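(* Let $\Phi:(0,\infty)\to\mathbb C$ be measurable, let $c\in(-1,0)$, assume $D_0:=\int_0^\infty\Phi(y)y^{-1}dy$ is finite and nonzero and $\int_0^\infty|\Phi(y)|y^{-c-1}dy<\infty$. Let $F(s)=\int_0^\infty y^{s-1}\Phi(y)dy$ where absolutely convergent, $\mathcal K(s)=-\frac{\pi}{2}\frac{\Gamma(s+1)}{\sin(\pi s/2)}$, $\Xi(z)=z\int_0^\infty\frac{e^{-zt}}{1+t^2}dt$, $S(\mu)=\frac1{D_0}\int_0^\infty\frac{\Phi(y)}{y}\Xi(\mu y)dy$, and fix $\mu>0$. Define $I(s;\mu)=\frac{1}{D_0}\mathcal K(s)F(-s)\mu^{-s}$. Let $a<c<b$ and assume: (1) $I(s;\mu)$ admits a meromorphic continuation to the strip $a<\Re s<b$; (2) for every $\sigma\in(a,b)$ such that the line $\Re s=\sigma$ contains no pole of $I$, $A(\sigma):=\int_{-\infty}^\infty\big|\frac1{D_0}\mathcal K(\sigma+it)F(-\sigma-it)\big|dt<\infty$; (3) for all $\sigma_1<\sigma_2$ with $[\sigma_1,\sigma_2]\subset(a,b)$, $\int_{\sigma_1}^{\sigma_2}|I(\sigma+iT;\mu)|d\sigma\to0$ and $\int_{\sigma_1}^{\sigma_2}|I(\sigma-iT;\mu)|d\sigma\to0$ as $T\to\infty$ (along $T$ for which the horizontal lines $\Im s=\pm T$ contain no pole). Then for any $a<\sigma_-<c<\sigma_+<b$ such that the lines $\Re s=\sigma_\pm$ contain no poles, $$S(\mu)=\sum_{\sigma_-<\Re\rho<c}\operatorname{Res}_{s=\rho}I(s;\mu)+\frac1{2\pi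 i}\int_{(\sigma_-)}I(s;\mu)\,ds,$$ $$S(\mu)=-\sum_{c<\Re\rho<\sigma_+}\operatorname{Res}_{s=\rho}I(s;\mu)+\frac1{2\pi i}\int_{(\sigma_+)}I(s;\mu)\,ds,$$ where each residue sum is understood as $\lim_{T\to\infty}$ of the sum over poles $\rho$ in the indicated vertical strip with $|\Im\rho|<T$. Moreover, for every pole-free $\sigma\in(a,b)$, $$\Big|\frac1{2\pi i}\int_{(\sigma)}I(s;\mu)\,ds\Big|\le\frac{\mu^{-\sigma}}{2\pi}A(\sigma).$$ Finally, if $\mathcal K(s)F(-s)=\sum_{j=1}^m a_{-j}(s-\rho)^{-j}+O(1)$ as $s\to\rho$ (a pole of order $m$), then $$\operatorname{Res}_{s=\rho}I(s;\mu)=\mu^{-\rho}P_{\rho,m-1}(\log\mu),\qquad P_{\rho,m-1}(L)=\frac1{D_0}\sum_{j=1}^m a_{-j}\frac{(-L)^{j-1}}{(j-1)!}.$$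
   Context: $\int_{(\sigma)}$ denotes integration upward along the vertical line $\Re s=\sigma$. *)

(* Defs.v *)
From HB Require Import structures.
From mathcomp Require Import all_boot all_order all_algebra.
From mathcomp Require Import all_classical all_reals all_analysis.
From mathcomp Require Import complex.
Import Order.TTheory GRing.Theory Num.Theory numFieldNormedType.Exports.

Set Implicit Arguments.
Unset Strict Implicit.
Unset Printing Implicit Defensive.

Local Open Scope ring_scope.
Local Open Scope classical_set_scope.

(* R[i] as a normed module over itself (its numFieldType norm/topology);
   this makes [derivable f z 1] the complex derivative. *)
HB.instance Definition _ (R : rcfType) :=
  NormedModule.copy R[i] (R[i] : numFieldType).

Section Defs.
Variable R : realType.

Notation mu := (@lebesgue_measure R).

Definition cre (z : R[i]) : R := complex.Re z.
Definition cim (z : R[i]) : R := complex.Im z.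
Definition rc (x : R) : R[i] := Complex x 0.
Definition ci : R[i] := Complex 0 1.
Definition cabs (z : R[i]) : R := Num.sqrt (cre z ^+ 2 + cim z ^+ 2).

Definition cexp (z : R[i]) : R[i] :=
  Complex (expR (cre z) * cos (cim z)) (expR (cre z) * sin (cim z)).
Definition cpow (y : R) (s : R[i]) : R[i] := cexp (s * rc (ln y)).
Definition csin (z : R[i]) : R[i] :=
  (cexp (ci * z) - cexp (- (ci * z))) / (rc 2 * ci).

(* Euler's Gamma function, via Gauss' product formula
   Gamma(z) = lim n! n^z / (z (z+1) ... (z+n))  (z not in {0,-1,-2,...}) *)
Definition cGamma (z : R[i]) : R[i] :=
  limn (fun n : nat => rc (n`!)%:R * cpow n%:R z /
                        \prod_(k < n.+1) (z + rc k%:R)).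

Definition Kfun (s : R[i]) : R[i] :=
  - rc (pi / 2) * cGamma (s + 1) / csin (rc pi * s / rc 2).

(* the poles of the formula for K: s+1 in {0,-1,-2,...} or sin(pi s/2)=0 *)
Definition Kpole (s : R[i]) : Prop :=
  (exists n : nat, s = - rc (n.+1)%:R) \/ (exists k : int, s = rc (2 * k%:~R)).

Definition cmeasurable (D : set R) (f : R -> R[i]) : Prop :=
  measurable_fun D (cre \o f) /\ measurable_fun D (cim \o f).
Definition cintegrable (D : set R) (f : R -> R[i]) : Prop :=
  mu.-integrable D (fun x => (cre (f x))%:E) /\
  mu.-integrable D (fun x => (cim (f x))%:E).
Definition cintegral (D : set R) (f : R -> R[i]) : R[i] :=
  Complex (Rintegral mu D (cre \o f)) (Rintegral mu D (cim \o f)).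

Definition Mellin_abs (Phi : R -> R[i]) (s : R[i]) : Prop :=
  cintegrable `]0, +oo[ (fun y => cpow y (s - 1) * Phi y).
Definition Mellin (Phi : R -> R[i]) (s : R[i]) : R[i] :=
  cintegral `]0, +oo[ (fun y => cpow y (s - 1) * Phi y).

Definition D0 (Phi : R -> R[i]) : R[i] :=
  cintegral `]0, +oo[ (fun y => Phi y / rc y).

Definition Xi (z : R) : R :=
  z * Rintegral mu `[0, +oo[ (fun t => expR (- (z * t)) / (1 + t ^+ 2)).

Definition Sfun (Phi : R -> R[i]) (m : R) : R[i] :=
  (D0 Phi)^-1 * cintegral `]0, +oo[ (fun y => Phi y / rc y * rc (Xi (m * y))).

Definition Iform (Phi : R -> R[i]) (m : R) (s : R[i]) : R[i] :=
  (D0 Phi)^-1 * Kfun s * Mellin Phi (- s) * cpow m (- s).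

Definition strip (a b : R) : set R[i] := [set s | a < cre s < b].

Definition meromorphic_on (U : set R[i]) (f : R[i] -> R[i]) (P : set R[i])
  : Prop :=
  [/\ open U, P `<=` U,
      (forall z, U z -> exists2 r : R, 0 < r &
          forall w, P w -> 0 < cabs (w - z) -> r <= cabs (w - z)),
      (forall z, U z -> ~ P z -> derivable f z 1) &
      (forall p, P p -> forall M : R, exists2 d : R, 0 < d &
          forall s, 0 < cabs (s - p) < d -> M < cabs (f s))].

Definition vline_int (sigma : R) (f : R[i] -> R[i]) : R[i] :=
  ci * cintegral setT (fun t => f (Complex sigma t)).

Definition circle_int (f : R[i] -> R[i]) (rho : R[i]) (eps : R) : R[i] :=
  cintegral `[0, 2 * pi]
    (fun th => f (rho + rc eps * cexp (ci * rc th)) *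
               (ci * rc eps * cexp (ci * rc th))).

Definition Res (f : R[i] -> R[i]) (rho : R[i]) : R[i] :=
  lim ((circle_int f rho eps / (rc (2 * pi) * ci)) @[eps --> 0^'+]).

(* A(sigma) = int_{-oo}^{oo} |D_0^{-1} K(sigma+it) F(-sigma-it)| dt, where
   D_0^{-1} K(s) F(-s) is (the continuation) I(s) mu^{s} *)
Definition A_int (I : R[i] -> R[i]) (m sigma : R) : \bar R :=
  (\int[mu]_(t in setT)
     (cabs (I (Complex sigma t) * cpow m (Complex sigma t)))%:E)%E.

End Defs.
Arguments ci {R}.

(* Main.v *)
Require Import Defs.
From HB Require Import structures.
From mathcomp Require Import all_boot all_order all_algebra.
From mathcomp Require Import all_classical all_reals all_analysis.
From mathcomp Require Import complex measurable_realfun ring lra.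
Import Order.TTheory GRing.Theory Num.Theory numFieldNormedType.Exports.
Set Implicit Arguments.
Unset Strict Implicit.
Unset Printing Implicit Defensive.
Local Open Scope ring_scope.
Local Open Scope classical_set_scope.

(** Write K(s) = B(s) Gamma(s+1) with B(s) = - (pi/2) / sin(pi s/2).  On -1 < Re s < 0
    Euler's integral gives Gamma(s+1) x^(-s) = x int_0^oo e^(-xt) t^s dt, and B is the
    Mellin transform of 1/(1+t^2): moving the line Re s = c to Re s = c - 2 multiplies the
    integrand t^s B(s) by - t^(-2), and the only pole crossed is s = -2.  By Fubini the
    inverse Mellin transform of K is Xi, and a second application of Fubini gives
    S = (2 pi i)^-1 int_(c) I.  In particular I stays bounded near Re s = c, so there is no
    pole on that line.  The two expansions are the residue theorem on rectangles
    [sl, sr] x [-T, T]; as the poles are locally finite they are countable, so T can be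
    chosen off their ordinates without changing the set of enclosed poles.  The residue
    theorem itself comes from a Goursat theorem for images of rectangles under smooth maps:
    the region between a circle and a rectangle around it is cut into five such images. *)

(** * Complex numbers in coordinates *)

(** The line Re s = c is not assumed free of poles, yet both expansions use it as a side of their
    rectangles; this is why the boundedness of I there has to be proved and why it relies on the
    explicit formula, not on the continuation. The step 2 is the antiperiod of sin(pi s/2): it makes
    the left side of the rectangle a multiple of the right one, so that letting the height grow
    leaves a linear equation for the integral of t^s B(s), with nonzero coefficient 1 + t^(-2). All
    absolute convergence in the vertical direction comes from B: on the line |sin(pi s/2)| grows at
    least like 1 + y^2, while |t^s| = t^c does not depend on y, so every double integral is
    dominated by a product of a function of y and a function of t. Residues are limits of circle
    integrals whereas contours are rectangles. Goursat's theorem is therefore proved in parameter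
    space: the parameter rectangle is bisected, and its image may be the sector between an arc and a
    segment. *)

Section Complex.
Variable R : realType.
Implicit Types (z w : R[i]) (x y : R).

Lemma eqC z w : cre z = cre w -> cim z = cim w -> z = w.
Proof. by case: z w => [a b] [c d] /= -> ->. Qed.

Lemma creD z w : cre (z + w) = cre z + cre w. Proof. by case: z w => [? ?] []. Qed.
Lemma cimD z w : cim (z + w) = cim z + cim w. Proof. by case: z w => [? ?] []. Qed.
Lemma creN z : cre (- z) = - cre z. Proof. by case: z. Qed.
Lemma cimN z : cim (- z) = - cim z. Proof. by case: z. Qed.
Lemma creM z w : cre (z * w) = cre z * cre w - cim z * cim w.
Proof. by case: z w => [? ?] []. Qed.
Lemma cimM z w : cim (z * w) = cre z * cim w + cim z * cre w.
Proof. by case: z w => [? ?] [? ?] /=. Qed.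
Lemma cre0 : cre (0 : R[i]) = 0. Proof. by []. Qed.
Lemma cim0 : cim (0 : R[i]) = 0. Proof. by []. Qed.
Lemma cre1 : cre (1 : R[i]) = 1. Proof. by []. Qed.
Lemma cim1 : cim (1 : R[i]) = 0. Proof. by []. Qed.
Lemma cre_rc x : cre (rc x) = x. Proof. by []. Qed.
Lemma cim_rc x : cim (rc x) = 0. Proof. by []. Qed.
Lemma cre_ci : cre (ci : R[i]) = 0. Proof. by []. Qed.
Lemma cim_ci : cim (ci : R[i]) = 1. Proof. by []. Qed.
Lemma creC x y : cre (Complex x y) = x. Proof. by []. Qed.
Lemma cimC x y : cim (Complex x y) = y. Proof. by []. Qed.

Definition cE := (creD, cimD, creN, cimN, creM, cimM, cre0, cim0, cre1, cim1,
  cre_rc, cim_rc, cre_ci, cim_ci, creC, cimC).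

Lemma ComplexE z : z = rc (cre z) + ci * rc (cim z).
Proof. by apply: eqC; rewrite !cE; ring. Qed.

Lemma rcD x y : rc (x + y) = rc x + rc y.
Proof. by apply: eqC; rewrite !cE ?addr0. Qed.
Lemma rcN x : rc (- x) = - rc x.
Proof. by apply: eqC; rewrite !cE ?oppr0. Qed.
Lemma rcB x y : rc (x - y) = rc x - rc y.
Proof. by rewrite rcD rcN. Qed.
Lemma rcM x y : rc (x * y) = rc x * rc y.
Proof. by apply: eqC; rewrite !cE; ring. Qed.
Lemma rc0 : rc 0 = 0 :> R[i]. Proof. by []. Qed.
Lemma rc1 : rc 1 = 1 :> R[i]. Proof. by []. Qed.
Lemma rcV x : rc x^-1 = (rc x)^-1.
Proof. exact: (fmorphV (@real_complex R)). Qed.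
Lemma rc_eq0 x : (rc x == 0) = (x == 0).
Proof. exact: (fmorph_eq0 (@real_complex R)). Qed.
Lemma rc_nat n : rc n%:R = n%:R :> R[i].
Proof. exact: (rmorph_nat (@real_complex R)). Qed.
Lemma ci_neq0 : (ci : R[i]) != 0.
Proof. by apply/eqP => /(congr1 (@cim R)); rewrite !cE => /eqP; rewrite oner_eq0. Qed.
Lemma ci2 : ci * ci = -1 :> R[i].
Proof. by apply: eqC; rewrite !cE; ring. Qed.

Lemma cabsE z : `|z| = rc (cabs z). Proof. by case: z. Qed.
Lemma le_rc x y : (rc x <= rc y) = (x <= y). Proof. exact: lecR. Qed.
Lemma lt_rc x y : (rc x < rc y) = (x < y). Proof. exact: ltcR. Qed.
Lemma rc_inj : injective (@rc R). Proof. by move=> x y []. Qed.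
Lemma cabs_ge0 z : 0 <= cabs z. Proof. exact: sqrtr_ge0. Qed.
Lemma cabsM z w : cabs (z * w) = cabs z * cabs w.
Proof. by apply: rc_inj; rewrite rcM -!cabsE normrM. Qed.
Lemma cabsD z w : cabs (z + w) <= cabs z + cabs w.
Proof. by rewrite -le_rc rcD -!cabsE ler_normD. Qed.
Lemma cabsN z : cabs (- z) = cabs z.
Proof. by apply: rc_inj; rewrite -!cabsE normrN. Qed.
Lemma cabsBC z w : cabs (z - w) = cabs (w - z).
Proof. by rewrite -cabsN opprB. Qed.
Lemma cabsB z w : cabs (z - w) <= cabs z + cabs w.
Proof. by rewrite (le_trans (cabsD _ _)) // cabsN. Qed.
Lemma cabsBD z w t : cabs (z - t) <= cabs (z - w) + cabs (w - t).
Proof. by rewrite (le_trans _ (cabsD _ _)) // addrA subrK. Qed.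
Lemma cabs_sub z w : cabs z - cabs w <= cabs (z - w).
Proof. by rewrite lerBlDr (le_trans _ (cabsD _ _)) // subrK. Qed.
Lemma cabsV z : cabs z^-1 = (cabs z)^-1.
Proof. by apply: rc_inj; rewrite rcV -!cabsE normfV. Qed.
Lemma cabs_eq0 z : (cabs z == 0) = (z == 0).
Proof. by rewrite -rc_eq0 -cabsE normr_eq0. Qed.
Lemma cabs_gt0 z : (0 < cabs z) = (z != 0).
Proof. by rewrite lt_neqAle cabs_ge0 andbT eq_sym cabs_eq0. Qed.
Lemma cabs0 : cabs (0 : R[i]) = 0. Proof. by apply/eqP; rewrite cabs_eq0. Qed.
Lemma cabs_rc x : cabs (rc x) = `|x|.
Proof. by rewrite /cabs !cE expr0n addr0 sqrtr_sqr. Qed.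
Lemma cabs1 : cabs (1 : R[i]) = 1. Proof. by rewrite -rc1 cabs_rc normr1. Qed.
Lemma cabs_ci : cabs (ci : R[i]) = 1.
Proof. by rewrite /cabs !cE expr0n add0r expr1n sqrtr1. Qed.
Lemma cre_le z : `|cre z| <= cabs z.
Proof. by rewrite -sqrtr_sqr ler_wsqrtr // lerDl sqr_ge0. Qed.
Lemma cim_le z : `|cim z| <= cabs z.
Proof. by rewrite -sqrtr_sqr ler_wsqrtr // lerDr sqr_ge0. Qed.
Lemma cabs_le z : cabs z <= `|cre z| + `|cim z|.
Proof.
rewrite {1}(ComplexE z) (le_trans (cabsD _ _)) // cabsM cabs_ci mul1r !cabs_rc.
by [].
Qed.

Lemma cabs_sqr z : cabs z ^+ 2 = cre z ^+ 2 + cim z ^+ 2.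
Proof. by rewrite sqr_sqrtr // addr_ge0 // sqr_ge0. Qed.

Lemma cexpD z w : cexp (z + w) = cexp z * cexp w.
Proof.
apply: eqC; rewrite !cE expRD ?cosD ?sinD; ring.
Qed.
Lemma cexp0 : cexp (0 : R[i]) = 1.
Proof. by apply: eqC; rewrite !cE expR0 ?cos0 ?sin0 ?mulr1 ?mulr0. Qed.
Lemma cabs_cexp z : cabs (cexp z) = expR (cre z).
Proof.
rewrite /cabs !cE !exprMn -mulrDr cos2Dsin2 mulr1 sqrtr_sqr ger0_norm //.
Qed.
Lemma cexp_neq0 z : cexp z != 0.
Proof. by rewrite -cabs_gt0 cabs_cexp expR_gt0. Qed.
Lemma cexpN z : cexp (- z) = (cexp z)^-1.
Proof.
by apply: (mulIf (cexp_neq0 z)); rewrite -cexpD addNr cexp0 mulVf ?cexp_neq0.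
Qed.
Lemma cexp_rc x : cexp (rc x) = rc (expR x).
Proof. by apply: eqC; rewrite !cE ?cos0 ?sin0 ?mulr1 ?mulr0. Qed.

Lemma cpowD y z w : cpow y (z + w) = cpow y z * cpow y w.
Proof. by rewrite /cpow mulrDl cexpD. Qed.
Lemma cpowN y z : cpow y (- z) = (cpow y z)^-1.
Proof. by rewrite /cpow mulNr cexpN. Qed.
Lemma cpow_neq0 y z : cpow y z != 0. Proof. exact: cexp_neq0. Qed.
Lemma cpow1 y : 0 < y -> cpow y 1 = rc y.
Proof. by move=> y0; rewrite /cpow mul1r cexp_rc lnK. Qed.
Lemma cabs_cpow y z : 0 < y -> cabs (cpow y z) = powR y (cre z).
Proof.
move=> y0; rewrite cabs_cexp /powR gt_eqF // !cE mulr0 subr0 //.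
Qed.
Lemma cpowMl x y z : 0 < x -> 0 < y -> cpow (x * y) z = cpow x z * cpow y z.
Proof. by move=> x0 y0; rewrite /cpow lnM // rcD mulrDr cexpD. Qed.
Lemma cpowV x z : 0 < x -> cpow x^-1 z = cpow x (- z).
Proof. by move=> x0; rewrite /cpow lnV // rcN mulrN mulNr. Qed.
End Complex.

(** * Paths in the complex plane and complex differentiability *)

Section Calculus.
Variable R : realType.
Implicit Types (g h : R -> R[i]) (f : R[i] -> R[i]) (x y : R) (z w : R[i]).

(** Maps from R to R[i] are handled by components, which makes real calculus available. Maps of a
    complex variable ([ccf], [holo]) are handled in epsilon-delta form with the real modulus [cabs],
    because the norm of R[i] takes its values in R[i]. *)
Definition ccont g x :=
  {for x, continuous (@cre R \o g)} /\ {for x, continuous (@cim R \o g)}.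

Definition cder g x (l : R[i]) :=
  is_derive x 1 (@cre R \o g) (cre l) /\ is_derive x 1 (@cim R \o g) (cim l).

Definition ccf f z := forall e : R, 0 < e -> exists2 d : R, 0 < d &
  forall w, cabs (w - z) < d -> cabs (f w - f z) <= e.

(** The inequality includes [w = z], where both sides vanish, so no punctured neighbourhood has to
    be carried along. *)
Definition holo f z := exists l : R[i], forall e : R, 0 < e ->
  exists2 d : R, 0 < d & forall w, cabs (w - z) < d ->
    cabs (f w - f z - l * (w - z)) <= e * cabs (w - z).

Lemma contP (k : R -> R) x : {for x, continuous k} <->
  (forall e : R, 0 < e -> exists2 d : R, 0 < d &
     forall y, `|y - x| < d -> `|k y - k x| <= e).
Proof.
split.
  move=> /cvgrPdist_le H e e0; have /nbhs_ballP[d /= d0 Hd] := H _ e0.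
  exists d => // y yx; rewrite distrC; apply: Hd; rewrite /ball /= distrC //.
move=> H; apply/cvgrPdist_le => e e0; have [d d0 Hd] := H _ e0.
apply/nbhs_ballP; exists d => // y; rewrite /ball /= distrC => yx.
by rewrite distrC; exact: Hd.
Qed.

Lemma ccontP g x : ccont g x <->
  (forall e : R, 0 < e -> exists2 d : R, 0 < d &
     forall y, `|y - x| < d -> cabs (g y - g x) <= e).
Proof.
split.
  move=> [/contP H1 /contP H2] e e0.
  have e20 : 0 < e / 2 by rewrite divr_gt0.
  have [d1 d10 D1] := H1 _ e20; have [d2 d20 D2] := H2 _ e20.
  exists (Num.min d1 d2); first by rewrite lt_min d10.
  move=> y; rewrite lt_min => /andP[/D1 + /D2]; rewrite /= => A B.
  rewrite (le_trans (cabs_le _)) // !cE.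
  by rewrite [leRHS](splitr e) lerD.
move=> H; split; apply/contP => e /H[d d0 Hd]; exists d => // y /Hd; apply: le_trans => /=.
  by rewrite -creN -creD cre_le.
by rewrite -cimN -cimD cim_le.
Qed.

Lemma ccont_cst z x : ccont (fun=> z) x.
Proof. by split; exact: cst_continuous. Qed.

Lemma ccontD g h x : ccont g x -> ccont h x -> ccont (fun t => g t + h t) x.
Proof.
move=> [a b] [c d]; split.
  rewrite (_ : _ \o _ = (@cre R \o g) \+ (@cre R \o h)); last by apply/funext => t; rewrite /= creD.
  exact: continuousD.
rewrite (_ : _ \o _ = (@cim R \o g) \+ (@cim R \o h)); last by apply/funext => t; rewrite /= cimD.
exact: continuousD.
Qed.

Lemma ccontM g h x : ccont g x -> ccont h x -> ccont (fun t => g t * h t) x.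
Proof.
move=> [a b] [c d]; split.
  rewrite (_ : _ \o _ = (fun t => (@cre R \o g) t * (@cre R \o h) t - (@cim R \o g) t * (@cim R \o h) t)); last first.
    by apply/funext => t; rewrite /= creM.
  by apply: continuousB; exact: continuousM.
rewrite (_ : _ \o _ = (fun t => (@cre R \o g) t * (@cim R \o h) t + (@cim R \o g) t * (@cre R \o h) t)); last first.
  by apply/funext => t; rewrite /= cimM.
by apply: continuousD; exact: continuousM.
Qed.

Lemma ccont_comp f g x : ccf f (g x) -> ccont g x -> ccont (fun t => f (g t)) x.
Proof.
move=> F /ccontP G; apply/ccontP => e /F[d d0 Hd].
have [d' d'0 Hd'] := G _ (divr_gt0 d0 (ltr0n R 2)).
exists d' => // y /Hd' yd; apply: Hd; rewrite (le_lt_trans yd) //.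
by rewrite ltr_pdivrMr // ltr_pMr // ltr1n.
Qed.

Lemma cder_cont g x l : cder g x l -> ccont g x.
Proof. by move=> [[A _] [B _]]; split; apply/differentiable_continuous/derivable1_diffP. Qed.

Lemma cder_cst z x : cder (fun=> z) x 0.
Proof. by split; exact: is_derive_cst. Qed.

Lemma cder_eq g x l l' : cder g x l -> l = l' -> cder g x l'.
Proof. by move=> ? <-. Qed.

Lemma cderD g h x l k : cder g x l -> cder h x k -> cder (fun t => g t + h t) x (l + k).
Proof.
move=> [a b] [c d]; split; rewrite !cE.
  rewrite (_ : _ \o _ = (@cre R \o g) \+ (@cre R \o h)); last by apply/funext => t; rewrite /= creD.
  exact: is_deriveD.
rewrite (_ : _ \o _ = (@cim R \o g) \+ (@cim R \o h)); last by apply/funext => t; rewrite /= cimD.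
exact: is_deriveD.
Qed.

Lemma cderM g h x l k : cder g x l -> cder h x k ->
  cder (fun t => g t * h t) x (l * h x + g x * k).
Proof.
move=> [a b] [c d]; split.
  rewrite (_ : _ \o _ = ((@cre R \o g) * (@cre R \o h) - (@cim R \o g) * (@cim R \o h))); last first.
    by apply/funext => t; rewrite /= creM.
  apply: is_derive_eq (is_deriveB (is_deriveM a c) (is_deriveM b d)) _.
  by rewrite !cE /GRing.scale /=; ring.
rewrite (_ : _ \o _ = ((@cre R \o g) * (@cim R \o h) + (@cim R \o g) * (@cre R \o h))); last first.
  by apply/funext => t; rewrite /= cimM.
apply: is_derive_eq (is_deriveD (is_deriveM a d) (is_deriveM b c)) _.
by rewrite !cE /GRing.scale /=; ring.
Qed.

Lemma cderZ z g x l : cder g x l -> cder (fun t => z * g t) x (z * l).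
Proof. by move=> H; apply: cder_eq (cderM (cder_cst z x) H) _; rewrite mul0r add0r. Qed.

Lemma cder_rc (k : R -> R) x l : is_derive x 1 k l -> cder (fun t => rc (k t)) x (rc l).
Proof. by move=> kx; split => //; exact: is_derive_cst. Qed.

Lemma cder_id x : cder (@rc R) x 1.
Proof. exact: (@cder_rc id x 1 (is_derive_id _ _)). Qed.

Lemma cder_exp g x l : cder g x l -> cder (fun t => cexp (g t)) x (l * cexp (g x)).
Proof.
move=> [a b]; split.
  rewrite (_ : _ \o _ = (expR \o (@cre R \o g)) * (cos \o (@cim R \o g))); last by [].
  apply: is_derive_eq; rewrite !cE /GRing.scale /=; ring.
rewrite (_ : _ \o _ = (expR \o (@cre R \o g)) * (sin \o (@cim R \o g))); last by [].
apply: is_derive_eq; rewrite !cE /GRing.scale /=; ring.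
Qed.

Lemma holo_ccf f z : holo f z -> ccf f z.
Proof.
move=> [l H] e e0; have [d d0 Hd] := H 1 ltr01.
pose K := 1 + cabs l; have K0 : 0 < K by rewrite ltr_pwDl // cabs_ge0.
exists (Num.min d (e / K)); first by rewrite lt_min d0 divr_gt0.
move=> w; rewrite lt_min => /andP[/Hd A B].
rewrite -(subrK (l * (w - z)) (f w - f z)) (le_trans (cabsD _ _)) //.
rewrite cabsM (le_trans (lerD A (lexx _))) // -mulrDl -/K.
by rewrite mulrC -ler_pdivlMr // ltW.
Qed.

Lemma derivable_holo f z : derivable f z 1 -> holo f z.
Proof.
move=> /cvg_ex[l /cvgrPdist_le H]; exists l => e e0.
have e0' : 0 < rc e by rewrite -rc0 lt_rc.
have /nbhs_ballP[d /= d0] := H _ e0'.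
(* Radii in R[i] are complex numbers; positivity forces the imaginary part to vanish, so [d] comes
   from a real radius. *)
have dE : d = rc (cre d) by apply: eqC; rewrite ?cE //; move: d0; rewrite ltcE => /andP[/eqP].
have d0' : 0 < cre d by rewrite -lt_rc -dE.
move=> Hd; exists (cre d) => // w wd.
have [->|wz] := eqVneq w z; first by rewrite !subrr mulr0 subr0 cabs0 mulr0.
have wz0 : w - z != 0 by rewrite subr_eq0.
have := Hd (w - z); rewrite /ball /= sub0r normrN cabsE dE lt_rc => /(_ wd wz0).
rewrite /GRing.scale /= mulr1 subrK cabsE le_rc => B.
rewrite (_ : f w - f z - l * (w - z) = - (w - z) * (l - (w - z)^-1 * (f w - f z))); last by field.
by rewrite cabsM cabsN mulrC ler_wpM2r // cabs_ge0.
Qed.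

End Calculus.

(** * Integrals of complex-valued functions *)

Section Integral.
Variable R : realType.
Notation mu := (@lebesgue_measure R).
Implicit Types (g h : R -> R[i]) (D : set (measurableTypeR R)) (a b x : R) (z w : R[i]).

Lemma eq_cintegral D g h : (forall x, D x -> g x = h x) ->
  cintegral D g = cintegral D h.
Proof.
by move=> gh; rewrite /cintegral; congr Complex; apply: eq_Rintegral => x /set_mem /gh /= ->.
Qed.

Lemma eq_cintegrable D g h : measurable D -> (forall x, D x -> g x = h x) ->
  cintegrable D g -> cintegrable D h.
Proof.
move=> mD gh [A B]; split; [apply: eq_integrable A|apply: eq_integrable B] => // x /set_mem /gh -> //.
Qed.

Lemma cintegrableD D g h : measurable D -> cintegrable D g -> cintegrable D h ->
  cintegrable D (fun x => g x + h x).
Proof.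
move=> mD [A B] [A' B']; split.
  under eq_fun do rewrite creD EFinD; exact: integrableD.
under eq_fun do rewrite cimD EFinD; exact: integrableD.
Qed.

Lemma cintegralD D g h : measurable D -> cintegrable D g -> cintegrable D h ->
  cintegral D (fun x => g x + h x) = cintegral D g + cintegral D h.
Proof.
move=> mD [A B] [A' B']; apply: eqC; rewrite !cE -RintegralD //;
  by apply: eq_Rintegral => x _; rewrite /= ?creD ?cimD.
Qed.

Lemma cintegrableZ D z g : measurable D -> cintegrable D g ->
  cintegrable D (fun x => z * g x).
Proof.
move=> mD [A B]; split.
  under eq_fun do rewrite creM EFinB !EFinM.
  by apply: integrableB => //; exact: integrableZl.
under eq_fun do rewrite cimM EFinD !EFinM.
by apply: integrableD => //; exact: integrableZl.
Qed.

Lemma cintegralZ D z g : measurable D -> cintegrable D g ->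
  cintegral D (fun x => z * g x) = z * cintegral D g.
Proof.
move=> mD [A B].
have I1 r (k : R -> R) : mu.-integrable D (EFin \o k) -> mu.-integrable D (EFin \o (fun x => r * k x)).
  by move=> I; rewrite (_ : _ \o _ = (fun x => r%:E * (EFin \o k) x)%E) //; exact: integrableZl.
apply: eqC; rewrite !cE.
  rewrite -!RintegralZl // -RintegralB //; try exact: I1.
  by apply: eq_Rintegral => x _; rewrite /= creM.
rewrite -!RintegralZl // -RintegralD //; try exact: I1.
by apply: eq_Rintegral => x _; rewrite /= cimM.
Qed.

Lemma cintegralN D g : measurable D -> cintegrable D g ->
  cintegral D (fun x => - g x) = - cintegral D g.
Proof.
move=> mD I; rewrite -mulN1r -cintegralZ //; apply: eq_cintegral => x _.
by rewrite mulN1r.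
Qed.

Lemma cintegrableN D g : measurable D -> cintegrable D g -> cintegrable D (fun x => - g x).
Proof.
move=> mD /(cintegrableZ (-1) mD); apply: eq_cintegrable => // x _.
by rewrite mulN1r.
Qed.

Lemma cintegralB D g h : measurable D -> cintegrable D g -> cintegrable D h ->
  cintegral D (fun x => g x - h x) = cintegral D g - cintegral D h.
Proof.
by move=> mD I J; rewrite cintegralD ?cintegralN //; exact: cintegrableN.
Qed.

Lemma measurable_cabs D g : cmeasurable D g -> measurable_fun D (@cabs R \o g).
Proof.
move=> [A B].
rewrite (_ : _ \o _ = Num.sqrt \o (fun x => (@cre R \o g) x ^+ 2 + (@cim R \o g) x ^+ 2)) //.
apply: measurableT_comp.
  by apply: continuous_measurable_fun; exact: sqrt_continuous.
by apply: measurable_funD; exact: measurable_funX.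
Qed.

Lemma cintegrable_measurable D g : cintegrable D g -> cmeasurable D g.
Proof.
by move=> [/measurable_int/measurable_EFinP A /measurable_int/measurable_EFinP B].
Qed.

Lemma cintegrable_dom D g (k : R -> R) : measurable D -> cmeasurable D g ->
  mu.-integrable D (EFin \o k) -> (forall x, D x -> cabs (g x) <= k x) ->
  cintegrable D g.
Proof.
move=> mD [A B] I gk; split; apply: (le_integrable mD _ _ I).
- exact/measurable_EFinP.
- move=> x Dx /=; rewrite lee_fin (le_trans (cre_le _)) // (le_trans (gk _ Dx)) //.
  by rewrite ler_norm.
- exact/measurable_EFinP.
- move=> x Dx /=; rewrite lee_fin (le_trans (cim_le _)) // (le_trans (gk _ Dx)) //.
  by rewrite ler_norm.
Qed.

Lemma integrable_cabs D g : measurable D -> cintegrable D g ->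
  mu.-integrable D (EFin \o (@cabs R \o g)).
Proof.
move=> mD I; have [A B] := I.
have J := integrableD mD (integrable_abse A) (integrable_abse B).
apply: (le_integrable mD _ _ J).
  by apply/measurable_EFinP; exact: (measurable_cabs (cintegrable_measurable I)).
move=> x Dx /=; rewrite lee_fin ger0_norm ?cabs_ge0 //.
rewrite ger0_norm ?addr_ge0 // ?normr_ge0 //; exact: cabs_le.
Qed.

Lemma cintegrableP D g : measurable D -> cmeasurable D g ->
  (\int[mu]_(x in D) (cabs (g x))%:E < +oo)%E -> cintegrable D g.
Proof.
move=> mD mg I; apply: (cintegrable_dom (k := @cabs R \o g)) => //.
apply/integrableP; split; first by apply/measurable_EFinP; exact: (measurable_cabs mg).
by under eq_integral => x _ do rewrite /= ger0_norm ?cabs_ge0 //.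
Qed.

(** Multiplying by the unimodular number [z] makes the integral real and nonnegative; it is then the
    integral of a real part, which the modulus dominates pointwise. *)
Lemma cabs_cintegral_le D g : measurable D -> cintegrable D g ->
  cabs (cintegral D g) <= Rintegral mu D (@cabs R \o g).
Proof.
move=> mD I; set w := cintegral D g.
have [w0|w0] := eqVneq w 0.
  by rewrite w0 cabs0; apply: Rintegral_ge0 => x _; exact: cabs_ge0.
pose z := (w^-1 * rc (cabs w)).
have zw : z * w = rc (cabs w) by rewrite /z mulrAC mulVf // mul1r.
have z1 : cabs z = 1 by rewrite /z cabsM cabsV cabs_rc ger0_norm ?cabs_ge0 // mulVf // cabs_eq0.
rewrite -[leLHS]cre_rc -zw -cintegralZ // /cintegral !cE.
have [A _] := cintegrableZ z mD I.
apply: le_Rintegral => //; first exact: integrable_cabs.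
move=> x Dx /=; rewrite (le_trans (ler_norm _)) // (le_trans (cre_le _)) //.
by rewrite cabsM z1 mul1r.
Qed.

Lemma cabs_cintegral_dom D g (k : R -> R) : measurable D -> cintegrable D g ->
  mu.-integrable D (EFin \o k) -> (forall x, D x -> cabs (g x) <= k x) ->
  cabs (cintegral D g) <= Rintegral mu D k.
Proof.
move=> mD I J gk; rewrite (le_trans (cabs_cintegral_le mD I)) //.
by apply: le_Rintegral => //; exact: integrable_cabs.
Qed.

(** The extended-real form matches the decay hypothesis on horizontal segments. *)
Lemma cabs_cintegral_lee D g : measurable D -> cintegrable D g ->
  ((cabs (cintegral D g))%:E <= \int[mu]_(x in D) (cabs (g x))%:E)%E.
Proof.
move=> mD I; have J := integrable_cabs mD I.
rewrite (le_trans (_ : _ <= (Rintegral mu D (@cabs R \o g))%:E)%E) //.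
  by rewrite lee_fin cabs_cintegral_le.
by rewrite /Rintegral fineK //; exact: integrable_fin_num.
Qed.

Lemma continuous_within (k : R -> R) a b :
  (forall x, a <= x <= b -> {for x, continuous k}) -> {within `[a, b], continuous k}.
Proof.
move=> H; apply: continuous_in_subspaceT => x /set_mem /=; rewrite in_itv /=.
exact: H.
Qed.

Lemma continuous_integrable (k : R -> R) a b :
  (forall x, a <= x <= b -> {for x, continuous k}) -> mu.-integrable `[a, b] (EFin \o k).
Proof.
move=> H; apply: continuous_compact_integrable; first exact: segment_compact.
exact: continuous_within.
Qed.

Lemma ccont_integrable g a b :
  (forall x, a <= x <= b -> ccont g x) -> cintegrable `[a, b] g.
Proof. by move=> H; split; apply: continuous_integrable => x /H[]. Qed.

Lemma cabs_cintegral_bound g a b (M : R) : a <= b ->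
  (forall x, a <= x <= b -> ccont g x) ->
  (forall x, a <= x <= b -> cabs (g x) <= M) ->
  cabs (cintegral `[a, b] g) <= M * (b - a).
Proof.
move=> ab cg gM.
rewrite (le_trans (cabs_cintegral_dom (k := cst M) _ (ccont_integrable cg) _ _)) //.
- by apply: continuous_integrable => x _; exact: cst_continuous.
- rewrite [leLHS](Rintegral_cst mu (measurable_itv `[a, b]%R)).
  suff H : fine (mu (`[a, b] : set R)) = b - a by rewrite -H.
  rewrite lebesgue_measure_itv /= lte_fin.
  by move: ab; rewrite le_eqVlt => /predU1P[->|->]; rewrite ?ltxx ?subrr ?mulr0.
Qed.

Lemma Rintegral_FTC (F k : R -> R) a b : a <= b ->
  (forall x, a <= x <= b -> is_derive x 1 F (k x)) ->
  (forall x, a <= x <= b -> {for x, continuous k}) ->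
  Rintegral mu `[a, b] k = F b - F a.
Proof.
rewrite le_eqVlt => /predU1P[<-|ab] dF ck.
  by rewrite set_itv1 Rintegral_set1 subrr.
have cF x : a <= x <= b -> {for x, continuous F}.
  by move=> /dF[d _]; apply/differentiable_continuous/derivable1_diffP.
rewrite /Rintegral (@continuous_FTC2 _ k F) //.
- exact: continuous_within.
- split.
  + by move=> x; rewrite in_itv /= => /andP[ax xb]; have [] := dF x _; rewrite ?(ltW ax) ?(ltW xb).
  + by apply: cvg_at_right_filter; apply: cF; rewrite lexx ltW.
  + by apply: cvg_at_left_filter; apply: cF; rewrite lexx ltW.
- move=> x; rewrite in_itv /= => /andP[ax xb]; rewrite derive1E.
  by apply: derive_val; apply: dF; rewrite (ltW ax) (ltW xb).
Qed.

Lemma cintegral_FTC g h a b : a <= b ->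
  (forall x, a <= x <= b -> cder h x (g x)) ->
  (forall x, a <= x <= b -> ccont g x) ->
  cintegral `[a, b] g = h b - h a.
Proof.
move=> ab dh cg; apply: eqC; rewrite !cE.
  by apply: (@Rintegral_FTC (@cre R \o h)) => // x xab; [case: (dh _ xab)|case: (cg _ xab)].
by apply: (@Rintegral_FTC (@cim R \o h)) => // x xab; [case: (dh _ xab)|case: (cg _ xab)].
Qed.

Lemma cintegral_split g a b c : a <= b -> b <= c -> cintegrable `[a, c] g ->
  cintegral `[a, c] g = cintegral `[a, b] g + cintegral `[b, c] g.
Proof.
move=> ab bc [A B].
have S (k : R -> R) : mu.-integrable `[a, c] (EFin \o k) ->
   Rintegral mu `[a, c] k = Rintegral mu `[a, b] k + Rintegral mu `[b, c] k.
  move=> I; rewrite -(@Rintegral_itv_obnd_cbnd _ b); last first.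
    by apply: integrableS I => //; apply: subset_itv; rewrite bnd_simp.
  by rewrite -(@Rintegral_itvB _ k (BLeft a) (BRight c) b) // addrC subrK.
by apply: eqC; rewrite !cE S.
Qed.

End Integral.

(** * Goursat's theorem *)

Section Goursat.
Variable R : realType.
Implicit Types (f : R[i] -> R[i]) (a b c d u v x y : R) (z w : R[i]).

(* Where [f] is within [r] of an affine function, its integral along a path is that of the
   affine function, which has a primitive, up to [r * M] times the length. *)
Lemma path_integral_affine f (g g' : R -> R[i]) a b z l (r M : R) : a <= b ->
  (forall t, a <= t <= b -> [/\ cder g t (g' t), ccont g' t & ccf f (g t)]) ->
  (forall t, a <= t <= b -> cabs (g' t) <= M) ->
  (forall t, a <= t <= b -> cabs (f (g t) - z - l * g t) <= r) ->
  cabs (cintegral `[a, b] (fun t => f (g t) * g' t) -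
    ((z * g b + l / rc 2 * (g b * g b)) - (z * g a + l / rc 2 * (g a * g a))))
  <= r * M * (b - a).
Proof.
move=> ab H HM Hr; pose K t := z * g t + l / rc 2 * (g t * g t).
rewrite -/(K b) -/(K a).
have cg t : a <= t <= b -> ccont g t by move=> /H[/cder_cont].
have cg' t : a <= t <= b -> ccont g' t by move=> /H[].
have cf t : a <= t <= b -> ccont (fun t => f (g t)) t.
  by move=> tab; apply: ccont_comp (cg _ tab); case: (H _ tab).
pose k t := (z + l * g t) * g' t.
have ck t : a <= t <= b -> ccont k t.
  move=> tab; apply: ccontM (cg' _ tab); apply: ccontD (ccont_cst _ _) _.
  exact: ccontM (ccont_cst _ _) (cg _ tab).
have <- : cintegral `[a, b] k = K b - K a.
  apply: (@cintegral_FTC _ k K) => // t tab; have [dg _ _] := H _ tab.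
  apply: cder_eq (cderD (cderZ _ dg) (cderZ _ (cderM dg dg))) _.
  rewrite /k rcD rc1; field.
  by [].
rewrite -cintegralB //; last 2 first.
- by apply: ccont_integrable => t tab; apply: ccontM; [exact: cf|exact: cg'].
- exact: ccont_integrable.
rewrite (eq_cintegral (h := fun t => (f (g t) - z - l * g t) * g' t)); last first.
  by move=> t _; rewrite /k; ring.
apply: cabs_cintegral_bound; [exact: ab| |] => t tab.
  apply: ccontM (cg' _ tab).
  rewrite (_ : (fun t => _) = (fun t => f (g t) + (- z + (- l) * g t))); last first.
    by apply/funext => ?; ring.
  apply: ccontD (cf _ tab) _; apply: ccontD (ccont_cst _ _) _.
  exact: ccontM (ccont_cst _ _) (cg _ tab).
rewrite cabsM ler_pM ?cabs_ge0 //; [exact: Hr|exact: HM].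
Qed.

(** The common point is the supremum of the left ends; nestedness makes every right end an upper
    bound of all left ends. *)
Lemma nested_halving (u : nat -> R) (w : R) : 0 <= w ->
  (forall n, u n <= u n.+1) ->
  (forall n, u n.+1 + w / 2 ^+ n.+1 <= u n + w / 2 ^+ n) ->
  exists x, forall n, u n <= x <= u n + w / 2 ^+ n.
Proof.
move=> w0 ui ud.
have um m n : (m <= n)%N -> u m <= u n.
  by move=> /subnK <-; elim: (n - m)%N => // k IH; rewrite addSn (le_trans IH).
have udm m n : (m <= n)%N -> u n + w / 2 ^+ n <= u m + w / 2 ^+ m.
  by move=> /subnK <-; elim: (n - m)%N => // k IH; rewrite addSn (le_trans _ IH).
have w0n n : 0 <= w / 2 ^+ n by rewrite divr_ge0 // exprn_ge0.
have B n m : u m <= u n + w / 2 ^+ n.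
  rewrite (le_trans (um _ _ (leq_maxl m n))) //.
  by rewrite (le_trans _ (udm _ _ (leq_maxr m n))) // lerDl.
pose S := range u.
have S0 : S !=set0 by exists (u 0%N), 0%N.
have Sub n : ubound S (u n + w / 2 ^+ n) by move=> _ [m _ <-].
exists (sup S) => n; apply/andP; split; last exact: ge_sup.
by apply: ub_le_sup; [exists (u 0%N + w / 2 ^+ 0)|exists n].
Qed.

(* [H] parametrizes a region by the rectangle [a, b] x [c, d]; [Hu] and [Hv] are its partial
   derivatives.  Degenerate sides are allowed. *)
Variables (f : R[i] -> R[i]) (H Hu Hv : R -> R -> R[i]).

Definition bdry u0 u1 v0 v1 : R[i] :=
  cintegral `[u0, u1] (fun u => f (H u v0) * Hu u v0)
  + cintegral `[v0, v1] (fun v => f (H u1 v) * Hv u1 v)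
  - cintegral `[u0, u1] (fun u => f (H u v1) * Hu u v1)
  - cintegral `[v0, v1] (fun v => f (H u0 v) * Hv u0 v).

Variables (a b c d M : R).
Hypothesis Hder : forall u v, a <= u <= b -> c <= v <= d ->
  cder (H^~ v) u (Hu u v) /\ cder (H u) v (Hv u v).
Hypothesis Hcont : forall u v, a <= u <= b -> c <= v <= d ->
  ccont (Hu^~ v) u /\ ccont (Hv u) v.
Hypothesis Hbnd : forall u v, a <= u <= b -> c <= v <= d ->
  cabs (Hu u v) <= M /\ cabs (Hv u v) <= M.
Hypothesis fholo : forall u v, a <= u <= b -> c <= v <= d -> holo f (H u v).

Lemma ccont_sideu u v : a <= u <= b -> c <= v <= d -> ccont (fun u => f (H u v) * Hu u v) u.
Proof.
move=> uab vcd; have [/cder_cont A _] := Hder uab vcd; have [B _] := Hcont uab vcd.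
apply: ccontM B; apply: ccont_comp A; apply: holo_ccf; exact: fholo.
Qed.

Lemma ccont_sidev u v : a <= u <= b -> c <= v <= d -> ccont (fun v => f (H u v) * Hv u v) v.
Proof.
move=> uab vcd; have [_ /cder_cont A] := Hder uab vcd; have [_ B] := Hcont uab vcd.
apply: ccontM B; apply: ccont_comp A; apply: holo_ccf; exact: fholo.
Qed.

Lemma bdry_splitu u0 u1 u2 v0 v1 : a <= u0 -> u0 <= u1 -> u1 <= u2 -> u2 <= b ->
  c <= v0 -> v0 <= v1 -> v1 <= d ->
  bdry u0 u2 v0 v1 = bdry u0 u1 v0 v1 + bdry u1 u2 v0 v1.
Proof.
move=> *; rewrite /bdry !(@cintegral_split _ _ u0 u1 u2) //; first ring;
  apply: ccont_integrable => t /andP[? ?]; apply: ccont_sideu; lra.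
Qed.

Lemma bdry_splitv u0 u1 v0 v1 v2 : a <= u0 -> u0 <= u1 -> u1 <= b ->
  c <= v0 -> v0 <= v1 -> v1 <= v2 -> v2 <= d ->
  bdry u0 u1 v0 v2 = bdry u0 u1 v0 v1 + bdry u0 u1 v1 v2.
Proof.
move=> *; rewrite /bdry !(@cintegral_split _ _ v0 v1 v2) //; first ring;
  apply: ccont_integrable => t /andP[? ?]; apply: ccont_sidev; lra.
Qed.

(** The mean value inequality in complex form: the increment is the integral of the derivative,
    which is bounded by [M]. *)
Lemma lipu u u' v : a <= u -> u <= u' -> u' <= b -> c <= v <= d ->
  cabs (H u' v - H u v) <= M * (u' - u).
Proof.
move=> au uu' ub vcd; rewrite -(@cintegral_FTC _ (Hu^~ v) (H^~ v)) //.
- apply: cabs_cintegral_bound; [exact: uu'| |] => t /andP[? ?].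
    by case: (@Hcont t v) => //; lra.
  by case: (@Hbnd t v) => //; lra.
- by move=> t /andP[? ?]; case: (@Hder t v) => //; lra.
- by move=> t /andP[? ?]; case: (@Hcont t v) => //; lra.
Qed.

Lemma lipv u v v' : c <= v -> v <= v' -> v' <= d -> a <= u <= b ->
  cabs (H u v' - H u v) <= M * (v' - v).
Proof.
move=> au uu' ub vcd; rewrite -(@cintegral_FTC _ (Hv u) (H u)) //.
- apply: cabs_cintegral_bound; [exact: uu'| |] => t /andP[? ?].
    by case: (@Hcont u t) => //; lra.
  by case: (@Hbnd u t) => //; lra.
- by move=> t /andP[? ?]; case: (@Hder u t) => //; lra.
- by move=> t /andP[? ?]; case: (@Hcont u t) => //; lra.
Qed.

Lemma lipuv u u' v v' (s t : R) : a <= u <= b -> a <= u' <= b -> c <= v <= d -> c <= v' <= d ->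
  `|u' - u| <= s -> `|v' - v| <= t ->
  cabs (H u' v' - H u v) <= M * (s + t).
Proof.
move=> uab u'ab vcd v'cd us vt.
have M0 : 0 <= M by have [A _] := Hbnd uab vcd; exact: le_trans (cabs_ge0 _) A.
have A : cabs (H u' v - H u v) <= M * s.
  apply: (@le_trans _ _ (M * `|u' - u|)); last exact: ler_wpM2l.
  by have [uu'|/ltW uu'] := leP u u'; [|rewrite cabsBC distrC]; rewrite ger0_norm ?subr_ge0 //; apply: lipu => //; lra.
have B : cabs (H u' v' - H u' v) <= M * t.
  apply: (@le_trans _ _ (M * `|v' - v|)); last exact: ler_wpM2l.
  by have [uu'|/ltW uu'] := leP v v'; [|rewrite cabsBC distrC]; rewrite ger0_norm ?subr_ge0 //; apply: lipv => //; lra.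
rewrite (le_trans (cabsBD _ (H u' v) _)) // mulrDr addrC lerD //.
Qed.

(** Near [H us vs] the function is affine up to e * M * (s + t). The affine part has a primitive, so
    only this error is integrated, over four sides of total length at most 2 * M * (s + t). The
    bound is quadratic in the size of the cell, which is exactly what bisection into quarters can
    exploit. *)
Lemma bdry_local us vs (e : R) : a <= us <= b -> c <= vs <= d -> 0 < e ->
  exists2 r : R, 0 < r & forall u v (s t : R), 0 <= s -> 0 <= t ->
    a <= u -> u + s <= b -> c <= v -> v + t <= d ->
    u <= us <= u + s -> v <= vs <= v + t ->
    M * (s + t) < r ->
    cabs (bdry u (u + s) v (v + t)) <= 2 * e * (M * (s + t)) ^+ 2.
Proof.
move=> usab vscd e0; have [l Hl] := fholo usab vscd; have [r r0 Hr] := Hl _ e0.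
exists r => // u v s t s0 t0 au ub cv vd uus vvs sr.
set p := H us vs in Hl Hr.
have inu x : u <= x <= u + s -> a <= x <= b.
  by move=> /andP[ux xu]; rewrite (le_trans au ux) (le_trans xu ub).
have inv x : v <= x <= v + t -> c <= x <= d.
  by move=> /andP[vx xv]; rewrite (le_trans cv vx) (le_trans xv vd).
have us0 : u <= u + s by rewrite lerDl.
have vt0 : v <= v + t by rewrite lerDl.
have close u' v' : u <= u' <= u + s -> v <= v' <= v + t ->
    cabs (f (H u' v') - (f p - l * p) - l * H u' v') <= e * (M * (s + t)).
  move=> u's v't.
  have L : cabs (H u' v' - p) <= M * (s + t).
    by apply: lipuv; rewrite ?ler_norml; lra.
  rewrite (_ : _ - _ = f (H u' v') - f p - l * (H u' v' - p)); last by ring.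
  by rewrite (le_trans (Hr _ (le_lt_trans L sr))) // ler_wpM2l // ltW.
set z := f p - l * p in close.
set E := e * (M * (s + t)).
have S1 v' : v <= v' <= v + t -> cabs (cintegral `[u, u + s] (fun t => f (H t v') * Hu t v') -
   ((z * H (u + s) v' + l / rc 2 * (H (u + s) v' * H (u + s) v')) -
    (z * H u v' + l / rc 2 * (H u v' * H u v')))) <= E * M * (u + s - u).
  move=> hv; have vcd := inv _ hv.
  apply: (path_integral_affine (f := f) (g := H^~ v') (g' := Hu^~ v') us0).
  - move=> x /inu xab.
    by split; [case: (Hder xab vcd)|case: (Hcont xab vcd)|exact/holo_ccf/fholo].
  - by move=> x /inu xab; case: (Hbnd xab vcd).
  - by move=> x xu; exact: close.
have S2 u' : u <= u' <= u + s -> cabs (cintegral `[v, v + t] (fun t => f (H u' t) * Hv u' t) -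
   ((z * H u' (v + t) + l / rc 2 * (H u' (v + t) * H u' (v + t))) -
    (z * H u' v + l / rc 2 * (H u' v * H u' v)))) <= E * M * (v + t - v).
  move=> hu; have uab := inu _ hu.
  apply: (path_integral_affine (f := f) (g := H u') (g' := Hv u') vt0).
  - move=> x /inv xcd.
    by split; [case: (Hder uab xcd)|case: (Hcont uab xcd)|exact/holo_ccf/fholo].
  - by move=> x /inv xcd; case: (Hbnd uab xcd).
  - by move=> x xv; exact: close.
have [lv lv' lu lu'] : [/\ v <= v <= v + t, v <= v + t <= v + t, u <= u <= u + s & u <= u + s <= u + s].
  by rewrite !lexx us0 vt0.
have A1 := S1 v lv; have A2 := S1 (v + t) lv'.
have B1 := S2 u lu; have B2 := S2 (u + s) lu'.
rewrite /bdry.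
set I1 := cintegral _ _ in A1 *. set I2 := cintegral _ _ in B2 *.
set I3 := cintegral _ _ in A2 *. set I4 := cintegral _ _ in B1 *.
set k1 := (X in cabs (I1 - X)) in A1. set k2 := (X in cabs (I2 - X)) in B2.
set k3 := (X in cabs (I3 - X)) in A2. set k4 := (X in cabs (I4 - X)) in B1.
(* The values of the primitive at the four corners cancel around the boundary. *)
have -> : I1 + I2 - I3 - I4 = (I1 - k1) + (I2 - k2) - (I3 - k3) - (I4 - k4).
  by rewrite /k1 /k2 /k3 /k4; ring.
have T : cabs ((I1 - k1) + (I2 - k2) - (I3 - k3) - (I4 - k4)) <=
  cabs (I1 - k1) + cabs (I2 - k2) + cabs (I3 - k3) + cabs (I4 - k4).
  rewrite (le_trans (cabsB _ _)) // lerD2r (le_trans (cabsB _ _)) // lerD2r.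
  exact: cabsD.
apply: (le_trans T).
have -> : 2 * e * (M * (s + t)) ^+ 2 = E * M * (u + s - u) + E * M * (v + t - v)
   + E * M * (u + s - u) + E * M * (v + t - v) by rewrite /E; ring.
by rewrite !lerD.
Qed.

Lemma bdry_quarter u v (s t : R) : 0 <= s -> 0 <= t ->
  a <= u -> u + s + s <= b -> c <= v -> v + t + t <= d ->
  bdry u (u + s + s) v (v + t + t) =
  bdry u (u + s) v (v + t) + bdry (u + s) (u + s + s) v (v + t) +
  (bdry u (u + s) (v + t) (v + t + t) + bdry (u + s) (u + s + s) (v + t) (v + t + t)).
Proof.
move=> *; rewrite (@bdry_splitv _ _ v (v + t)); [|lra..].
by rewrite !(@bdry_splitu u (u + s) (u + s + s)); [|lra..].
Qed.

(** If the boundary integral had modulus [eta] > 0, repeated quartering would give cells with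
    boundary integral at least eta / 4^n. Around the common point of these cells [bdry_local] bounds
    it by 2 e L^2 / 4^n with [e] at will, a contradiction. *)
Theorem goursat : a <= b -> c <= d -> bdry a b c d = 0.
Proof.
move=> ab cd; apply/eqP; rewrite -cabs_eq0 -[_ == _]negbK; apply/negP => eta0.
set eta := cabs (bdry a b c d) in eta0.
have eta_gt0 : 0 < eta by rewrite lt_neqAle eq_sym eta0 cabs_ge0.
pose W := b - a; pose h := d - c.
pose big n (p : R * R) := eta / 4 ^+ n <=
  cabs (bdry p.1 (p.1 + W / 2 ^+ n) p.2 (p.2 + h / 2 ^+ n)).
(* The fourth quarter is the default: when the other three fall below the threshold, it must reach
   it, since the four integrals add up to that of the parent cell. *)
pose nxt n (p : R * R) : R * R :=
  let s := W / 2 ^+ n.+1 in let t := h / 2 ^+ n.+1 in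
  if big n.+1 p then p else if big n.+1 (p.1 + s, p.2) then (p.1 + s, p.2)
  else if big n.+1 (p.1, p.2 + t) then (p.1, p.2 + t) else (p.1 + s, p.2 + t).
pose fix st n : R * R := if n is n'.+1 then nxt n' (st n') else (a, c).
have W0 n : 0 <= W / 2 ^+ n by rewrite divr_ge0 ?exprn_ge0 // /W; lra.
have h0 n : 0 <= h / 2 ^+ n by rewrite divr_ge0 ?exprn_ge0 // /h; lra.
have half (x : R) n : x / 2 ^+ n = x / 2 ^+ n.+1 + x / 2 ^+ n.+1.
  by rewrite exprS; field; rewrite expf_neq0.
have step n : (st n.+1).1 = (st n).1 \/ (st n.+1).1 = (st n).1 + W / 2 ^+ n.+1.
  by rewrite /= /nxt; do 3?case: ifP => _ /=; auto.
have step2 n : (st n.+1).2 = (st n).2 \/ (st n.+1).2 = (st n).2 + h / 2 ^+ n.+1.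
  by rewrite /= /nxt; do 3?case: ifP => _ /=; auto.
have in1 n : a <= (st n).1 /\ (st n).1 + W / 2 ^+ n <= b.
  elim: n => [|n [IH1 IH2]]; first by rewrite /= expr0 divr1 /W; lra.
  by have := step n; rewrite (half W n) in IH2; have := W0 n.+1; lra.
have in2 n : c <= (st n).2 /\ (st n).2 + h / 2 ^+ n <= d.
  elim: n => [|n [IH1 IH2]]; first by rewrite /= expr0 divr1 /h; lra.
  by have := step2 n; rewrite (half h n) in IH2; have := h0 n.+1; lra.
have bigst n : big n (st n).
  elim: n => [|n IH].
    by rewrite /big /= !expr0 !divr1 /W /h !(addrC _ (_ - _)) !subrK.
  rewrite /= /nxt; case: ifPn => // N1; case: ifPn => // N2; case: ifPn => // N3.
  move: IH (in1 n) (in2 n) N1 N2 N3; case: (st n) => u v; rewrite /big /=.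
  rewrite (half W n) (half h n); have := W0 n.+1; have := h0 n.+1.
  set s := W / _; set t := h / _ => t0 s0; rewrite -!ltNge => IH [au ub] [cv vd] N1 N2 N3.
  move: IH; rewrite !(addrA _ s) !(addrA _ t) in ub vd *; rewrite (bdry_quarter s0 t0 au ub cv vd).
  set x1 := bdry _ _ _ _ in N1 *; set x2 := bdry _ _ _ _ in N2 *.
  set x3 := bdry _ _ _ _ in N3 *; set x4 := bdry _ _ _ _ => IH.
  have T : cabs (x1 + x2 + (x3 + x4)) <= cabs x1 + cabs x2 + (cabs x3 + cabs x4).
    by rewrite (le_trans (cabsD _ _)) // lerD // cabsD.
  have E4 : eta / 4 ^+ n = 4 * (eta / 4 ^+ n.+1).
    by rewrite exprS; field; rewrite expf_neq0.
  rewrite E4 in IH; clear -IH T N1 N2 N3; lra.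
have [us Hus] : exists x, forall n, (st n).1 <= x <= (st n).1 + W / 2 ^+ n.
  apply: nested_halving; first by have := W0 0%N; rewrite expr0 divr1.
    by move=> n; have := step n; have := W0 n.+1; lra.
  by move=> n; have := step n; have := W0 n.+1; rewrite (half W n); lra.
have [vs Hvs] : exists x, forall n, (st n).2 <= x <= (st n).2 + h / 2 ^+ n.
  apply: nested_halving; first by have := h0 0%N; rewrite expr0 divr1.
    by move=> n; have := step2 n; have := h0 n.+1; lra.
  by move=> n; have := step2 n; have := h0 n.+1; rewrite (half h n); lra.
have usab : a <= us <= b by have := Hus 0%N; have := in1 0%N; lra.
have vscd : c <= vs <= d by have := Hvs 0%N; have := in2 0%N; lra.
have M0 : 0 <= M by have [A _] := Hbnd usab vscd; exact: le_trans (cabs_ge0 _) A.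
pose L := M * (W + h).
have L0 : 0 <= L by apply: mulr_ge0 => //; have := W0 0%N; have := h0 0%N; rewrite expr0 !divr1; lra.
(* Chosen so that 2 e L^2 = eta L^2 / (2 L^2 + 1) < eta; the summand 1 covers the case L = 0. *)
pose e := eta / (2 * L ^+ 2 + 1) / 2.
have q0 : 0 < 2 * L ^+ 2 + 1 by rewrite ltr_wpDl // mulr_ge0 // sqr_ge0.
have e0 : 0 < e by rewrite !divr_gt0.
have [r r0 Hr] := bdry_local usab vscd e0.
have [n Hn] : exists n : nat, L / r < 2 ^+ n.
  have [n Hn] : exists n : nat, L / r < n%:R.
    exists (Num.truncn (L / r)).+1; exact: truncnS_gt.
  exists n; rewrite (lt_le_trans Hn) // -natrX ler_nat ltnW //; exact: ltn_expl.
have Ln : M * (W / 2 ^+ n + h / 2 ^+ n) = L / 2 ^+ n by rewrite -mulrDl mulrA.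
have := Hr (st n).1 (st n).2 (W / 2 ^+ n) (h / 2 ^+ n) (W0 n) (h0 n).
case: (in1 n) => i1 i1'; case: (in2 n) => i2 i2'.
rewrite Ln; move=> /(_ i1 i1' i2 i2' (Hus n) (Hvs n)).
rewrite ltr_pdivrMr ?exprn_gt0 // mulrC -ltr_pdivrMr // => /(_ Hn) B.
have := le_trans (bigst n) B; apply/negP; rewrite -ltNge.
rewrite expr_div_n -exprM mulnC exprM (_ : 2 ^+ 2 = 4); last by rewrite expr2 -natrM.
rewrite mulrA ltr_pM2r ?invr_gt0 ?exprn_gt0 //.
have -> : 2 * e * L ^+ 2 = eta * (L ^+ 2 / (2 * L ^+ 2 + 1)).
  by rewrite /e; field; rewrite gt_eqF.
rewrite gtr_pMr // ltr_pdivrMr // mul1r; have := sqr_ge0 L; lra.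
Qed.

End Goursat.

(** * Rules for complex differentiability, and the complex exponential *)

Section Holo.
Variable R : realType.
Implicit Types (f g : R[i] -> R[i]) (x y : R) (z w : R[i]).

Lemma ccf_cst a z : ccf (fun=> a) z.
Proof. by move=> e e0; exists 1 => // w _; rewrite subrr cabs0 ltW. Qed.

Lemma ccfD f g z : ccf f z -> ccf g z -> ccf (fun w => f w + g w) z.
Proof.
move=> F G e e0; have e2 : 0 < e / 2 by rewrite divr_gt0.
have [d d0 Hd] := F _ e2; have [d' d'0 Hd'] := G _ e2.
exists (Num.min d d'); first by rewrite lt_min d0.
move=> w; rewrite lt_min => /andP[/Hd A /Hd' B].
rewrite (_ : _ - _ = (f w - f z) + (g w - g z)); last by ring.
by rewrite (le_trans (cabsD _ _)) // [leRHS](splitr e) lerD.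
Qed.

Lemma ccfM f g z : ccf f z -> ccf g z -> ccf (fun w => f w * g w) z.
Proof.
move=> F G e e0; pose K := 1 + cabs (f z) + cabs (g z).
have K0 : 0 < K by rewrite /K; have := cabs_ge0 (f z); have := cabs_ge0 (g z); lra.
pose h := Num.min 1 (e / K).
have h0 : 0 < h by rewrite lt_min ltr01 divr_gt0.
have [d d0 Hd] := F _ h0; have [d' d'0 Hd'] := G _ h0.
exists (Num.min d d'); first by rewrite lt_min d0.
move=> w; rewrite lt_min => /andP[/Hd A /Hd' B].
rewrite (_ : _ - _ = (f w - f z) * (g w - g z) + f z * (g w - g z) + (f w - f z) * g z); last by ring.
apply: (@le_trans _ _ (h * K)); last by rewrite -ler_pdivlMr // ge_min lexx orbT.
have -> : h * K = h + h * cabs (f z) + h * cabs (g z) by rewrite /K; ring.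
rewrite (le_trans (cabsD _ _)) // cabsM lerD //; last by rewrite ler_wpM2r ?cabs_ge0.
rewrite (le_trans (cabsD _ _)) // !cabsM lerD //; last by rewrite mulrC ler_wpM2r ?cabs_ge0.
rewrite -[leRHS]mulr1 ler_pM ?cabs_ge0 // (le_trans B) //.
by rewrite ge_min lexx.
Qed.

Lemma ccfV z : z != 0 -> ccf (fun w => w^-1) z.
Proof.
move=> z0 e e0; have cz : 0 < cabs z by rewrite cabs_gt0.
exists (Num.min (cabs z / 2) (e * cabs z ^+ 2 / 2)).
  by rewrite lt_min !divr_gt0 // mulr_gt0 // exprn_gt0.
move=> w; rewrite lt_min => /andP[A B].
have cw : cabs z / 2 < cabs w.
  by have := cabs_sub z w; rewrite cabsBC; lra.
have w0 : w != 0 by rewrite -cabs_gt0; lra.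
rewrite (_ : _ - _ = (z - w) * (w^-1 * z^-1)); last by field; rewrite ?z0 ?w0.
rewrite cabsM cabsBC !cabsM !cabsV -invfM ler_pdivrMr; last by rewrite mulr_gt0 //; lra.
rewrite (le_trans (ltW B)) // -mulrA ler_wpM2l ?(ltW e0) // expr2 -mulrA mulrC.
by rewrite mulrC (mulrC (cabs w)) ler_wpM2l // ltW.
Qed.

Lemma ccf_compf f g z : ccf f (g z) -> ccf g z -> ccf (fun w => f (g w)) z.
Proof.
move=> F G e /F[d d0 Hd]; have [d' d'0 Hd'] := G _ (divr_gt0 d0 (ltr0n R 2)).
exists d' => // w /Hd' wd; apply: Hd; rewrite (le_lt_trans wd) //.
by rewrite ltr_pdivrMr // ltr_pMr // ltr1n.
Qed.

(* Caratheodory's form of differentiability reduces the calculus rules to continuity. *)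
Lemma holoP f z : holo f z <->
  exists2 phi : R[i] -> R[i], ccf phi z & forall w, f w = f z + phi w * (w - z).
Proof.
split.
  move=> [l H]; exists (fun w => if w == z then l else (f w - f z) / (w - z)); last first.
    move=> w; have [->|wz] := eqVneq w z; first by rewrite subrr mulr0 addr0.
    by rewrite divfK ?subr_eq0 // addrC subrK.
  move=> e e0; have [d d0 Hd] := H _ e0; exists d => // w /Hd.
  rewrite [z == z]eqxx; have [->|wz B] := eqVneq w z; first by move=> _; rewrite subrr cabs0 ltW.
  rewrite (_ : _ - l = (f w - f z - l * (w - z)) / (w - z)); last first.
    by field; rewrite subr_eq0.
  by rewrite cabsM cabsV ler_pdivrMr // cabs_gt0 subr_eq0.
move=> [phi cphi E]; exists (phi z) => e e0; have [d d0 Hd] := cphi _ e0.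
exists d => // w wd.
have -> : f w - f z - phi z * (w - z) = (phi w - phi z) * (w - z).
  by rewrite (E w); ring.
by rewrite cabsM ler_wpM2r ?cabs_ge0 // Hd.
Qed.

Lemma holo_cst a z : holo (fun=> a) z.
Proof.
apply/holoP; exists (fun=> 0); last by move=> w; rewrite mul0r addr0.
exact: ccf_cst.
Qed.

Lemma holo_id z : holo id z.
Proof.
apply/holoP; exists (fun=> 1); last by move=> w; rewrite mul1r addrC subrK.
exact: ccf_cst.
Qed.

Lemma holoD f g z : holo f z -> holo g z -> holo (fun w => f w + g w) z.
Proof.
move=> /holoP[p cp fE] /holoP[q cq gE]; apply/holoP.
exists (fun w => p w + q w); first exact: ccfD.
by move=> w; rewrite (fE w) (gE w); ring.
Qed.

Lemma holoM f g z : holo f z -> holo g z -> holo (fun w => f w * g w) z.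
Proof.
move=> /holoP[p cp fE] /[dup] /holo_ccf cg /holoP[q cq gE]; apply/holoP.
exists (fun w => p w * g w + f z * q w).
  exact: (ccfD (ccfM cp cg) (ccfM (ccf_cst _ _) cq)).
by move=> w; rewrite (fE w) mulrDl {1}(gE w); ring.
Qed.

Lemma holo_comp f g z : holo f (g z) -> holo g z -> holo (fun w => f (g w)) z.
Proof.
move=> /holoP[p cp fE] /[dup] /holo_ccf cg /holoP[q cq gE].
apply/holoP; exists (fun w => p (g w) * q w).
  by apply: ccfM => //; exact: ccf_compf.
move=> w; rewrite (fE (g w)) -mulrA; congr (_ + _ * _).
by rewrite (gE w); ring.
Qed.

Lemma holoV z : z != 0 -> holo (fun w => w^-1) z.
Proof.
move=> z0; apply/holoP.
(* Since 0^-1 = 0 by convention, the identity at [w = 0] forces the value z^(-2); continuity at [z]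
   only sees [w] closer to [z] than 0 is. *)
exists (fun w => if w == 0 then z^-1 ^+ 2 else - (w^-1 * z^-1)); last first.
  move=> w; have [->|w0] := eqVneq w 0; first by rewrite sub0r invr0 expr2; field; rewrite ?z0.
  by field; rewrite ?z0 ?w0.
have H : ccf (fun w => - (w^-1 * z^-1)) z.
  rewrite (_ : (fun w => _) = fun w => w^-1 * (- z^-1)).
    exact: (ccfM (ccfV z0) (ccf_cst _ _)).
  by apply/funext => w; rewrite mulrN.
move=> e /H[d d0 Hd]; exists (Num.min d (cabs z)); first by rewrite lt_min d0 cabs_gt0.
move=> w; rewrite lt_min => /andP[wd wz]; rewrite (negPf z0).
have [w0|_] := eqVneq w 0; last exact: Hd.
by move: wz; rewrite w0 sub0r cabsN ltxx.
Qed.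

(** The increment over [0, 1] of t |-> exp(z t) is the integral of its derivative z exp(z t), and
    |exp(z t)| <= exp |z| there. *)
Lemma cexp_sub1 z : cabs (cexp z - 1) <= cabs z * expR (cabs z).
Proof.
pose k (t : R) := cexp (z * rc t).
have dk t : cder k t (z * cexp (z * rc t)).
  by apply: cder_exp; apply: cder_eq (cderZ z (cder_id t)) _; rewrite mulr1.
have ck t : ccont (fun t => z * cexp (z * rc t)) t.
  exact: ccontM (ccont_cst _ _) (cder_cont (dk t)).
have -> : cexp z - 1 = k 1 - k 0 by rewrite /k rc1 rc0 mulr1 mulr0 cexp0.
rewrite -(cintegral_FTC ler01 (fun t _ => dk t) (fun t _ => ck t)).
rewrite [leRHS](_ : _ = cabs z * expR (cabs z) * (1 - 0)); last by rewrite subr0 mulr1.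
apply: cabs_cintegral_bound => [||t /andP[t0 t1]]; [exact: ler01| by move=> t _; exact: ck|].
rewrite cabsM cabs_cexp ler_wpM2l ?cabs_ge0 // ler_expR.
rewrite (le_trans (ler_norm _)) // (le_trans (cre_le _)) // cabsM cabs_rc ger0_norm //.
by rewrite ler_piMr ?cabs_ge0.
Qed.

(** The same device once more: the derivative z (exp(z t) - 1) is controlled by the first-order
    estimate, which supplies the second factor |z|. *)
Lemma cexp_sub1_id z : cabs (cexp z - 1 - z) <= cabs z ^+ 2 * expR (cabs z).
Proof.
pose k (t : R) := cexp (z * rc t) - z * rc t.
have d1 t : cder (fun t => z * rc t) t z.
  by apply: cder_eq (cderZ z (cder_id t)) _; rewrite mulr1.
have dk t : cder k t (z * (cexp (z * rc t) - 1)).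
  have d2 := cderZ (-1) (d1 t); have d3 := cderD (cder_exp (d1 t)) d2.
  rewrite (_ : k = fun t => cexp (z * rc t) + -1 * (z * rc t)); last first.
    by apply/funext => ?; rewrite mulN1r.
  by apply: cder_eq d3 _; ring.
have ck t : ccont (fun t => z * (cexp (z * rc t) - 1)) t.
  apply: ccontM (ccont_cst _ _) (ccontD _ (ccont_cst _ _)).
  exact: cder_cont (cder_exp (d1 t)).
have -> : cexp z - 1 - z = k 1 - k 0 by rewrite /k rc1 rc0 mulr1 mulr0 cexp0; ring.
rewrite -(cintegral_FTC ler01 (fun t _ => dk t) (fun t _ => ck t)).
rewrite [leRHS](_ : _ = cabs z ^+ 2 * expR (cabs z) * (1 - 0)); last by rewrite subr0 mulr1.
apply: cabs_cintegral_bound => [||t /andP[t0 t1]]; [exact: ler01| by move=> t _; exact: ck|].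
rewrite cabsM expr2 -mulrA ler_wpM2l ?cabs_ge0 // (le_trans (cexp_sub1 _)) //.
have B : cabs (z * rc t) <= cabs z.
  by rewrite cabsM cabs_rc ger0_norm // ler_piMr ?cabs_ge0.
by rewrite ler_pM ?cabs_ge0 ?expR_ge0 // ler_expR.
Qed.

(** The addition law moves the expansion to the origin, where the second-order estimate applies. *)
Lemma holo_cexp z : holo (@cexp R) z.
Proof.
pose K := expR (1 + cre z); have K0 : 0 < K by exact: expR_gt0.
exists (cexp z) => e e0; exists (Num.min 1 (e / K)).
  by rewrite lt_min ltr01 divr_gt0.
move=> w; rewrite lt_min => /andP[w1 we].
have -> : cexp w - cexp z - cexp z * (w - z) = cexp z * (cexp (w - z) - 1 - (w - z)).
  by rewrite !mulrBr -cexpD (addrC z) subrK mulr1; ring.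
rewrite cabsM cabs_cexp; have := cexp_sub1_id (w - z).
set D := cabs (w - z) in w1 we *; set X := cabs _ => B.
rewrite (le_trans (ler_wpM2l (expR_ge0 _) B)) //.
have D0 : 0 <= D by exact: cabs_ge0.
rewrite mulrCA -expRD expr2 -mulrA mulrC ler_wpM2r // (@le_trans _ _ (D * K)) //.
  by rewrite ler_wpM2l // ler_expR; lra.
by rewrite -ler_pdivlMr // ltW.
Qed.

Lemma holo_eq f g z l : holo f z -> 0 < l -> (forall w, cabs (w - z) < l -> f w = g w) -> holo g z.
Proof.
move=> [k H] l0 fg; exists k => e /H[d d0 Hd]; exists (Num.min d l); first by rewrite lt_min d0.
by move=> w; rewrite lt_min => /andP[wd wl]; rewrite -!fg ?subrr ?cabs0 //; exact: Hd.
Qed.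

End Holo.

(** * Affine changes of variable *)

Section Substitution.
Variable R : realType.
Notation mu := (@lebesgue_measure R).
Implicit Types (g : R -> R[i]) (k : R -> R) (a b x y : R) (z w : R[i]).

Let affine_is_derive (s t x : R) : is_derive x 1 (fun x => s * x + t) s.
Proof.
have -> : (fun x : R => s * x + t) = (s \*: (@id R)) + cst t by apply/funext.
by apply: is_derive_eq; rewrite addr0 /GRing.scale /= mulr1.
Qed.

Let affine_continuous (s t x : R) : {for x, continuous (fun x => s * x + t)}.
Proof. by have [d _] := affine_is_derive s t x; apply/differentiable_continuous/derivable1_diffP. Qed.

Let affine_derive1 (s t : R) : (fun x => s * x + t)^`() = cst s.
Proof. by apply/funext => x; rewrite derive1E; exact: derive_val. Qed.

Let affine_LR (s t a b : R) : derivable_oo_LRcontinuous (fun x => s * x + t) a b.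
Proof.
split.
- by move=> x _; have [] := affine_is_derive s t x.
- by apply: cvg_at_right_filter; exact: affine_continuous.
- by apply: cvg_at_left_filter; exact: affine_continuous.
Qed.

Lemma Rintegral_affine_pos k a b (s t : R) : a <= b -> 0 < s ->
  (forall x, s * a + t <= x <= s * b + t -> {for x, continuous k}) ->
  Rintegral mu `[s * a + t, s * b + t] k = s * Rintegral mu `[a, b] (fun x => k (s * x + t)).
Proof.
move=> ab s0 ck; pose F x := s * x + t.
have ckF x : a <= x <= b -> {for x, continuous (fun x => k (F x))}.
  move=> /andP[ax xb]; apply: continuous_comp; first exact: affine_continuous.
  by apply: ck; rewrite !lerD2r !ler_pM2l // ax.
rewrite -RintegralZl //; last exact: continuous_integrable.
rewrite /Rintegral (@integration_by_substitution_increasing _ F k) //.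
- congr fine; apply: eq_integral => x _; rewrite affine_derive1 /=.
  by congr (_%:E); rewrite mulrC.
- by move=> x y _ _ xy; rewrite /F ltrD2r ltr_pM2l.
- by move=> x _; rewrite affine_derive1; exact: cst_continuous.
- by rewrite affine_derive1; apply: is_cvg_cst.
- by rewrite affine_derive1; apply: is_cvg_cst.
- exact: affine_LR.
- exact: continuous_within.
Qed.

Lemma Rintegral_affine_neg k a b (s t : R) : a <= b -> s < 0 ->
  (forall x, s * b + t <= x <= s * a + t -> {for x, continuous k}) ->
  Rintegral mu `[s * b + t, s * a + t] k = - s * Rintegral mu `[a, b] (fun x => k (s * x + t)).
Proof.
move=> ab s0 ck; pose F x := s * x + t.
have ckF x : a <= x <= b -> {for x, continuous (fun x => k (F x))}.
  move=> /andP[ax xb]; apply: continuous_comp; first exact: affine_continuous.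
  by apply: ck; rewrite !lerD2r !ler_nM2l // xb.
rewrite -RintegralZl //; last exact: continuous_integrable.
rewrite /Rintegral (@integration_by_substitution_decreasing _ F k) //.
- congr fine; apply: eq_integral => x _; rewrite affine_derive1 /=.
  by congr (_%:E); rewrite mulrC.
- by move=> x y _ _ xy; rewrite /F ltrD2r ltr_nM2l.
- by move=> x _; rewrite affine_derive1; exact: cst_continuous.
- by rewrite affine_derive1; apply: is_cvg_cst.
- by rewrite affine_derive1; apply: is_cvg_cst.
- exact: affine_LR.
- exact: continuous_within.
Qed.

Lemma cintegral_affine_pos g a b (s t : R) : a <= b -> 0 < s ->
  (forall x, s * a + t <= x <= s * b + t -> ccont g x) ->
  cintegral `[s * a + t, s * b + t] g = rc s * cintegral `[a, b] (fun x => g (s * x + t)).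
Proof.
move=> ab s0 cg; apply: eqC; rewrite !cE mul0r ?subr0 ?addr0.
  by apply: Rintegral_affine_pos => // x /cg[].
by apply: Rintegral_affine_pos => // x /cg[].
Qed.

Lemma cintegral_affine_neg g a b (s t : R) : a <= b -> s < 0 ->
  (forall x, s * b + t <= x <= s * a + t -> ccont g x) ->
  cintegral `[s * b + t, s * a + t] g = - rc s * cintegral `[a, b] (fun x => g (s * x + t)).
Proof.
move=> ab s0 cg; rewrite -rcN; apply: eqC; rewrite !cE mul0r ?subr0 ?addr0.
  by apply: Rintegral_affine_neg => // x /cg[].
by apply: Rintegral_affine_neg => // x /cg[].
Qed.
End Substitution.

(** * Segments, arcs and the sector between them *)

Section Contour.
Variable R : realType.
Implicit Types (f : R[i] -> R[i]) (x y : R) (z w p q : R[i]).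

Lemma is_derive_affine (s t x : R) : is_derive x 1 (fun x => s + t * x) t.
Proof.
have -> : (fun v : R => s + t * v) = cst s + t \*: (@id R) by apply/funext.
by apply: is_derive_eq; rewrite add0r /GRing.scale /= mulr1.
Qed.

Definition seg f p q := cintegral `[0, 1] (fun t : R => f (p + rc t * (q - p)) * (q - p)).

Definition arcint f z (e s t : R) := cintegral `[s, t]
  (fun th => f (z + rc e * cexp (ci * rc th)) * (ci * rc e * cexp (ci * rc th))).

Definition arcpt z (e th : R) := z + rc e * cexp (ci * rc th).

Lemma cder_arcpt z e th : cder (arcpt z e) th (ci * rc e * cexp (ci * rc th)).
Proof.
apply: cder_eq (cderD (cder_cst z th) (cderZ (rc e) (cder_exp (cderZ ci (cder_id th))))) _.
by rewrite mulr1 add0r; ring.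
Qed.

Lemma ccont_darc (e th : R) : ccont (fun th => ci * rc e * cexp (ci * rc th)) th.
Proof.
apply: ccontM (ccont_cst _ _) _.
exact: cder_cont (cder_exp (cderZ ci (cder_id th))).
Qed.

Lemma cabs_cexp_ci (th : R) : cabs (cexp (ci * rc th)) = 1.
Proof. by rewrite cabs_cexp !cE mul0r mul1r subrr expR0. Qed.

(* Goursat on the straight-line homotopy from the arc to the segment [p, q]. *)
Lemma sector f z (e s t : R) p q : 0 < e -> s < t ->
  (forall u v : R, 0 <= u <= 1 -> s <= v <= t ->
     holo f (rc (1 - u) * arcpt z e v + rc u * (p + rc ((v - s) / (t - s)) * (q - p)))) ->
  arcint f z e s t = seg f (arcpt z e s) p + seg f p q - seg f (arcpt z e t) q.
Proof.
move=> e0 st hf.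
have ts : 0 < t - s by rewrite subr_gt0.
pose A v := arcpt z e (s + (t - s) * v).
pose dA v := rc (t - s) * (ci * rc e * cexp (ci * rc (s + (t - s) * v))).
pose B (v : R) := p + rc v * (q - p).
(* [u = 0] is the arc and [u = 1] the segment [p, q], both run by [v] in [0, 1]; [v = 0] and [v = 1]
   are the two cuts joining the ends of the arc to [p] and [q]. *)
pose H (u v : R) := rc (1 - u) * A v + rc u * B v.
pose Hu (u v : R) := B v - A v.
pose Hv (u v : R) := rc (1 - u) * dA v + rc u * (q - p).
have dAf v : cder A v (dA v).
  have d1 : cder (fun v => ci * rc (s + (t - s) * v)) v (ci * rc (t - s)).
    apply: cderZ; apply: cder_rc.
    exact: is_derive_affine.
  apply: cder_eq (cderD (cder_cst z v) (cderZ (rc e) (cder_exp d1))) _.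
  by rewrite add0r /dA; ring.
have cdA v : ccont dA v.
  apply: ccontM (ccont_cst _ _) _; apply: ccontM (ccont_cst _ _) _.
  apply: (@cder_cont _ _ _ _ (cder_exp (l := ci * rc (t - s)) _)).
  apply: cderZ; apply: cder_rc.
  exact: is_derive_affine.
have dB v : cder B v (q - p).
  apply: cder_eq (cderD (cder_cst p v) (cderM (cder_id v) (cder_cst (q - p) v))) _.
  by rewrite mulr0 addr0 mul1r add0r.
have d1u (u : R) : cder (fun u => rc (1 - u)) u (- 1).
  rewrite -rc1 -rcN; apply: cder_rc.
  have -> : (fun u : R => 1 - u) = cst 1 - (@id R) by apply/funext.
  by apply: is_derive_eq; rewrite sub0r.
have Hder u v : cder (H^~ v) u (Hu u v) /\ cder (H u) v (Hv u v).
  split.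
    apply: cder_eq (cderD (cderM (d1u u) (cder_cst (A v) u)) (cderM (cder_id u) (cder_cst (B v) u))) _.
    by rewrite /Hu; ring.
  exact: cderD (cderZ _ (dAf v)) (cderZ _ (dB v)).
have Hcont u v : ccont (Hu^~ v) u /\ ccont (Hv u) v.
  split; first exact: ccont_cst.
  apply: ccontD (ccont_cst _ _); exact: ccontM (ccont_cst _ _) (cdA v).
pose M := cabs p + cabs (q - p) + (cabs z + e) + (t - s) * e.
have Hbnd u v : 0 <= u <= 1 -> 0 <= v <= 1 -> cabs (Hu u v) <= M /\ cabs (Hv u v) <= M.
  move=> /andP[u0 u1] /andP[v0 v1].
  have p0 := cabs_ge0 p; have qp0 := cabs_ge0 (q - p); have z0 := cabs_ge0 z.
  have tse : 0 <= (t - s) * e by rewrite mulr_ge0 // ltW.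
  have aA : cabs (A v) <= cabs z + e.
    by rewrite (le_trans (cabsD _ _)) // lerD2l cabsM cabs_cexp_ci mulr1 cabs_rc ger0_norm // ltW.
  have aB : cabs (B v) <= cabs p + cabs (q - p).
    rewrite (le_trans (cabsD _ _)) // lerD2l cabsM cabs_rc ger0_norm //.
    by rewrite ler_piMl.
  have adA : cabs (dA v) = (t - s) * e.
    rewrite /dA !cabsM cabs_cexp_ci !cabs_rc cabs_ci mul1r mulr1.
    by rewrite !ger0_norm // ltW.
  split.
    by rewrite (le_trans (cabsB _ _)) // /M; lra.
  rewrite (le_trans (cabsD _ _)) // (cabsM _ (dA v)) adA (cabsM (rc u)) !cabs_rc.
  rewrite !ger0_norm //; last by rewrite subr_ge0.
  have X1 : (1 - u) * ((t - s) * e) <= (t - s) * e by rewrite ler_piMl //; lra.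
  have X2 : u * cabs (q - p) <= cabs (q - p) by rewrite ler_piMl.
  by rewrite /M; lra.
have fh u v : 0 <= u <= 1 -> 0 <= v <= 1 -> holo f (H u v).
  move=> u01 /andP[v0 v1]; have := hf u (s + (t - s) * v) u01.
  rewrite (_ : (s + (t - s) * v - s) / (t - s) = v); last by field; rewrite gt_eqF.
  apply; apply/andP; split; first by rewrite lerDl mulr_ge0 // ltW.
  by rewrite -lerBrDl ler_piMr // ltW.
have := goursat (fun u v _ _ => Hder u v) (fun u v _ _ => Hcont u v) Hbnd fh ler01 ler01.
rewrite /bdry.
have -> : cintegral `[0, 1] (fun u : R => f (H u 0) * Hu u 0) = seg f (arcpt z e s) p.
  apply: eq_cintegral => u _; rewrite /H /Hu /A /B rcB rc1 rc0 mulr0 addr0 mul0r addr0.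
  by congr (f _ * _); ring.
have -> : cintegral `[0, 1] (fun u : R => f (H u 1) * Hu u 1) = seg f (arcpt z e t) q.
  apply: eq_cintegral => u _; rewrite /H /Hu /A /B rcB rc1 mulr1 mul1r.
  by rewrite (addrC s) subrK (addrC p) subrK; congr (f _ * _); ring.
have -> : cintegral `[0, 1] (fun v : R => f (H 1 v) * Hv 1 v) = seg f p q.
  apply: eq_cintegral => u _; rewrite /H /Hv /A /B subrr rc0 rc1 !mul0r !add0r !mul1r.
  by [].
have -> : cintegral `[0, 1] (fun v : R => f (H 0 v) * Hv 0 v) = arcint f z e s t.
  pose k th := f (arcpt z e th) * (ci * rc e * cexp (ci * rc th)).
  transitivity (rc (t - s) * cintegral `[0, 1] (fun v => k ((t - s) * v + s))).
    rewrite -cintegralZ //; last first.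
      apply: ccont_integrable => v v01; rewrite /k.
      have h0 : holo f (arcpt z e ((t - s) * v + s)).
        have := fh 0 v; rewrite /H subr0 rc1 mul1r rc0 mul0r addr0 addrC; apply => //.
        by rewrite lexx ler01.
      have e1 : (fun v => f (arcpt z e ((t - s) * v + s)) * (ci * rc e * cexp (ci * rc ((t - s) * v + s))))
        = (fun v => f (A v) * ((rc (t - s))^-1 * dA v)).
        have ts0 : rc (t - s) != 0 by rewrite rc_eq0 gt_eqF.
        by apply/funext => v'; rewrite /A /dA (addrC s) mulKf.
      rewrite e1; apply: ccontM; last exact: ccontM (ccont_cst _ _) (cdA v).
      apply: ccont_comp (cder_cont (dAf v)); apply: holo_ccf.
      by rewrite /A (addrC s).
    apply: eq_cintegral => v _; rewrite /H /Hv /k /A /dA subr0 rc1 rc0 !mul0r !mul1r !addr0.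
    by rewrite (addrC s); ring.
  have E := @cintegral_affine_pos _ k 0 1 (t - s) s ler01 ts.
  rewrite mulr0 add0r mulr1 subrK in E; rewrite -E => [//|v vst]; rewrite /k.
  apply: ccontM; last exact: ccont_darc.
  apply: ccont_comp (cder_cont (cder_arcpt z e v)); apply: holo_ccf.
  have := hf 0 v; rewrite subr0 rc1 rc0 mul1r mul0r addr0; apply => //.
  by rewrite lexx ler01.
move/eqP; rewrite subr_eq0 => /eqP <-; ring.
Qed.
End Contour.

(** * The residue theorem on rectangles *)

Section Rectangle.
Variable R : realType.
Implicit Types (f : R[i] -> R[i]) (x y : R) (z w p q : R[i]).

Definition hint f y x0 x1 := cintegral `[x0, x1] (fun x => f (Complex x y)).
Definition vint f x y0 y1 := ci * cintegral `[y0, y1] (fun y => f (Complex x y)).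
Definition rectint f x0 x1 y0 y1 :=
  hint f y0 x0 x1 + vint f x1 y0 y1 - hint f y1 x0 x1 - vint f x0 y0 y1.
Definition inrect x0 x1 y0 y1 z := (x0 <= cre z <= x1) && (y0 <= cim z <= y1).

Lemma inrectC x0 x1 y0 y1 x y : x0 <= x <= x1 -> y0 <= y <= y1 ->
  inrect x0 x1 y0 y1 (Complex x y).
Proof. by move=> xx yy; rewrite /inrect !cE xx. Qed.

Lemma cder_h y x : cder (fun x => Complex x y) x 1.
Proof.
rewrite (_ : (fun x => _) = fun x => rc x + ci * rc y); last first.
  by apply/funext => t; apply: eqC; rewrite !cE; ring.
by apply: cder_eq (cderD (cder_id x) (cder_cst _ x)) _; rewrite addr0.
Qed.

Lemma cder_v x y : cder (fun y => Complex x y) y ci.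
Proof.
rewrite (_ : (fun y => _) = fun y => rc x + ci * rc y); last first.
  by apply/funext => t; apply: eqC; rewrite !cE; ring.
by apply: cder_eq (cderD (cder_cst _ y) (cderZ ci (cder_id y))) _; rewrite add0r mulr1.
Qed.

Lemma ccont_h f y x : ccf f (Complex x y) -> ccont (fun x => f (Complex x y)) x.
Proof. by move=> H; apply: (ccont_comp H); exact: cder_cont (cder_h y x). Qed.

Lemma ccont_v f x y : ccf f (Complex x y) -> ccont (fun y => f (Complex x y)) y.
Proof. by move=> H; apply: (ccont_comp H); exact: cder_cont (cder_v x y). Qed.

Lemma ccont_comp_affine (g : R -> R[i]) (s t x : R) : ccont g (s * x + t) -> ccont (fun x => g (s * x + t)) x.
Proof.
have A : {for x, continuous (fun x => s * x + t)}.
  have [+ _] := is_derive_affine t s x; rewrite (_ : (fun x => _) = fun x => s * x + t).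
    by move=> /derivable1_diffP/differentiable_continuous.
  by apply/funext => ?; rewrite addrC.
by move=> [c1 c2]; split; [exact: (continuous_comp A c1)|exact: (continuous_comp A c2)].
Qed.

(** [k] is the direction of the side: 1 for a horizontal side, [ci] for a vertical one. *)
Lemma seg_affine f p q (g : R -> R[i]) a b (k : R[i]) : a < b ->
  (forall t, a <= t <= b -> ccont g t) ->
  (forall t, f (p + rc t * (q - p)) = g ((b - a) * t + a)) ->
  q - p = k * rc (b - a) ->
  seg f p q = k * cintegral `[a, b] g.
Proof.
move=> ab cg fg qp; have ba : 0 < b - a by rewrite subr_gt0.
have E := @cintegral_affine_pos _ g 0 1 (b - a) a ler01 ba.
rewrite mulr0 add0r mulr1 subrK in E; rewrite E //.
rewrite mulrA -qp -cintegralZ //.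
  by apply: eq_cintegral => t _; rewrite fg mulrC.
apply: ccont_integrable => t /andP[t0 t1].
apply: ccont_comp_affine; apply: cg.
by rewrite lerDr mulr_ge0 ?(ltW ba) //= -lerBrDr ler_piMr // ltW.
Qed.

(** For the top and the left side, which a counterclockwise tour of the rectangle runs backwards. *)
Lemma seg_affine_rev f p q (g : R -> R[i]) a b (k : R[i]) : a < b ->
  (forall t, a <= t <= b -> ccont g t) ->
  (forall t, f (p + rc t * (q - p)) = g ((a - b) * t + b)) ->
  q - p = k * rc (a - b) ->
  seg f p q = - (k * cintegral `[a, b] g).
Proof.
move=> ab cg fg qp; have ba : a - b < 0 by rewrite subr_lt0.
have E := @cintegral_affine_neg _ g 0 1 (a - b) b ler01 ba.
rewrite mulr0 add0r mulr1 subrK in E; rewrite E // mulNr mulrN opprK.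
rewrite mulrA -qp -cintegralZ //.
  by apply: eq_cintegral => t _; rewrite fg mulrC.
apply: ccont_integrable => t /andP[t0 t1].
apply: ccont_comp_affine; apply: cg.
have A : 0 <= (b - a) * t by rewrite mulr_ge0 // subr_ge0 ltW.
have B : 0 <= (b - a) * (1 - t) by rewrite mulr_ge0 // subr_ge0 // ltW.
by apply/andP; split; lra.
Qed.

Lemma seg_h f y x0 x1 : x0 < x1 ->
  (forall x, x0 <= x <= x1 -> ccf f (Complex x y)) ->
  seg f (Complex x0 y) (Complex x1 y) = hint f y x0 x1.
Proof.
move=> x01 cf; rewrite (@seg_affine _ _ _ (fun x => f (Complex x y)) x0 x1 1) ?mul1r //.
- by move=> x /cf /ccont_h.
- by move=> t; congr f; apply: eqC; rewrite !cE; ring.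
- by apply: eqC; rewrite !cE; ring.
Qed.

Lemma seg_h_rev f y x0 x1 : x0 < x1 ->
  (forall x, x0 <= x <= x1 -> ccf f (Complex x y)) ->
  seg f (Complex x1 y) (Complex x0 y) = - hint f y x0 x1.
Proof.
move=> x01 cf; rewrite (@seg_affine_rev _ _ _ (fun x => f (Complex x y)) x0 x1 1) ?mul1r //.
- by move=> x /cf /ccont_h.
- by move=> t; congr f; apply: eqC; rewrite !cE; ring.
- by apply: eqC; rewrite !cE; ring.
Qed.

Lemma seg_v f x y0 y1 : y0 < y1 ->
  (forall y, y0 <= y <= y1 -> ccf f (Complex x y)) ->
  seg f (Complex x y0) (Complex x y1) = vint f x y0 y1.
Proof.
move=> y01 cf; rewrite (@seg_affine _ _ _ (fun y => f (Complex x y)) y0 y1 ci) //.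
- by move=> y /cf /ccont_v.
- by move=> t; congr f; apply: eqC; rewrite !cE; ring.
- by apply: eqC; rewrite !cE; ring.
Qed.

Lemma seg_v_rev f x y0 y1 : y0 < y1 ->
  (forall y, y0 <= y <= y1 -> ccf f (Complex x y)) ->
  seg f (Complex x y1) (Complex x y0) = - vint f x y0 y1.
Proof.
move=> y01 cf; rewrite (@seg_affine_rev _ _ _ (fun y => f (Complex x y)) y0 y1 ci) //.
- by move=> y /cf /ccont_v.
- by move=> t; congr f; apply: eqC; rewrite !cE; ring.
- by apply: eqC; rewrite !cE; ring.
Qed.

(** The rectangle parametrizes itself, with partial derivatives 1 and i. *)
Lemma goursat_rect f x0 x1 y0 y1 : x0 <= x1 -> y0 <= y1 ->
  (forall z, inrect x0 x1 y0 y1 z -> holo f z) -> rectint f x0 x1 y0 y1 = 0.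
Proof.
move=> x01 y01 hf.
have Hder (u v : R) : cder (fun u => Complex u v) u 1 /\ cder (fun v => Complex u v) v ci.
  by split; [exact: cder_h|exact: cder_v].
have Hcont (u v : R) : ccont (fun _ : R => (1 : R[i])) u /\ ccont (fun _ : R => (ci : R[i])) v.
  by split; exact: ccont_cst.
have Hbnd : cabs (1 : R[i]) <= 1 /\ cabs (ci : R[i]) <= 1 by rewrite cabs1 cabs_ci.
have fh u v : x0 <= u <= x1 -> y0 <= v <= y1 -> holo f (Complex u v).
  by move=> u01 v01; apply: hf; rewrite /inrect !cE u01.
have := @goursat R f (fun u v => Complex u v) (fun _ _ => 1) (fun _ _ => ci) x0 x1 y0 y1 1
  (fun u v _ _ => Hder u v) (fun u v _ _ => Hcont u v) (fun u v _ _ => Hbnd) fh x01 y01.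
rewrite /bdry /rectint /vint.
have cv x : x0 <= x <= x1 -> cintegral `[y0, y1] (fun v => f (Complex x v) * ci) =
    ci * cintegral `[y0, y1] (fun v => f (Complex x v)).
  move=> xx; rewrite -cintegralZ //; first by apply: eq_cintegral => y _; rewrite mulrC.
  by apply: ccont_integrable => y yy; apply/ccont_v/holo_ccf; exact: fh.
rewrite !cv ?lexx ?x01 // => E; rewrite -[RHS]E /hint.
by congr (_ + _ - _ - _); apply: eq_cintegral => x _; rewrite mulr1.
Qed.

Definition punctured x0 x1 y0 y1 (r : R[i]) z := inrect x0 x1 y0 y1 z /\ z <> r.

(* A linear form [al * x + be * y] centred at [r] and positive at the three points keeps their
   convex hull away from [r]. *)
Lemma sector_inside x0 x1 y0 y1 (r A p q : R[i]) (al be u t : R) :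
  inrect x0 x1 y0 y1 A -> inrect x0 x1 y0 y1 p -> inrect x0 x1 y0 y1 q ->
  0 <= u <= 1 -> 0 <= t <= 1 ->
  0 < al * (cre A - cre r) + be * (cim A - cim r) ->
  0 < al * (cre p - cre r) + be * (cim p - cim r) ->
  0 < al * (cre q - cre r) + be * (cim q - cim r) ->
  punctured x0 x1 y0 y1 r (rc (1 - u) * A + rc u * (p + rc t * (q - p))).
Proof.
have conv (l a b s : R) : 0 <= s <= 1 -> l <= a -> l <= b -> l <= (1 - s) * a + s * b.
  move=> /andP[s0 s1] la lb.
  have X : 0 <= (1 - s) * (a - l) by rewrite mulr_ge0 ?subr_ge0.
  have Y : 0 <= s * (b - l) by rewrite mulr_ge0 ?subr_ge0.
  by lra.
have convr (l a b s : R) : 0 <= s <= 1 -> a <= l -> b <= l -> (1 - s) * a + s * b <= l.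
  move=> s01 al' bl; have := conv (- l) (- a) (- b) s s01; rewrite !lerN2 => /(_ al' bl).
  lra.
move=> /andP[/andP[a1 a2] /andP[a3 a4]] /andP[/andP[p1 p2] /andP[p3 p4]].
move=> /andP[/andP[q1 q2] /andP[q3 q4]] u01 t01 lA lp lq.
set B := p + _; set W := _ + _.
have Bre : cre B = (1 - t) * cre p + t * cre q by rewrite /B !cE; ring.
have Bim : cim B = (1 - t) * cim p + t * cim q by rewrite /B !cE; ring.
have Wre : cre W = (1 - u) * cre A + u * cre B by rewrite /W !cE; ring.
have Wim : cim W = (1 - u) * cim A + u * cim B by rewrite /W !cE; ring.
split.
  by rewrite /inrect Wre Wim Bre Bim !conv ?convr.
move=> Wr.
have lB : 0 < al * (cre B - cre r) + be * (cim B - cim r).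
  rewrite Bre Bim.
  pose m := Num.min (al * (cre p - cre r) + be * (cim p - cim r)) (al * (cre q - cre r) + be * (cim q - cim r)).
  have m0 : 0 < m by rewrite lt_min lp.
  apply: (lt_le_trans m0).
  have H1 : m <= al * (cre p - cre r) + be * (cim p - cim r) by rewrite ge_min lexx.
  have H2 : m <= al * (cre q - cre r) + be * (cim q - cim r) by rewrite ge_min lexx orbT.
  by apply: le_trans (conv m _ _ t t01 H1 H2) _; rewrite le_eqVlt; apply/orP; left; apply/eqP; ring.
have : 0 < al * (cre W - cre r) + be * (cim W - cim r).
  rewrite Wre Wim.
  pose m := Num.min (al * (cre A - cre r) + be * (cim A - cim r)) (al * (cre B - cre r) + be * (cim B - cim r)).
  have m0 : 0 < m by rewrite lt_min lA.
  apply: (lt_le_trans m0).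
  have H1 : m <= al * (cre A - cre r) + be * (cim A - cim r) by rewrite ge_min lexx.
  have H2 : m <= al * (cre B - cre r) + be * (cim B - cim r) by rewrite ge_min lexx orbT.
  by apply: le_trans (conv m _ _ u u01 H1 H2) _; rewrite le_eqVlt; apply/orP; left; apply/eqP; ring.
by rewrite Wr !subrr !mulr0 addr0 ltxx.
Qed.
End Rectangle.

(** * From circle integrals to rectangle integrals *)

Section Circle.
Variable R : realType.
Implicit Types (f : R[i] -> R[i]) (x y : R) (z w p q r : R[i]).

Lemma cre_arcpt r (e th : R) : cre (arcpt r e th) = cre r + e * cos th.
Proof. by rewrite /arcpt !cE !(mul0r, mul1r, subrr, subr0, addr0, add0r) expR0 mul1r. Qed.

Lemma cim_arcpt r (e th : R) : cim (arcpt r e th) = cim r + e * sin th.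
Proof. by rewrite /arcpt !cE !(mul0r, mul1r, subrr, subr0, addr0, add0r) expR0 mul1r. Qed.

(** With [h = pi / 4], each arc between consecutive cuts is a range of angles on which one of [cos],
    [sin] keeps a strict sign. Up to sign, that function is the linear form separating the sector
    from the center. *)
Lemma cos_pos1 (h th : R) : pi = 4 * h -> 0 < h -> 0 <= th <= h -> 0 < cos th.
Proof. by move=> hpi h0 H; apply: cos_gt0_pihalf; rewrite hpi; lra. Qed.

Lemma cos_pos8 (h th : R) : pi = 4 * h -> 0 < h -> 7 * h <= th <= 8 * h -> 0 < cos th.
Proof.
move=> hpi h0 H; have <- : cos (th - pi *+ 2) = cos th by rewrite -[in RHS](subrK (pi *+ 2) th) cosD2pi.
by apply: cos_gt0_pihalf; rewrite hpi; lra.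
Qed.

Lemma sin_pos (h th : R) : pi = 4 * h -> 0 < h -> h <= th <= 3 * h -> 0 < sin th.
Proof. by move=> hpi h0 H; apply: sin_gt0_pi; rewrite hpi; lra. Qed.

Lemma cos_neg (h th : R) : pi = 4 * h -> 0 < h -> 3 * h <= th <= 5 * h -> cos th < 0.
Proof.
move=> hpi h0 H; rewrite -[th](subrK pi) cosDpi oppr_lt0.
by apply: cos_gt0_pihalf; rewrite hpi; lra.
Qed.

Lemma sin_neg (h th : R) : pi = 4 * h -> 0 < h -> 5 * h <= th <= 7 * h -> sin th < 0.
Proof.
move=> hpi h0 H; rewrite -[th](subrK pi) sinDpi oppr_lt0.
by apply: sin_gt0_pi; rewrite hpi; lra.
Qed.

Lemma cut_cancel (s0 s1 s2 s3 s4 a b c d t : R[i]) :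
  s0 + a - s1 + (s1 + b - s2 + (s2 + c - s3 + (s3 + d - s4 + (s4 + t - s0)))) = d + (t + a) + b + c.
Proof. ring. Qed.

(* The region between circle and rectangle is cut along rays from the circle to the midpoint
   of the right side and to the four corners; the cuts cancel in pairs. *)
Lemma circle_rect f x0 x1 y0 y1 r (e : R) : 0 < e ->
  x0 <= cre r - e -> cre r + e <= x1 -> y0 <= cim r - e -> cim r + e <= y1 ->
  (forall z, inrect x0 x1 y0 y1 z -> z <> r -> holo f z) ->
  circle_int f r e = rectint f x0 x1 y0 y1.
Proof.
move=> e0 rx0 rx1 ry0 ry1 hf.
have hf' z : punctured x0 x1 y0 y1 r z -> holo f z by case; exact: hf.
set a := cre r in rx0 rx1 *; set b := cim r in ry0 ry1 *.
have arc_in th : inrect x0 x1 y0 y1 (arcpt r e th).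
  rewrite /inrect cre_arcpt cim_arcpt -/a -/b.
  have c1 : e * cos th <= e by rewrite ger_pMr // cos_le1.
  have c2 : - e <= e * cos th by rewrite -mulrN1 ler_pM2l // cos_geN1.
  have s1 : e * sin th <= e by rewrite ger_pMr // sin_le1.
  have s2 : - e <= e * sin th by rewrite -mulrN1 ler_pM2l // sin_geN1.
  by do !(apply/andP; split); lra.
(* (al, be) is the outward normal of the side facing the arc; it is positive on the arc and at both
   ends of the segment, so the whole sector avoids [r]. *)
have S (s t al be : R) p q : s < t ->
    inrect x0 x1 y0 y1 p -> inrect x0 x1 y0 y1 q ->
    (forall th, s <= th <= t -> 0 < al * cos th + be * sin th) ->
    0 < al * (cre p - a) + be * (cim p - b) ->
    0 < al * (cre q - a) + be * (cim q - b) ->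
    arcint f r e s t = seg f (arcpt r e s) p + seg f p q - seg f (arcpt r e t) q.
  move=> st ip iq pos lp lq; apply: sector => // u v u01 vst.
  apply: hf'; apply: (sector_inside (al := al) (be := be)) => //.
  - move/andP: vst => [sv vt]; have ts : 0 < t - s by rewrite subr_gt0.
    by rewrite divr_ge0 ?subr_ge0 ?(ltW st) //= ler_pdivrMr // mul1r lerD2r.
  - rewrite cre_arcpt cim_arcpt.
    have -> : al * (cre r + e * cos v - cre r) + be * (cim r + e * sin v - cim r) = e * (al * cos v + be * sin v) by ring.
    by rewrite mulr_gt0 // pos.
(* [circle_int] starts at angle 0, so the right side is split at the height of the center. *)
pose p0 := Complex x1 b; pose p1 := Complex x1 y1; pose p2 := Complex x0 y1.
pose p3 := Complex x0 y0; pose p4 := Complex x1 y0.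
have ar : a < x1 by apply: lt_le_trans rx1; rewrite ltrDl.
have al : x0 < a by apply: le_lt_trans rx0 _; rewrite gtrBl.
have bu : b < y1 by apply: lt_le_trans ry1; rewrite ltrDl.
have bd : y0 < b by apply: le_lt_trans ry0 _; rewrite gtrBl.
have x01 : x0 < x1 := lt_trans al ar.
have y01 : y0 < y1 := lt_trans bd bu.
have lx : x0 <= x0 <= x1 by rewrite lexx ltW.
have rx : x0 <= x1 <= x1 by rewrite lexx ltW.
have dy : y0 <= y0 <= y1 by rewrite lexx ltW.
have uy : y0 <= y1 <= y1 by rewrite lexx ltW.
have i0 : inrect x0 x1 y0 y1 p0 by apply: inrectC => //; rewrite !ltW.
have i1 := inrectC rx uy; have i2 := inrectC lx uy.
have i3 := inrectC lx dy; have i4 := inrectC rx dy.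
pose h := pi / 4 : R.
have hpi : pi = 4 * h :> R by rewrite /h; field.
have h0 : 0 < h by rewrite divr_gt0 // pi_gt0.
have h01 : 0 < h by []; have h13 : h < 3 * h by rewrite ltr_pMl // ltr1n.
have h35 : 3 * h < 5 * h by rewrite ltr_pM2r // ltr_nat.
have h57 : 5 * h < 7 * h by rewrite ltr_pM2r // ltr_nat.
have h78 : 7 * h < 8 * h by rewrite ltr_pM2r // ltr_nat.
have S1 : arcint f r e 0 h = seg f (arcpt r e 0) p0 + seg f p0 p1 - seg f (arcpt r e h) p1.
  apply: (S 0 h 1 0 p0 p1 h01 i0 i1); rewrite ?mul1r ?mul0r ?addr0 ?subr_gt0 //.
  by move=> th /(cos_pos1 hpi h0) ?; rewrite mul1r mul0r addr0.
have S2 : arcint f r e h (3 * h) = seg f (arcpt r e h) p1 + seg f p1 p2 - seg f (arcpt r e (3 * h)) p2.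
  apply: (S h (3 * h) 0 1 p1 p2 h13 i1 i2); rewrite ?mul1r ?mul0r ?add0r ?subr_gt0 //.
  by move=> th /(sin_pos hpi h0) ?; rewrite mul1r mul0r add0r.
have S3 : arcint f r e (3 * h) (5 * h) = seg f (arcpt r e (3 * h)) p2 + seg f p2 p3 - seg f (arcpt r e (5 * h)) p3.
  apply: (S (3 * h) (5 * h) (-1) 0 p2 p3 h35 i2 i3); rewrite ?mulN1r ?mul0r ?addr0 ?oppr_gt0 ?subr_lt0 //.
  by move=> th /(cos_neg hpi h0) ?; rewrite mulN1r mul0r addr0 oppr_gt0.
have S4 : arcint f r e (5 * h) (7 * h) = seg f (arcpt r e (5 * h)) p3 + seg f p3 p4 - seg f (arcpt r e (7 * h)) p4.
  apply: (S (5 * h) (7 * h) 0 (-1) p3 p4 h57 i3 i4); rewrite ?mulN1r ?mul0r ?add0r ?oppr_gt0 ?subr_lt0 //.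
  by move=> th /(sin_neg hpi h0) ?; rewrite mulN1r mul0r add0r oppr_gt0.
have S5 : arcint f r e (7 * h) (8 * h) = seg f (arcpt r e (7 * h)) p4 + seg f p4 p0 - seg f (arcpt r e (8 * h)) p0.
  apply: (S (7 * h) (8 * h) 1 0 p4 p0 h78 i4 i0); rewrite ?mul1r ?mul0r ?addr0 ?subr_gt0 //.
  by move=> th /(cos_pos8 hpi h0) ?; rewrite mul1r mul0r addr0.
have E0 : arcpt r e (8 * h) = arcpt r e 0.
  apply: eqC; rewrite ?cre_arcpt ?cim_arcpt.
    by rewrite (_ : 8 * h = 0 + pi *+ 2); [rewrite cosD2pi|rewrite hpi; ring].
  by rewrite (_ : 8 * h = 0 + pi *+ 2); [rewrite sinD2pi|rewrite hpi; ring].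
have carc (s t : R) : cintegrable `[s, t]
   (fun th => f (r + rc e * cexp (ci * rc th)) * (ci * rc e * cexp (ci * rc th))).
  apply: ccont_integrable => th _; apply: ccontM; last exact: ccont_darc.
  apply: (@ccont_comp _ _ (arcpt r e)); last exact: cder_cont (cder_arcpt r e th).
  apply: holo_ccf; apply: hf; first exact: arc_in.
  (* A point of the circle differs from the center because its squared distance to it is e^2. *)
  move=> /(congr1 (fun z => (cre z - a) ^+ 2 + (cim z - b) ^+ 2)).
  rewrite cre_arcpt cim_arcpt -/a -/b !subrr expr0n addr0.
  rewrite (addrC a) addrK (addrC b) addrK !exprMn -mulrDr cos2Dsin2 mulr1.
  by move/eqP; rewrite sqrf_eq0 gt_eqF.
have arcD (s t u : R) : s <= t -> t <= u -> arcint f r e s u = arcint f r e s t + arcint f r e t u.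
  by move=> st tu; apply: cintegral_split.
have -> : circle_int f r e = arcint f r e 0 (8 * h).
  by rewrite /circle_int (_ : 2 * pi = 8 * h) // hpi; ring.
have [l1 l3 l5 l7] : [/\ 0 <= h, h <= 3 * h, 3 * h <= 5 * h & 5 * h <= 7 * h] by rewrite !ltW.
have m7 : 7 * h <= 8 * h := ltW h78.
have m5 : 5 * h <= 8 * h := le_trans l7 m7.
have m3 : 3 * h <= 8 * h := le_trans l5 m5.
rewrite (arcD _ _ _ l1 (le_trans l3 m3)) (arcD _ _ _ l3 m3) (arcD _ _ _ l5 m5) (arcD _ _ _ l7 m7).
rewrite S1 S2 S3 S4 S5 E0 cut_cancel.
have cf x y : inrect x0 x1 y0 y1 (Complex x y) -> x != a \/ y != b -> ccf f (Complex x y).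
  move=> inr ne; apply: holo_ccf; apply: hf => // E.
  by case: ne; rewrite /a /b -E !cE eqxx.
have an1 : x0 != a by rewrite lt_eqF.
have an2 : x1 != a by rewrite gt_eqF.
have bn1 : y0 != b by rewrite lt_eqF.
have bn2 : y1 != b by rewrite gt_eqF.
have T1 : seg f p1 p2 = - hint f y1 x0 x1.
  by apply: (seg_h_rev x01) => x xx; apply: cf (inrectC xx uy) _; right.
have T3 : seg f p3 p4 = hint f y0 x0 x1.
  by apply: (seg_h x01) => x xx; apply: cf (inrectC xx dy) _; right.
have T2 : seg f p2 p3 = - vint f x0 y0 y1.
  by apply: (seg_v_rev y01) => y yy; apply: cf (inrectC lx yy) _; left.
have T4 : seg f p4 p0 + seg f p0 p1 = vint f x1 y0 y1.
  have cv y : y0 <= y <= y1 -> ccf f (Complex x1 y).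
    by move=> yy; apply: cf (inrectC rx yy) _; left.
  rewrite (seg_v bd) => [|y /andP[u v]]; last by apply: cv; rewrite u (le_trans v (ltW bu)).
  rewrite (seg_v bu) => [|y /andP[u v]]; last by apply: cv; rewrite v (le_trans (ltW bd) u).
  rewrite /vint -mulrDr -(cintegral_split (ltW bd) (ltW bu)) //.
  by apply: ccont_integrable => y /cv /ccont_v.
by rewrite T4 T1 T2 T3.
Qed.
End Circle.

(** * The residue theorem for finitely many poles in a rectangle *)

Section Residues.
Variable R : realType.
Implicit Types (f : R[i] -> R[i]) (x y : R) (z w p q r : R[i]).

Lemma twopii_neq0 : rc (2 * pi) * ci != 0 :> R[i].
Proof. by rewrite mulf_neq0 ?ci_neq0 // rc_eq0 mulf_neq0 ?pnatr_eq0 // gt_eqF // pi_gt0. Qed.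

Lemma Res_eventually f r (d : R) (v : R[i]) : 0 < d ->
  (forall e, 0 < e -> e < d -> circle_int f r e = rc (2 * pi) * ci * v) ->
  Res f r = v.
Proof.
move=> d0 H; apply: cvg_lim; first exact: norm_hausdorff.
apply: cvg_near_cst; near=> e.
rewrite H; last 2 first.
- by near: e; exact: nbhs_right_gt.
- by near: e; exact: nbhs_right_lt.
by rewrite mulrC mulKf // twopii_neq0.
Unshelve. all: by end_near. Qed.

(** All sufficiently small circles have the same integral, that of the rectangle, so the limit
    defining [Res] is that of an eventually constant function. *)
Lemma Res_rect f x0 x1 y0 y1 r : x0 < cre r < x1 -> y0 < cim r < y1 ->
  (forall z, inrect x0 x1 y0 y1 z -> z <> r -> holo f z) ->
  rectint f x0 x1 y0 y1 = rc (2 * pi) * ci * Res f r.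
Proof.
move=> /andP[a b] /andP[c d] hf.
pose e0 := Num.min (Num.min (cre r - x0) (x1 - cre r)) (Num.min (cim r - y0) (y1 - cim r)).
have e00 : 0 < e0 by rewrite !lt_min !subr_gt0 a b c d.
have <- : rectint f x0 x1 y0 y1 / (rc (2 * pi) * ci) = Res f r.
  symmetry; apply: (Res_eventually e00) => e e_gt0.
  rewrite !lt_min => /andP[/andP[e1 e2] /andP[e3 e4]].
  rewrite (@circle_rect _ f x0 x1 y0 y1) //; [|lra..].
  by rewrite mulrC divfK // twopii_neq0.
by rewrite mulrC divfK // twopii_neq0.
Qed.

Lemma exists_avoid (a b : R) (l : seq R) : a < b -> exists2 x, a < x < b & x \notin l.
Proof.
elim: l a b => [|h l IH] a b ab; first by exists ((a + b) / 2) => //; rewrite ?midf_lt.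
have [/andP[ah hb]|out] := boolP (a < h < b).
  have [x /andP[ax xh] xl] := IH a h ah; exists x; first by rewrite ax (lt_trans xh).
  by rewrite inE negb_or xl andbT lt_eqF.
have [x xab xl] := IH a b ab; exists x => //; rewrite inE negb_or xl andbT.
by apply/eqP => E; rewrite -E xab in out.
Qed.

Lemma rectint_cutx f x0 x1 x2 y0 y1 : x0 <= x1 -> x1 <= x2 ->
  (forall x, x0 <= x <= x2 -> ccf f (Complex x y0) /\ ccf f (Complex x y1)) ->
  rectint f x0 x2 y0 y1 = rectint f x0 x1 y0 y1 + rectint f x1 x2 y0 y1.
Proof.
move=> a b cf; rewrite /rectint /hint !(@cintegral_split _ _ x0 x1 x2) //.
- ring.
- by apply: ccont_integrable => x /cf[_ /ccont_h].
- by apply: ccont_integrable => x /cf[/ccont_h].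
Qed.

Lemma rectint_cuty f x0 x1 y0 y1 y2 : y0 <= y1 -> y1 <= y2 ->
  (forall y, y0 <= y <= y2 -> ccf f (Complex x0 y) /\ ccf f (Complex x1 y)) ->
  rectint f x0 x1 y0 y2 = rectint f x0 x1 y0 y1 + rectint f x0 x1 y1 y2.
Proof.
move=> a b cf; rewrite /rectint /vint !(@cintegral_split _ _ y0 y1 y2) //.
- ring.
- by apply: ccont_integrable => x /cf[/ccont_v].
- by apply: ccont_integrable => x /cf[_ /ccont_v].
Qed.

Definition inside x0 x1 y0 y1 z := (x0 < cre z < x1) && (y0 < cim z < y1).

(** Strong induction on the number of poles. Two distinct poles differ in real or imaginary part; a
    line strictly between them and off all poles cuts the rectangle into two, each with fewer
    poles. *)
Theorem residue_rect f x0 x1 y0 y1 (s : seq R[i]) : x0 <= x1 -> y0 <= y1 -> uniq s ->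
  (forall z, z \in s -> inside x0 x1 y0 y1 z) ->
  (forall z, inrect x0 x1 y0 y1 z -> z \notin s -> holo f z) ->
  rectint f x0 x1 y0 y1 = rc (2 * pi) * ci * \sum_(r <- s) Res f r.
Proof.
have [n] := ubnP (size s); elim: n s x0 x1 y0 y1 => // n IH s x0 x1 y0 y1 sn x01 y01 us ins hf.
case E : s => [|r1 [|r2 s']].
- rewrite big_nil mulr0; apply: goursat_rect => // z iz; apply: hf => //.
  by rewrite E.
- rewrite big_seq1; have /andP[? ?] : inside x0 x1 y0 y1 r1 by apply: ins; rewrite E mem_seq1.
  by apply: Res_rect => // z iz zr; apply: hf => //; rewrite E mem_seq1; apply/eqP.
rewrite -E.
have r1s : r1 \in s by rewrite E !inE eqxx.
have r2s : r2 \in s by rewrite E !inE eqxx orbT.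
have r12 : r1 != r2 by move: us; rewrite E /= inE negb_or -andbA => /and3P[].
have small (P : pred R[i]) r : r \in s -> ~~ P r -> (size (seq.filter P s) < n)%N.
  move=> rs nP; rewrite size_filter; apply: (@leq_trans (size s)); last by rewrite -ltnS.
  rewrite ltn_neqAle count_size andbT -all_count; apply/negP => /allP /(_ _ rs).
  by rewrite (negPf nP).
have sumE (P : pred R[i]) : \sum_(r <- s) Res f r =
    \sum_(r <- seq.filter P s) Res f r + \sum_(r <- seq.filter (predC P) s) Res f r.
  by rewrite (bigID P) /= !big_filter.
have nbd z : inrect x0 x1 y0 y1 z -> ~~ inside x0 x1 y0 y1 z -> ccf f z.
  by move=> iz nz; apply/holo_ccf/hf => //; apply: contra nz; exact: ins.
(* Equal real parts call for a horizontal cut; otherwise a vertical cut separates [r1] and [r2]. *)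
have [cEq|cNe] := eqVneq (cre r1) (cre r2).
  have iNe : cim r1 != cim r2.
    by apply: contraNneq r12 => iE; apply/eqP; exact: eqC.
  wlog lt12 : r1 r2 r1s r2s iNe {E r12 cEq} / cim r1 < cim r2.
    move=> W; have [L|L|L] := ltgtP (cim r1) (cim r2).
    - exact: (W r1 r2).
    - by apply: (W r2 r1) => //; rewrite eq_sym.
    - by rewrite L eqxx in iNe.
  have [t /andP[t1 t2] tl] := exists_avoid (map (@cim R) s) lt12.
  have tne z : z \in s -> cim z != t.
    by move=> zs; apply: contraNneq tl => <-; exact: map_f.
  have /andP[_ /andP[ir1 _]] := ins _ r1s; have /andP[_ /andP[_ ir2]] := ins _ r2s.
  pose P z := cim z < t.
  have sP1 : (size (seq.filter P s) < n)%N by apply: (small _ r2) => //; rewrite /P -leNgt ltW.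
  have sP2 : (size (seq.filter (predC P) s) < n)%N by apply: (small _ r1) => //=; rewrite /P negbK.
  rewrite (sumE P) mulrDr (@rectint_cuty f x0 x1 y0 t y1); [|lra|lra|]; last first.
    by move=> y yy; split; apply: nbd; rewrite /inrect /inside !cE ?lexx ?x01 ?yy ?ltxx ?andbF.
  congr (_ + _); apply: IH => //; rewrite ?filter_uniq //; try lra.
  - move=> z; rewrite mem_filter /P => /andP[zt /ins /andP[zx /andP[zy _]]].
    by rewrite /inside zx zy zt.
  - move=> z iz nz; apply: hf.
      by move: iz => /andP[zx /andP[zy zt]]; rewrite /inrect zx zy /=; lra.
    move: nz; rewrite mem_filter negb_and => /orP[|//].
    rewrite /P -leNgt => tz; apply/negP => /tne; move: iz => /andP[_ /andP[_ zt]].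
    by rewrite eq_le zt tz.
  - move=> z; rewrite mem_filter /= /P -leNgt => /andP[zt /[dup] /tne zn /ins /andP[zx /andP[_ zy]]].
    by rewrite /inside zx zy lt_neqAle zt eq_sym zn.
  - move=> z iz nz; apply: hf.
      by move: iz => /andP[zx /andP[zy zt]]; rewrite /inrect zx zt andbT /=; lra.
    move: nz; rewrite mem_filter negb_and /= => /orP[|//].
    rewrite /P negbK => tz; apply/negP => _; move: iz => /andP[_ /andP[zt _]].
    by rewrite leNgt tz in zt.
wlog lt12 : r1 r2 r1s r2s cNe {E r12} / cre r1 < cre r2.
  move=> W; have [L|L|L] := ltgtP (cre r1) (cre r2).
  - exact: (W r1 r2).
  - by apply: (W r2 r1) => //; rewrite eq_sym.
  - by rewrite L eqxx in cNe.
have [t /andP[t1 t2] tl] := exists_avoid (map (@cre R) s) lt12.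
have tne z : z \in s -> cre z != t.
  by move=> zs; apply: contraNneq tl => <-; exact: map_f.
have /andP[/andP[ir1 _] _] := ins _ r1s; have /andP[/andP[_ ir2] _] := ins _ r2s.
pose P z := cre z < t.
have sP1 : (size (seq.filter P s) < n)%N by apply: (small _ r2) => //; rewrite /P -leNgt ltW.
have sP2 : (size (seq.filter (predC P) s) < n)%N by apply: (small _ r1) => //=; rewrite /P negbK.
rewrite (sumE P) mulrDr (@rectint_cutx f x0 t x1 y0 y1); [|lra|lra|]; last first.
  by move=> y yy; split; apply: nbd; rewrite /inrect /inside !cE ?lexx ?y01 ?yy ?ltxx ?andbF.
congr (_ + _); apply: IH => //; rewrite ?filter_uniq //; try lra.
- move=> z; rewrite mem_filter /P => /andP[zt /ins /andP[/andP[zy _] zx]].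
  by rewrite /inside zx zy zt.
- move=> z iz nz; apply: hf.
    by move: iz => /andP[/andP[zy zt] zx]; rewrite /inrect zx zy andbT /=; lra.
  move: nz; rewrite mem_filter negb_and => /orP[|//].
  rewrite /P -leNgt => tz; apply/negP => /tne; move: iz => /andP[/andP[_ zt] _].
  by rewrite eq_le zt tz.
- move=> z; rewrite mem_filter /= /P -leNgt => /andP[zt /[dup] /tne zn /ins /andP[/andP[_ zy] zx]].
  by rewrite /inside zx zy lt_neqAle zt eq_sym zn.
- move=> z iz nz; apply: hf.
    by move: iz => /andP[/andP[zy zt] zx]; rewrite /inrect zx zt !andbT /=; lra.
  move: nz; rewrite mem_filter negb_and /= => /orP[|//].
  rewrite /P negbK => tz; apply/negP => _; move: iz => /andP[/andP[zt _] _].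
  by rewrite leNgt tz in zt.
Qed.
End Residues.

(** * Residues from polar parts *)

Section ResidueLimits.
Variable R : realType.
Implicit Types (f g : R[i] -> R[i]) (x y : R) (z w p q r : R[i]).

Lemma Res_lim f r v :
  (forall eta : R, 0 < eta -> exists2 d : R, 0 < d & forall e, 0 < e < d ->
     cabs (circle_int f r e - rc (2 * pi) * ci * v) <= eta) ->
  Res f r = v.
Proof.
move=> H; apply: cvg_lim; first exact: norm_hausdorff.
have c0 : 0 < cabs (rc (2 * pi) * ci : R[i]) by rewrite cabs_gt0 twopii_neq0.
apply/cvgrPdist_le => eta eta0.
have eE : eta = rc (cre eta) by apply: eqC; rewrite ?cE //; move: eta0; rewrite ltcE => /andP[/eqP].
have eta0' : 0 < cre eta by rewrite -lt_rc -eE.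
have [d d0 Hd] := H _ (mulr_gt0 eta0' c0).
near=> e; rewrite eE cabsE le_rc cabsBC.
rewrite (_ : _ - v = (circle_int f r e - rc (2 * pi) * ci * v) / (rc (2 * pi) * ci)); last first.
  by rewrite mulrBl [X in _ = _ - X]mulrC mulKf ?twopii_neq0.
rewrite cabsM cabsV ler_pdivrMr // Hd //; apply/andP; split.
- by near: e; exact: nbhs_right_gt.
- by near: e; exact: nbhs_right_lt.
Unshelve. all: by end_near. Qed.

Lemma arcptB r (e th : R) : arcpt r e th - r = rc e * cexp (ci * rc th).
Proof. by rewrite /arcpt addrC addKr. Qed.

Lemma cabs_arcptB r (e th : R) : 0 < e -> cabs (arcpt r e th - r) = e.
Proof. by move=> e0; rewrite arcptB cabsM cabs_cexp_ci mulr1 cabs_rc gtr0_norm. Qed.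

Lemma ccont_circle f r (e : R) (th : R) : ccf f (arcpt r e th) ->
  ccont (fun th => f (r + rc e * cexp (ci * rc th)) * (ci * rc e * cexp (ci * rc th))) th.
Proof.
move=> H; apply: ccontM; last exact: ccont_darc.
exact: (@ccont_comp _ f (arcpt r e) th H (cder_cont (cder_arcpt r e th))).
Qed.

Lemma circle_integrable f r (e : R) : 0 < e -> (forall z, cabs (z - r) = e -> ccf f z) ->
  cintegrable `[0, 2 * pi]
   (fun th => f (r + rc e * cexp (ci * rc th)) * (ci * rc e * cexp (ci * rc th))).
Proof.
move=> e0 H; apply: ccont_integrable => th _; apply: ccont_circle; apply: H.
exact: cabs_arcptB.
Qed.

Lemma circleD f g r (e : R) : 0 < e -> (forall z, cabs (z - r) = e -> ccf f z) ->
  (forall z, cabs (z - r) = e -> ccf g z) ->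
  circle_int (fun z => f z + g z) r e = circle_int f r e + circle_int g r e.
Proof.
move=> e0 cf cg; rewrite /circle_int -cintegralD //; try exact: circle_integrable.
by apply: eq_cintegral => th _; rewrite mulrDl.
Qed.

Lemma circleZ f k r (e : R) : 0 < e -> (forall z, cabs (z - r) = e -> ccf f z) ->
  circle_int (fun z => k * f z) r e = k * circle_int f r e.
Proof.
move=> e0 cf; rewrite /circle_int -cintegralZ //; try exact: circle_integrable.
by apply: eq_cintegral => th _; rewrite -mulrA.
Qed.

Lemma eq_circle f g r (e : R) : 0 < e -> (forall z, cabs (z - r) = e -> f z = g z) ->
  circle_int f r e = circle_int g r e.
Proof.
move=> e0 fg; apply: eq_cintegral => th _; congr (_ * _); apply: fg.
exact: (cabs_arcptB r th e0).
Qed.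

Let tp0 : 0 <= 2 * pi :> R.
Proof. by rewrite mulr_ge0 // pi_ge0. Qed.

Lemma circle_bound f r (e M : R) : 0 < e ->
  (forall z, cabs (z - r) = e -> ccf f z) ->
  (forall z, cabs (z - r) = e -> cabs (f z) <= M) ->
  cabs (circle_int f r e) <= M * e * (2 * pi).
Proof.
move=> e0 cf fM; rewrite -[X in _ <= _ * X]subr0.
apply: cabs_cintegral_bound => [||th _]; first exact: tp0.
- by move=> th _; apply/ccont_circle/cf; exact: cabs_arcptB.
rewrite cabsM !cabsM cabs_ci mul1r cabs_cexp_ci mulr1 cabs_rc gtr0_norm //.
by rewrite ler_wpM2r ?(ltW e0) //; apply: fM; exact: (cabs_arcptB r th e0).
Qed.

Lemma circle_pole r (e : R) k : 0 < e ->
  circle_int (fun z => k / (z - r)) r e = rc (2 * pi) * ci * k.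
Proof.
move=> e0; have re0 : rc e != 0 :> R[i] by rewrite rc_eq0 gt_eqF.
rewrite /circle_int (eq_cintegral (h := fun=> k * ci)); last first.
  move=> th _; rewrite -/(arcpt r e th) arcptB.
  have := cexp_neq0 (ci * rc th); move: (cexp _) => c c0; field.
  by rewrite c0.
rewrite (@cintegral_FTC _ _ (fun th => k * ci * rc th)) //.
- by rewrite rc0; ring.
- by move=> th _; apply: cder_eq (cderZ _ (cder_id th)) _; rewrite mulr1.
- by move=> th _; exact: ccont_cst.
Qed.

(** The circle integral of al / (z - r) is exact for every radius. What remains is at most a small
    multiple of 1 / e on a circle of length 2 pi e. *)
Lemma circle_simple f r al : (exists2 d : R, 0 < d & forall z, 0 < cabs (z - r) < d -> ccf f z) ->
  (forall eta : R, 0 < eta -> exists2 d : R, 0 < d & forall z, 0 < cabs (z - r) < d ->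
    cabs ((z - r) * f z - al) <= eta) ->
  forall eta : R, 0 < eta -> exists2 d : R, 0 < d & forall e, 0 < e < d ->
     cabs (circle_int f r e - rc (2 * pi) * ci * al) <= eta.
Proof.
move=> [d0 d00 cf] H eta eta0.
have tp : 0 < 2 * pi :> R by rewrite mulr_gt0 // pi_gt0.
have [d1 d10 Hd] := H _ (divr_gt0 eta0 tp).
exists (Num.min d0 d1); first by rewrite lt_min d00.
move=> e /andP[e0]; rewrite lt_min => /andP[ed0 ed1].
have zr z : cabs (z - r) = e -> z - r != 0 by rewrite -cabs_gt0 => ->.
have cP z : cabs (z - r) = e -> ccf (fun z => (- al) / (z - r)) z.
  move=> /zr zr0; apply: ccfM; first exact: ccf_cst.
  apply: (@ccf_compf _ (fun w => w^-1) (fun z => z - r)); first exact: ccfV.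
  exact/holo_ccf/holoD/holo_cst/holo_id.
have cF z : cabs (z - r) = e -> ccf f z by move=> E; apply: cf; rewrite E e0.
rewrite (_ : _ - _ = circle_int (fun z => f z + (- al) / (z - r)) r e); last first.
  by rewrite circleD // circle_pole // mulrN.
rewrite (le_trans (@circle_bound _ _ _ (eta / (2 * pi) / e) e0 _ _)) //.
- by move=> z E; apply: ccfD; [exact: cF|exact: cP].
- move=> z E; rewrite (_ : _ + _ = ((z - r) * f z - al) / (z - r)); last first.
    by field; exact: zr.
  rewrite cabsM cabsV E ler_wpM2r ?invr_ge0 ?(ltW e0) //.
  by apply: Hd; rewrite E e0.
- by rewrite divfK ?gt_eqF // divfK ?gt_eqF.
Qed.

Lemma Res_simple f r al : (exists2 d : R, 0 < d & forall z, 0 < cabs (z - r) < d -> ccf f z) ->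
  (forall eta : R, 0 < eta -> exists2 d : R, 0 < d & forall z, 0 < cabs (z - r) < d ->
    cabs ((z - r) * f z - al) <= eta) -> Res f r = al.
Proof. by move=> cf H; apply: Res_lim; exact: circle_simple. Qed.

Lemma cderX (g : R -> R[i]) x l n : cder g x l ->
  cder (fun t => g t ^+ n.+1) x (n.+1%:R * g x ^+ n * l).
Proof.
move=> dg; elim: n => [|n IH].
  by apply: cder_eq dg _; rewrite expr0 mulr1 mul1r.
rewrite (_ : (fun t => _) = fun t => g t * g t ^+ n.+1); last first.
  by apply/funext => t; rewrite exprS.
apply: cder_eq (cderM dg IH) _; rewrite (exprS _ n) [in RHS]mulrS; ring.
Qed.

Lemma holo_cpow (m : R) z : holo (fun s => cpow m (- s)) z.
Proof.
apply: (@holo_comp _ (@cexp R) (fun s => - s * rc (ln m))); first exact: holo_cexp.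
rewrite (_ : (fun s => _) = fun s => s * (- rc (ln m))); last by apply/funext => s; ring.
exact: holoM (@holo_id _ _) (@holo_cst _ _ _).
Qed.

Lemma ccf_inv r z : z != r -> ccf (fun z => (z - r)^-1) z.
Proof.
move=> zr; apply: (@ccf_compf _ (fun w => w^-1) (fun z => z - r)).
  by apply: ccfV; rewrite subr_eq0.
exact/holo_ccf/holoD/holo_cst/holo_id.
Qed.

Lemma ccfX f z n : ccf f z -> ccf (fun z => f z ^+ n) z.
Proof.
move=> cf; elim: n => [|n IH]; first exact: ccf_cst.
under eq_fun do rewrite exprS; exact: ccfM.
Qed.

Lemma ccf_pw (m : R) r z n : z != r -> ccf (fun s => cpow m (- s) * (s - r)^-1 ^+ n) z.
Proof. by move=> zr; apply: ccfM; [exact/holo_ccf/holo_cpow|apply: ccfX; exact: ccf_inv]. Qed.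

(* Integrate the derivative of [cpow m (- s) / (s - r) ^+ n.+1] over the closed circle. *)
Lemma circle_pw_rec (m : R) r (e : R) n : 0 < e ->
  circle_int (fun s => cpow m (- s) * (s - r)^-1 ^+ n.+2) r e =
  (- rc (ln m) / n.+1%:R) * circle_int (fun s => cpow m (- s) * (s - r)^-1 ^+ n.+1) r e.
Proof.
move=> e0; have re0 : rc e != 0 :> R[i] by rewrite rc_eq0 gt_eqF.
pose c (th : R) := cexp (ci * rc th).
have c0 th : c th != 0 by exact: cexp_neq0.
(* 1 / (s - r) along the circle is again an exponential, so it is differentiated without a quotient
   rule. *)
pose u th := (rc e)^-1 * cexp (- ci * rc th).
have uE th : u th = (arcpt r e th - r)^-1.
  by rewrite arcptB invfM /u -cexpN mulNr.
pose E th := cpow m (- arcpt r e th).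
have dE th : cder E th (- rc (ln m) * (ci * rc e * c th) * E th).
  have EE : E = fun th => cexp (-1 * arcpt r e th * rc (ln m)).
    by apply/funext => t; rewrite /E /cpow mulN1r.
  rewrite {1}EE.
  apply: cder_eq (cder_exp (cderM (cderZ (-1) (cder_arcpt r e th)) (cder_cst (rc (ln m)) th))) _.
  by rewrite EE /c mulr0 addr0; ring.
have du th : cder u th (- ci * u th).
  apply: cder_eq (cderZ (rc e)^-1 (cder_exp (cderZ (- ci) (cder_id th)))) _.
  by rewrite /u; ring.
pose K th := E th * u th ^+ n.+1.
pose dK th := - rc (ln m) * (cpow m (- arcpt r e th) * (arcpt r e th - r)^-1 ^+ n.+1 * (ci * rc e * c th))
  + - n.+1%:R * (cpow m (- arcpt r e th) * (arcpt r e th - r)^-1 ^+ n.+2 * (ci * rc e * c th)).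
have dKP th : cder K th (dK th).
  apply: cder_eq (cderM (dE th) (cderX n (du th))) _.
  rewrite /dK -uE -/(E th) !exprS.
  have ec : rc e * c th = (u th)^-1 by rewrite uE invrK arcptB.
  have u0 : u th != 0 by rewrite uE invr_eq0 -cabs_gt0 cabs_arcptB.
  rewrite -[ci * rc e * c th]mulrA ec; field.
  by rewrite u0.
have zr z : cabs (z - r) = e -> z != r by move=> Z; rewrite -subr_eq0 -cabs_gt0 Z.
have ar th : arcpt r e th != r by apply: zr; exact: cabs_arcptB.
have cK th : ccont dK th.
  apply: ccontD; (apply: ccontM; first exact: ccont_cst);
    exact: (@ccont_circle (fun s => cpow m (- s) * (s - r)^-1 ^+ _) r e th (ccf_pw _ _ (ar th))).
have := cintegral_FTC tp0 (fun th _ => dKP th) (fun th _ => cK th).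
have -> : K (2 * pi) = K 0.
  have P : arcpt r e (2 * pi) = arcpt r e 0.
    apply: eqC; rewrite ?cre_arcpt ?cim_arcpt (_ : 2 * pi = 0 + pi *+ 2) ?cosD2pi ?sinD2pi //; ring.
  by rewrite /K !uE /E P.
have ik k : cintegrable `[0, 2 * pi] (fun th => cpow m (- arcpt r e th) *
    (arcpt r e th - r)^-1 ^+ k * (ci * rc e * c th)).
  apply: (@circle_integrable (fun s => cpow m (- s) * (s - r)^-1 ^+ k) r e e0) => z /zr.
  exact: ccf_pw.
rewrite subrr /dK cintegralD //; [|exact: cintegrableZ..].
rewrite !cintegralZ //.
rewrite -/(circle_int (fun s => cpow m (- s) * (s - r)^-1 ^+ n.+1) r e).
rewrite -/(circle_int (fun s => cpow m (- s) * (s - r)^-1 ^+ n.+2) r e).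
move: (circle_int _ _ _) (circle_int _ _ _) => C1 C2 H.
have nz : n.+1%:R != 0 :> R[i] by rewrite pnatr_eq0.
apply: (mulfI nz); apply/eqP; rewrite -subr_eq0 -oppr_eq0 -H; apply/eqP; field.
by rewrite -mulrS.
Qed.

(** Iterating the recursion down to the simple pole accumulates the factors - ln m / j into (- ln
    m)^n / n!, the coefficients of the polynomial in log m. *)
Lemma circle_pw (m : R) r (e : R) n : 0 < e ->
  circle_int (fun s => cpow m (- s) * (s - r)^-1 ^+ n.+1) r e =
  rc ((- ln m) ^+ n / n`!%:R) * circle_int (fun s => cpow m (- s) / (s - r)) r e.
Proof.
move=> e0; elim: n => [|n IH]; first by rewrite expr0 fact0 divr1 rc1 mul1r.
rewrite circle_pw_rec // IH mulrA; congr (_ * _).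
rewrite -rcN -rc_nat -rcV -!rcM factS natrM exprS; congr rc; field.
by rewrite -mulrS !pnatr_eq0 -lt0n fact_gt0.
Qed.

End ResidueLimits.

Section PolarPart.
Variable R : realType.

(** I is split as [d0^-1] times the polar part multiplied by m^(-s), plus [d0^-1 * h] with [h]
    bounded near [r]. Circle integrals of the first reduce to the simple pole; those of the second
    are O(e). *)
Lemma Res_polar_part (d0 : R[i]) (m : R) (I : R[i] -> R[i]) (r : R[i]) (k : nat)
    (al : nat -> R[i]) (M d d' : R) : d0 != 0 -> 0 < d -> 0 < d' ->
  (forall s, 0 < cabs (s - r) < d' -> ccf I s) ->
  (forall s, 0 < cabs (s - r) < d ->
     cabs (d0 * I s * cpow m s - \sum_(1 <= j < k.+1) al j / (s - r) ^+ j) <= M) ->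
  Res I r = cpow m (- r) *
    (d0^-1 * \sum_(1 <= j < k.+1) al j * rc ((- ln m) ^+ j.-1 / (j.-1)`!%:R)).
Proof.
move=> d00 dgt d'gt cI bnd.
pose pw j s := cpow m (- s) * (s - r)^-1 ^+ j.
pose Q := d0^-1 * \sum_(1 <= j < k.+1) al j * rc ((- ln m) ^+ j.-1 / (j.-1)`!%:R).
rewrite -/Q; pose h s := cpow m (- s) * (d0 * I s * cpow m s - \sum_(1 <= j < k.+1) al j / (s - r) ^+ j).
have IE s : I s = d0^-1 * (\sum_(1 <= j < k.+1) al j * pw j s) + d0^-1 * h s.
  have E : \sum_(1 <= j < k.+1) al j * pw j s =
      cpow m (- s) * \sum_(1 <= j < k.+1) al j / (s - r) ^+ j.
    by rewrite big_distrr /=; apply: eq_bigr => j _; rewrite /pw exprVn; ring.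
  rewrite E /h -mulrDr -mulrDr addrC subrK cpowN.
  by field; rewrite d00 cpow_neq0.
have sr s e : 0 < e -> cabs (s - r) = e -> s != r.
  by move=> e0 E; rewrite -subr_eq0 -cabs_gt0 E.
have cpw j s e : 0 < e -> cabs (s - r) = e -> ccf (pw j) s.
  by move=> e0 /(sr _ _ e0); exact: ccf_pw.
have csum n s e : 0 < e -> cabs (s - r) = e -> ccf (fun s => \sum_(1 <= j < n) al j * pw j s) s.
  move=> e0 E; elim: n => [|n IH].
    by under eq_fun do rewrite big_geq //; exact: ccf_cst.
  case: n IH => [|n] IH.
    by under eq_fun do rewrite big_geq //; exact: ccf_cst.
  under eq_fun do rewrite big_nat_recr //=.
  by apply: ccfD => //; apply: ccfM; [exact: ccf_cst|exact: (cpw _ _ e)].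
have circ_sum n e : 0 < e ->
    circle_int (fun s => \sum_(1 <= j < n.+1) al j * pw j s) r e =
    (\sum_(1 <= j < n.+1) al j * rc ((- ln m) ^+ j.-1 / (j.-1)`!%:R)) *
      circle_int (fun s => cpow m (- s) / (s - r)) r e.
  move=> e0; elim: n => [|n IH].
    rewrite [in RHS]big_geq // mul0r (eq_circle (g := fun s => 0 * pw 1%N s)) //.
      by rewrite circleZ // ?mul0r // => s E; exact: (cpw _ _ e).
    by move=> s _; rewrite big_geq // mul0r.
  rewrite [in RHS]big_nat_recr //= mulrDl -IH -mulrA -circle_pw // -circleZ //; last first.
    by move=> s E; exact: (cpw _ _ e).
  rewrite -circleD //.
  - by apply: eq_circle => // s E; rewrite big_nat_recr.
  - by move=> s E; exact: (csum _ _ e).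
  - by move=> s E; apply: ccfM; [exact: ccf_cst|exact: (cpw _ _ e)].
pose dd := Num.min d d'.
have dd0 : 0 < dd by rewrite lt_min dgt.
have ch s e : 0 < e < dd -> cabs (s - r) = e -> ccf h s.
  rewrite lt_min => /andP[e0 /andP[ed ed']] E.
  have -> : h = fun s => d0 * I s + (-1) * \sum_(1 <= j < k.+1) al j * pw j s.
    apply/funext => t; rewrite (IE t); set X := \sum_(1 <= j < _) _; field.
    exact: d00.
  have cIs : ccf I s by apply: cI; rewrite E e0.
  exact: (ccfD (ccfM (ccf_cst d0 s) cIs) (ccfM (ccf_cst (-1) s) (csum _ _ e e0 E))).
have circI e : 0 < e < dd -> circle_int I r e =
    Q * circle_int (fun s => cpow m (- s) / (s - r)) r e + d0^-1 * circle_int h r e.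
  move=> /[dup] e0d /andP[e0 ed].
  rewrite (eq_circle (g := fun s => d0^-1 * (\sum_(1 <= j < k.+1) al j * pw j s) + d0^-1 * h s)) //.
  rewrite circleD //; last 2 first.
  - by move=> s E; apply: ccfM; [exact: ccf_cst|exact: (csum _ _ e)].
  - by move=> s E; apply: ccfM; [exact: ccf_cst|exact: (ch _ e)].
  rewrite !circleZ //; last 2 first.
  - by move=> s E; exact: (ch _ e).
  - by move=> s E; exact: (csum _ _ e).
  by rewrite circ_sum // mulrA.
clearbody Q.
have L1 := @circle_simple R (fun s => cpow m (- s) / (s - r)) r (cpow m (- r)).
have {}L1 : forall eta : R, 0 < eta -> exists2 d : R, 0 < d & forall e, 0 < e < d ->
     cabs (circle_int (fun s => cpow m (- s) / (s - r)) r e - rc (2 * pi) * ci * cpow m (- r)) <= eta.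
  apply: L1.
    exists 1 => // z /andP[z0 _]; apply: ccfM; first exact/holo_ccf/holo_cpow.
    by apply: ccf_inv; rewrite -subr_eq0 -cabs_gt0.
  move=> eta /(holo_ccf (holo_cpow m r))[t t0 Ht]; exists t => // z /andP[z0 zt].
  have zr : z - r != 0 by rewrite -cabs_gt0.
  by rewrite mulrC divfK //; exact: Ht.
have [t t0 Ht] := holo_ccf (holo_cpow m r) ltr01.
pose N := 1 + cabs (cpow m (- r)).
have N0 : 0 < N by rewrite /N ltr_pwDl // cabs_ge0.
(* A bound that is visibly positive, whatever [M] is. *)
pose M' := `|M| + 1.
have M'0 : 0 < M' by rewrite /M' ltr_wpDl.
have tp : 0 < 2 * pi :> R by rewrite mulr_gt0 // pi_gt0.
have hb s : 0 < cabs (s - r) < Num.min dd t -> cabs (h s) <= N * M'.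
  rewrite !lt_min => /andP[s0 /andP[/andP[sd _] st]].
  rewrite cabsM ler_pM ?cabs_ge0 //.
    rewrite /N -lerBlDr (le_trans (cabs_sub _ _)) //; exact: Ht.
  rewrite (le_trans (bnd _ _)) ?s0 // (le_trans (ler_norm M)) // /M'; lra.
apply: Res_lim => eta eta0.
have q0 : 0 < cabs Q + 1 by rewrite ltr_wpDl // cabs_ge0.
have [d1 d10 Hd1] := L1 _ (divr_gt0 (divr_gt0 eta0 q0) (ltr0n R 2)).
(* C * e bounds the contribution of the remainder: at most N * M' on a circle of length 2 pi e,
   divided by [d0]. *)
pose C := cabs d0^-1 * (N * M') * (2 * pi).
have dV0 : 0 < cabs d0^-1 by rewrite cabs_gt0 invr_neq0.
have C0 : 0 < C by rewrite /C !mulr_gt0 // pi_gt0.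
exists (Num.min (Num.min dd t) (Num.min d1 (eta / C / 2))).
  by rewrite !lt_min dgt d'gt t0 d10 !divr_gt0.
move=> e; rewrite lt_min => /andP[e0 /andP[edt]]; rewrite lt_min => /andP[ed1 eC].
have edd : e < dd by move: edt; rewrite lt_min => /andP[].
rewrite circI ?e0 //.
set C1 := circle_int _ _ _ in Hd1 *; set C2 := circle_int h r e.
have -> : Q * C1 + d0^-1 * C2 - rc (2 * pi) * ci * (cpow m (- r) * Q) =
  Q * (C1 - rc (2 * pi) * ci * cpow m (- r)) + d0^-1 * C2 by ring.
rewrite (le_trans (cabsD _ _)) // [leRHS](splitr eta) (cabsM Q) (cabsM d0^-1) lerD //.
  have H1 := Hd1 e; rewrite e0 ed1 in H1.
  apply: (le_trans (ler_wpM2l (cabs_ge0 Q) (H1 isT))).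
  rewrite mulrA ler_wpM2r // mulrA mulrAC ler_piMl ?(ltW eta0) // ler_pdivrMr //.
  by rewrite mul1r lerDl.
have H2 : cabs C2 <= (N * M') * e * (2 * pi).
  apply: circle_bound => // z E; first by apply: (ch _ e) => //; rewrite e0.
  by apply: hb; rewrite E e0.
apply: (le_trans (ler_wpM2l (cabs_ge0 _) H2)).
have -> : cabs d0^-1 * (N * M' * e * (2 * pi)) = C * e by rewrite /C; ring.
have -> : eta / 2 = C * (eta / C / 2) by field; rewrite gt_eqF.
by rewrite ler_wpM2l // ltW.
Qed.
End PolarPart.

(** * Dominated convergence for complex-valued functions *)

Section Dominated.
Variable R : realType.
Notation mu := (@lebesgue_measure R).
Implicit Types (g h : R -> R[i]) (D A : set (measurableTypeR R)).

Lemma Rdominated0 D (k : R -> R) (h_ : nat -> R -> R) : measurable D ->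
  (forall n, measurable_fun D (h_ n)) -> mu.-integrable D (EFin \o k) ->
  (forall n x, D x -> 0 <= h_ n x <= k x) ->
  (forall x, D x -> forall e, 0 < e -> exists N, forall n, (N <= n)%N -> h_ n x <= e) ->
  forall e, 0 < e -> exists N, forall n, (N <= n)%N -> Rintegral mu D (h_ n) <= e.
Proof.
move=> mD mh ik hk cvh.
have mh' n : measurable_fun D (EFin \o h_ n) by exact/measurable_EFinP.
have m0 : measurable_fun D (fun=> 0%E : \bar R) by exact: measurable_cst.
have cvg0 : {ae mu, forall x, D x -> (fun n => (EFin \o h_ n) x) @ \oo --> (0%E : \bar R)}.
  apply/aeW => x Dx; apply/fine_cvgP; split; first by near=> n.
  apply/cvgrPdist_le => e e0; have [N HN] := cvh x Dx e e0.
  exists N => // n /= /HN; have /andP[h0 _] := hk n x Dx.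
  by rewrite sub0r normrN ger0_norm.
have dom : {ae mu, forall x n, D x -> (`|(EFin \o h_ n) x| <= (EFin \o k) x)%E}.
  apply/aeW => x n Dx /=; rewrite lee_fin; have /andP[h0 hkx] := hk n x Dx.
  by rewrite ger0_norm.
have [_ _ C] := dominated_convergence mD mh' m0 cvg0 ik dom.
have {}C : (fun n => \int[mu]_(x in D) (h_ n x)%:E)%E @ \oo --> (0%E : \bar R).
  by move: C; rewrite integral0.
move=> e e0; have /fine_cvgP[_ /cvgrPdist_le /(_ e e0)[N _ HN]] := C.
exists N => n /HN; rewrite sub0r normrN; apply: le_trans; exact: ler_norm.
Unshelve. all: by end_near. Qed.

Lemma cmeasurableB D g h : cmeasurable D g -> cmeasurable D h -> cmeasurable D (fun x => g x - h x).
Proof.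
move=> [a b] [c d]; split.
  rewrite (_ : _ \o _ = (fun x => (@cre R \o g) x - (@cre R \o h) x)); last first.
    by apply/funext => t; rewrite /= creD creN.
  exact: measurable_funB.
rewrite (_ : _ \o _ = (fun x => (@cim R \o g) x - (@cim R \o h) x)); last first.
  by apply/funext => t; rewrite /= cimD cimN.
exact: measurable_funB.
Qed.

(** The functions |g_n - g| are real, nonnegative, dominated by 2 k and tend to 0, which is the case
    treated in [Rdominated0]. *)
Lemma cdominated D (k : R -> R) (g_ : nat -> R -> R[i]) g : measurable D ->
  (forall n, cmeasurable D (g_ n)) -> cmeasurable D g -> mu.-integrable D (EFin \o k) ->
  (forall n x, D x -> cabs (g_ n x) <= k x) -> (forall x, D x -> cabs (g x) <= k x) ->
  (forall x, D x -> forall e, 0 < e -> exists N, forall n, (N <= n)%N -> cabs (g_ n x - g x) <= e) ->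
  forall e, 0 < e -> exists N, forall n, (N <= n)%N -> cabs (cintegral D (g_ n) - cintegral D g) <= e.
Proof.
move=> mD mg_ mg ik gk_ gk cv e e0.
have i1 n : cintegrable D (g_ n) by apply: (cintegrable_dom (k := k)) => // x; exact: gk_.
have i2 : cintegrable D g by apply: (cintegrable_dom (k := k)).
have ik2 : mu.-integrable D (EFin \o (fun x => 2 * k x)).
  by rewrite (_ : _ \o _ = (fun x => 2%:E * (EFin \o k) x)%E) //; exact: integrableZl.
have [||N HN] := @Rdominated0 D _ (fun n x => cabs (g_ n x - g x)) mD _ ik2 _ cv e e0.
- by move=> n; exact: (measurable_cabs (cmeasurableB (mg_ n) mg)).
- move=> n x Dx; rewrite cabs_ge0 (le_trans (cabsB _ _)) // mulr2n mulrDl mul1r.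
  by rewrite lerD ?gk_ ?gk.
exists N => n /HN; apply: le_trans; rewrite -cintegralB //.
apply: cabs_cintegral_le => //; apply: cintegrableD => //; exact: cintegrableN.
Qed.

(** Extension by zero turns integrals over varying sets into integrals of varying functions over a
    fixed set. *)
Definition cpatch A g := fun x => if x \in A then g x else 0.

Lemma cre_cpatch A g : @cre R \o cpatch A g = (@cre R \o g) \_ A.
Proof. by apply/funext => x; rewrite /cpatch /patch /=; case: ifP. Qed.

Lemma cim_cpatch A g : @cim R \o cpatch A g = (@cim R \o g) \_ A.
Proof. by apply/funext => x; rewrite /cpatch /patch /=; case: ifP. Qed.

Lemma cintegral_cpatch D A g : cintegral D (cpatch A g) = cintegral (D `&` A) g.
Proof. by rewrite /cintegral cre_cpatch cim_cpatch -!Rintegral_mkcondr. Qed.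

Lemma cabs_cpatch A g x : cabs (cpatch A g x) <= cabs (g x).
Proof. by rewrite /cpatch; case: ifP => // _; rewrite cabs0 cabs_ge0. Qed.

Lemma cmeasurable_cpatch D A g : measurable D -> measurable A -> cmeasurable (D `&` A) g ->
  cmeasurable D (cpatch A g).
Proof.
move=> mD mA [a b]; rewrite /cmeasurable cre_cpatch cim_cpatch.
by split; apply/(measurable_restrict _ mA mD); rewrite // setIC.
Qed.

Lemma cmeasurableS D A g : measurable D -> A `<=` D -> cmeasurable D g -> cmeasurable A g.
Proof. by move=> mD AD [a b]; split; exact: measurable_funS mD AD _. Qed.

(** Dominated convergence for [g] cut off outside [A_ n], with |g| as majorant; each point lies
    eventually in all [A_ n]. *)
Lemma cintegral_exhaust D (A_ : nat -> set (measurableTypeR R)) g : measurable D ->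
  (forall n, measurable (A_ n)) -> (forall n, A_ n `<=` D) -> cintegrable D g ->
  (forall x, D x -> exists N, forall n, (N <= n)%N -> A_ n x) ->
  forall e, 0 < e -> exists N, forall n, (N <= n)%N -> cabs (cintegral (A_ n) g - cintegral D g) <= e.
Proof.
move=> mD mA AD ig ex e e0.
have mg := cintegrable_measurable ig.
have [||||N HN] := @cdominated D (@cabs R \o g) (fun n => cpatch (A_ n) g) g mD _ mg (integrable_cabs mD ig) _ _ _ e e0.
- move=> n; apply: cmeasurable_cpatch => //; apply: cmeasurableS mg => //; exact: subIsetl.
- by move=> n x _; exact: cabs_cpatch.
- by [].
- move=> x Dx e' e'0; have [N HN] := ex x Dx; exists N => n /HN Ax.
  by rewrite /cpatch mem_set // subrr cabs0 ltW.
exists N => n /HN; rewrite cintegral_cpatch setIidr //; exact: AD.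
Qed.

End Dominated.

(** * Measurability of complex-valued maps on an arbitrary measurable space *)

Section CMeasurable.
Context {R : realType} {d : measure_display} {T : measurableType d}.
Implicit Types (D : set T) (g h : T -> R[i]).

(** The notion of [cmeasurable] over a general domain; Fubini needs it on the product of two
    lines. *)
Definition cmeas D g := measurable_fun D (@cre R \o g) /\ measurable_fun D (@cim R \o g).

Lemma cmeas_cst D z : cmeas D (fun=> z).
Proof. by split; exact: measurable_cst. Qed.

Lemma cmeasD D g h : cmeas D g -> cmeas D h -> cmeas D (fun x => g x + h x).
Proof.
move=> [a b] [c e]; split.
  rewrite (_ : _ \o _ = (fun x => (@cre R \o g) x + (@cre R \o h) x)); last first.
    by apply/funext => t; rewrite /= creD.
  exact: measurable_funD.
rewrite (_ : _ \o _ = (fun x => (@cim R \o g) x + (@cim R \o h) x)); last first.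
  by apply/funext => t; rewrite /= cimD.
exact: measurable_funD.
Qed.

Lemma cmeasM D g h : cmeas D g -> cmeas D h -> cmeas D (fun x => g x * h x).
Proof.
move=> [a b] [c e]; split.
  rewrite (_ : _ \o _ = (fun x => (@cre R \o g) x * (@cre R \o h) x - (@cim R \o g) x * (@cim R \o h) x)); last first.
    by apply/funext => t; rewrite /= creM.
  by apply: measurable_funB; exact: measurable_funM.
rewrite (_ : _ \o _ = (fun x => (@cre R \o g) x * (@cim R \o h) x + (@cim R \o g) x * (@cre R \o h) x)); last first.
  by apply/funext => t; rewrite /= cimM.
by apply: measurable_funD; exact: measurable_funM.
Qed.

Lemma cmeas_rc D (k : T -> R) : measurable_fun D k -> cmeas D (fun x => rc (k x)).
Proof. by move=> mk; split => //; exact: measurable_cst. Qed.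

Lemma cmeas_cexp D g : cmeas D g -> cmeas D (fun x => cexp (g x)).
Proof.
move=> [a b].
have mc : measurable_fun setT (@cos R) by apply: continuous_measurable_fun; exact: continuous_cos.
have ms : measurable_fun setT (@sin R) by apply: continuous_measurable_fun; exact: continuous_sin.
have me : measurable_fun setT (@expR R) by exact: measurable_expR.
split.
  rewrite (_ : _ \o _ = (fun x => expR ((@cre R \o g) x) * cos ((@cim R \o g) x))) //.
  by apply: measurable_funM; exact: measurableT_comp.
rewrite (_ : _ \o _ = (fun x => expR ((@cre R \o g) x) * sin ((@cim R \o g) x))) //.
by apply: measurable_funM; exact: measurableT_comp.
Qed.

Lemma cmeas_cpow D (k : T -> R) g : measurable_fun D k -> cmeas D g ->
  cmeas D (fun x => cpow (k x) (g x)).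
Proof.
move=> mk mg; apply: cmeas_cexp; apply: cmeasM => //; apply: cmeas_rc.
apply: (@measurableT_comp _ _ _ _ _ _ (@ln R)) => //; exact: measurable_ln.
Qed.

End CMeasurable.

(** * Euler's integral for Gamma *)

Section Gamma.
Variable R : realType.
Notation mu := (@lebesgue_measure R).
Implicit Types (x t M : R) (z : R[i]).

Lemma cder_cpow t z : 0 < t -> cder (fun t => cpow t z) t (z * cpow t (z - 1)).
Proof.
move=> t0; have dl := is_derive1_ln t0.
apply: cder_eq (cder_exp (cderM (cder_cst z t) (cder_rc dl))) _.
rewrite mul0r add0r -/(cpow t z) cpowD cpowN cpow1 // rcV; ring.
Qed.

Lemma cpow_pred t z : 0 < t -> rc t * cpow t (z - 1) = cpow t z.
Proof.
move=> t0; rewrite cpowD cpowN cpow1 // mulrC divfK // rc_eq0 gt_eqF //.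
Qed.

Lemma cmeasurable_cpow (D : set R) z : cmeasurable D (fun t => cpow t z).
Proof. by apply: (@cmeas_cpow R _ _ D id (fun=> z)); [exact: measurable_id|exact: cmeas_cst]. Qed.

Lemma ccont_cpow t z : 0 < t -> ccont (fun t => cpow t z) t.
Proof. by move=> t0; exact: cder_cont (cder_cpow z t0). Qed.

Lemma cintegral_cpow_cc (e M : R) z : 0 < e -> e <= M -> z != 0 ->
  cintegral `[e, M] (fun t => cpow t (z - 1)) = (cpow M z - cpow e z) / z.
Proof.
move=> e0 eM z0; rewrite (@cintegral_FTC _ _ (fun t => z^-1 * cpow t z)) //.
- by rewrite mulrBl mulrC [in X in _ - X]mulrC.
- move=> t /andP[et _]; apply: cder_eq (cderZ _ (cder_cpow z (lt_le_trans e0 et))) _.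
  by rewrite mulKf.
- by move=> t /andP[et _]; apply: ccont_cpow; exact: lt_le_trans et.
Qed.

Lemma Rintegral_powR_cc (e M x : R) : 0 < e -> e <= M -> 0 < x ->
  Rintegral mu `[e, M] (fun t => powR t (x - 1)) = (powR M x - powR e x) / x.
Proof.
move=> e0 eM x0; transitivity (x^-1 * powR M x - x^-1 * powR e x); last first.
  by rewrite mulrBl mulrC [in X in _ - X]mulrC.
apply: (@Rintegral_FTC R (fun t => x^-1 * powR t x)) => //.
- move=> t /andP[et _]; have t0 := lt_le_trans e0 et.
  have dp := is_derive1_powR x t0.
  by apply: is_derive_eq; rewrite /GRing.scale /= mulKf // gt_eqF.
- move=> t /andP[et _]; have t0 := lt_le_trans e0 et.
  have [dp _] := is_derive1_powR (x - 1) t0.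
  by apply/differentiable_continuous/derivable1_diffP.
Qed.

Lemma powR_continuous x t : 0 < t -> {for t, continuous (fun t => powR t x)}.
Proof.
move=> t0; have [dp _] := is_derive1_powR x t0.
by apply/differentiable_continuous/derivable1_diffP.
Qed.

Lemma bigcup_cutoff M : 0 < M ->
  \bigcup_n [set` `[M / n.+1%:R, M]%R] = [set` `]0, M]%R] :> set R.
Proof.
move=> M0; apply/seteqP; split => x.
  move=> [n _]; rewrite /= !in_itv /= => /andP[a ->]; rewrite andbT (lt_le_trans _ a) //.
  by rewrite divr_gt0.
rewrite /= in_itv /= => /andP[x0 xM]; exists (Num.truncn (M / x)) => //=.
by rewrite in_itv /= xM andbT ler_pdivrMr // mulrC -ler_pdivrMr // ltW // truncnS_gt.
Qed.

(** Monotone convergence over [M / (n + 1), M], where the primitive t^x / x keeps the integrals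
    below M^x / x. *)
Lemma powR_integrable M x : 0 < M -> 0 < x ->
  mu.-integrable `]0, M] (EFin \o (fun t => powR t (x - 1))).
Proof.
move=> M0 x0; apply/integrableP; split.
  by apply/measurable_EFinP; apply: measurable_funTS; exact: measurable_powR.
have -> : (\int[mu]_(t in `]0%R, M]) `|(EFin \o (fun t => powR t (x - 1))) t|)%E =
   (\int[mu]_(t in `]0%R, M]) (powR t (x - 1))%:E)%E.
  by apply: eq_integral => t _ /=; rewrite ger0_norm // powR_ge0.
apply: (@le_lt_trans _ _ (powR M x / x)%:E); last exact: ltry.
rewrite -bigcup_cutoff //.
have H := @ge0_nondecreasing_set_cvg_integral _ (measurableTypeR R) R
  (fun n => [set` `[M / n.+1%:R, M]%R]) (fun t => (powR t (x - 1))%:E) mu.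
apply: (cvge_le _ (H _ _ _ _)); last 4 first.
- move=> m n mn; rewrite subsetEset => t /=; rewrite !in_itv /= => /andP[a ->].
  by rewrite andbT (le_trans _ a) // ler_pM2l // lef_pV2 ?posrE // ler_nat ltnS.
- by move=> n; exact: measurable_itv.
- by move=> n; apply/measurable_EFinP; apply: measurable_funTS; exact: measurable_powR.
- by move=> n t _; rewrite lee_fin powR_ge0.
apply: nearW => n.
have e0 : 0 < M / n.+1%:R by rewrite divr_gt0.
have eM : M / n.+1%:R <= M by rewrite ler_pdivrMr // ler_peMr ?(ltW M0) // ler1n.
rewrite -(@fineK _ (\int[mu]_(t in _) _)%E); last first.
  apply: integrable_fin_num => //; apply: (@continuous_integrable _ (fun t => powR t (x - 1))).
  by move=> t /andP[et _]; apply: powR_continuous; exact: lt_le_trans et.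
rewrite lee_fin -/(Rintegral mu _ (fun t => powR t (x - 1))) Rintegral_powR_cc //.
by rewrite ler_pM2r ?invr_gt0 // gerBl powR_ge0.
Qed.

End Gamma.

Section GaussEuler.
Variable R : realType.
Notation mu := (@lebesgue_measure R).
Implicit Types (x t M : R) (z : R[i]).

Lemma cpow_integrable M z : 0 < M -> 0 < cre z ->
  cintegrable `]0, M] (fun t => cpow t (z - 1)).
Proof.
move=> M0 z0; apply: (cintegrable_dom (k := fun t => powR t (cre z - 1))) => //.
- exact: cmeasurable_cpow.
- exact: powR_integrable.
- move=> t; rewrite /= in_itv /= => /andP[t0 _].
  by rewrite cabs_cpow // !cE.
Qed.

Lemma powR_cutoff M x (e : R) : 0 < M -> 0 < x -> 0 < e ->
  exists N, forall n, (N <= n)%N -> powR (M / n.+1%:R) x <= e.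
Proof.
move=> M0 x0 e0; pose r := powR e x^-1; have r0 : 0 < r by rewrite powR_gt0.
exists (Num.truncn (M / r)) => n Nn.
have -> : e = powR r x by rewrite -powRrM mulVf ?gt_eqF // powRr1 // ltW.
have nn : 0 < n.+1%:R :> R by [].
have Mn0 : 0 < M / n.+1%:R by rewrite divr_gt0.
apply: ge0_ler_powR; rewrite ?nnegrE ?ltW //.
rewrite ltr_pdivrMr // mulrC -ltr_pdivrMr // (lt_le_trans (truncnS_gt _)) //.
by rewrite ler_nat ltnS.
Qed.

(** The primitive t^z / z is only used away from 0; the formula on [M / (n + 1), M] passes to the
    limit because |t^z| = t^(Re z) tends to 0 with t. *)
Lemma cintegral_cpow M z : 0 < M -> 0 < cre z ->
  cintegral `]0, M] (fun t => cpow t (z - 1)) = cpow M z / z.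
Proof.
move=> M0 z0; have zn0 : z != 0 by apply: contraTneq z0 => ->; rewrite cre0 ltxx.
have cz : 0 < cabs z by rewrite cabs_gt0.
apply/eqP; rewrite -subr_eq0 -cabs_eq0 eq_le cabs_ge0 andbT; apply/ler_addgt0Pl => e e0.
have e2 : 0 < e / 2 by rewrite divr_gt0.
have [||||N HN] := @cintegral_exhaust R `]0, M]%classic (fun n => [set` `[M / n.+1%:R, M]%R])
  _ _ _ _ (cpow_integrable M0 z0) _ (e / 2) e2 => //.
- move=> n x /=; rewrite !in_itv /= => /andP[a ->]; rewrite andbT (lt_le_trans _ a) //.
  by rewrite divr_gt0.
- move=> x; rewrite /= in_itv /= => /andP[x0 xM]; exists (Num.truncn (M / x)) => n Nn.
  rewrite /= in_itv /= xM andbT ler_pdivrMr // mulrC -ler_pdivrMr // ltW //.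
  by rewrite (lt_le_trans (truncnS_gt _)) // ler_nat ltnS.
have [N' HN'] := powR_cutoff M0 z0 (mulr_gt0 e2 cz).
pose n := maxn N N'.
have {HN} := HN n (leq_maxl _ _); have {HN'} := HN' n (leq_maxr _ _).
have e0' : 0 < M / n.+1%:R by rewrite divr_gt0.
have eM : M / n.+1%:R <= M by rewrite ler_pdivrMr // ler_peMr ?(ltW M0) // ler1n.
rewrite cintegral_cpow_cc // => H1 H2; rewrite addr0.
set J := cintegral _ _ in H2 *.
rewrite (_ : J - _ = - ((cpow M z - cpow (M / n.+1%:R) z) / z - J) - cpow (M / n.+1%:R) z / z); last first.
  by field; rewrite zn0.
rewrite (le_trans (cabsB _ _)) // cabsN [leRHS](splitr e) lerD //.
by rewrite cabsM cabsV ler_pdivrMr // cabs_cpow.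
Qed.

Lemma gauss_integrable n M z : 0 < M -> 0 < cre z ->
  cintegrable `]0, M] (fun t => rc ((1 - t / M) ^+ n) * cpow t (z - 1)).
Proof.
move=> M0 z0; apply: (cintegrable_dom (k := fun t => powR t (cre z - 1))) => //.
- apply: (@cmeasM R _ R); last exact: cmeasurable_cpow.
  apply: cmeas_rc; apply: measurable_funX; apply: measurable_funB => //.
  by apply: measurable_funM => //; exact: measurable_cst.
- exact: powR_integrable.
- move=> t; rewrite /= in_itv /= => /andP[t0 tM].
  rewrite cabsM cabs_cpow // !cE cabs_rc ler_piMl ?powR_ge0 // normrX.
  have h0 : 0 <= 1 - t / M by rewrite subr_ge0 ler_pdivrMr // mul1r.
  rewrite ger0_norm // exprn_ile1 // gerBl divr_ge0 // ltW //.
Qed.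

(* Induction on [n], with (1 - t/M)^(n+1) t^(z-1) = (1 - t/M)^n (t^(z-1) - t^z / M). *)
Lemma gauss_integral n M z : 0 < M -> 0 < cre z ->
  cintegral `]0, M] (fun t => rc ((1 - t / M) ^+ n) * cpow t (z - 1)) =
  cpow M z * rc (n`!)%:R / \prod_(k < n.+1) (z + rc k%:R).
Proof.
move=> M0; have M0' : rc M != 0 :> R[i] by rewrite rc_eq0 gt_eqF.
elim: n z => [|n IH] z z0.
  transitivity (cintegral `]0, M] (fun t => cpow t (z - 1))).
    by apply: eq_cintegral => t _; rewrite expr0 rc1 mul1r.
  by rewrite cintegral_cpow // big_ord_recr big_ord0 /= mul1r rc0 addr0 rc1 mulr1.
have z1 : 0 < cre (z + 1) by rewrite !cE addr_gt0.
transitivity (cintegral `]0, M] (fun t => rc ((1 - t / M) ^+ n) * cpow t (z - 1)) -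
  (rc M)^-1 * cintegral `]0, M] (fun t => rc ((1 - t / M) ^+ n) * cpow t (z + 1 - 1))).
  rewrite -cintegralZ //; last exact: gauss_integrable.
  rewrite -cintegralB //; first last.
  - by apply: cintegrableZ => //; exact: gauss_integrable.
  - exact: gauss_integrable.
  apply: eq_cintegral => t; rewrite /= in_itv /= => /andP[t0 _].
  by rewrite addrK -(cpow_pred z t0) exprS rcM rcB rc1 rcM rcV; ring.
rewrite !IH // cpowD cpow1 // factS natrM rcM.
have nz k : z + rc k%:R != 0.
  apply/eqP => /(congr1 (@cre R)); rewrite !cE => E.
  by have := ltr_wpDr (ler0n R k) z0; rewrite E ltxx.
have E1 : \prod_(k < n.+1) (z + 1 + rc k%:R) = \prod_(k < n.+1) (z + rc k.+1%:R).
  by apply: eq_bigr => k _; rewrite -addrA -rc1 -rcD -natr1 [1 + _]addrC.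
have E2 : z * \prod_(k < n.+1) (z + rc k.+1%:R) = (\prod_(k < n.+1) (z + rc k%:R)) * (z + rc n.+1%:R).
  transitivity (\prod_(k < n.+2) (z + rc k%:R)); last by rewrite big_ord_recr.
  by rewrite [RHS]big_ord_recl; congr (_ * _); rewrite addr0.
have P1 : \prod_(k < n.+1) (z + rc k%:R) != 0 by apply/prodf_neq0 => k _; exact: nz.
have P2 : \prod_(k < n.+1) (z + rc k.+1%:R) != 0 by apply/prodf_neq0 => k _; exact: nz.
have zn0 : z != 0 by have := nz 0%N; rewrite rc0 addr0.
rewrite E1 (big_ord_recr n.+1) /=.
set A := \prod_(k < n.+1) (z + rc k%:R) in P1 E2 *.
set B := \prod_(k < n.+1) (z + rc k.+1%:R) in P2 E2 *.
have -> : B = A * (z + rc n.+1%:R) / z by rewrite -E2 mulrC mulKf.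
have nn := nz n.+1; rewrite -natr1 rcD rc1 in nn *.
by field; rewrite M0' zn0 P1 nn.
Qed.

(** Cut at t = 1: before it the exponential is at most 1 and the power is integrable, after it the
    power is at most 1, because a <= 1, and the exponential is integrable. *)
Lemma expR_powR_integrable x a : 0 < x -> 0 < a -> a <= 1 ->
  mu.-integrable `]0, +oo[ (EFin \o (fun t => expR (- (x * t)) * powR t (a - 1))).
Proof.
move=> x0 a0 a1.
pose k t := expR (- (x * t)) * powR t (a - 1).
have cE : continuous (fun t => expR (- (x * t))).
  move=> t; apply: (continuous_comp (f := fun t => - (x * t))); last exact: continuous_expR.
  apply: (continuous_comp (f := fun t => x * t)); first exact: mulrl_continuous.
  exact: oppr_continuous.
have mE0 : measurable_fun setT (fun t => expR (- (x * t))) by exact: continuous_measurable_fun.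
have mk : measurable_fun setT k.
  by apply: measurable_funM => //; exact: measurable_powR.
have mE D : measurable_fun D (EFin \o k) by apply/measurable_EFinP; exact: measurable_funTS.
have k0 t : 0 <= k t by rewrite mulr_ge0 ?expR_ge0 ?powR_ge0.
have i1 : mu.-integrable `]0, 1] (EFin \o k).
  apply: (le_integrable _ _ _ (powR_integrable ltr01 a0)) => //; first exact: mE.
  move=> t /=; rewrite in_itv /= => /andP[t0 t1]; rewrite lee_fin !ger0_norm ?powR_ge0 //.
  by rewrite ler_piMl ?powR_ge0 // expR_le1 oppr_le0 mulr_ge0 // ltW.
have iE : mu.-integrable `[1, +oo[ (EFin \o (fun t => expR (- (x * t)))).
  apply/integrableP; split.
    by apply/measurable_EFinP; exact: measurable_funTS.
  under eq_integral do rewrite /= ger0_norm ?expR_ge0 //.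
  pose F t := - x^-1 * expR (- (x * t)).
  have dF t : is_derive t 1 F (expR (- (x * t))).
    apply: is_derive_eq; rewrite /GRing.scale /= ?mulr1 ?mulr0 ?addr0; field.
    by rewrite gt_eqF.
  rewrite (@ge0_continuous_FTC2y _ _ F 1 0).
  - by rewrite -EFinB ltry.
  - by move=> t _; exact: expR_ge0.
  - exact: continuous_subspaceT.
  - rewrite -[X in _ --> X](mulr0 (- x^-1)); apply: cvgMr.
    apply: (@cvg_comp _ _ _ (fun t => x * t) (fun t => expR (- t)) _ +oo); last exact: cvgr_expR.
    by apply: gt0_cvgMry.
  - by move=> t _; have [] := dF t.
  - by apply: cvg_at_right_filter; apply/differentiable_continuous/derivable1_diffP; have [] := dF 1.
  - by move=> t _; rewrite derive1E; exact: derive_val.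
have i2 : mu.-integrable `[1, +oo[ (EFin \o k).
  apply: (le_integrable _ _ _ iE) => //; first exact: mE.
  move=> t /=; rewrite in_itv /= => /andP[t1 _]; rewrite lee_fin !ger0_norm ?expR_ge0 //.
  have a10 : a - 1 <= 0 by rewrite subr_le0.
  by have := ler_powR t1 a10; rewrite powRr0 => P; rewrite ler_piMr ?expR_ge0.
have i1' : mu.-integrable `]0, +oo[ (EFin \o (k \_ `]0, 1]%classic)).
  by rewrite -restrict_EFin; apply/integrable_restrict => //; rewrite setIidr // => t /=; rewrite !in_itv /= => /andP[->].
have i2' : mu.-integrable `]0, +oo[ (EFin \o (k \_ `[1, +oo[%classic)).
  rewrite -restrict_EFin; apply/integrable_restrict => //; rewrite setIidr // => t /=.
  by rewrite !in_itv /= !andbT; exact: lt_le_trans.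
have mI : measurable ([set` `]0, +oo[%R] : set (measurableTypeR R)) by exact: measurable_itv.
apply: (le_integrable mI _ _ (integrableD mI i1' i2')); first exact: mE.
move=> t /=.
rewrite in_itv /= andbT => t0; rewrite lee_fin -/(k t) ger0_norm //.
have p1 D : 0 <= (k \_ D) t by rewrite /patch; case: ifP.
rewrite ger0_norm ?addr_ge0 //; have [t1|t1] := leP t 1.
  suff -> : k t = (k \_ `]0, 1]%classic) t by rewrite lerDl.
  by rewrite /patch mem_set //= in_itv /= t0.
suff -> : k t = (k \_ `[1, +oo[%classic) t by rewrite lerDr.
by rewrite /patch mem_set //= in_itv /= ltW.
Qed.

End GaussEuler.

Section GammaIntegral.
Variable R : realType.
Notation mu := (@lebesgue_measure R).
Implicit Types (x t y M : R) (z : R[i]).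

Lemma limn_eps (u : nat -> R[i]) (l : R[i]) :
  (forall e : R, 0 < e -> exists N, forall n, (N <= n)%N -> cabs (u n - l) <= e) -> limn u = l.
Proof.
move=> H; apply: cvg_lim; first exact: norm_hausdorff.
apply/cvgrPdist_le => e e0.
have eE : e = rc (cre e) by apply: eqC; rewrite ?cE //; move: e0; rewrite ltcE => /andP[/eqP].
have e0' : 0 < cre e by rewrite -lt_rc -eE.
have [N HN] := H _ e0'; exists N => // n /= /HN.
by rewrite eE cabsE le_rc cabsBC.
Qed.

Lemma bernoulli_ineq (a : R) n : -1 <= a -> 1 + n%:R * a <= (1 + a) ^+ n.
Proof.
move=> a1; have a0 : 0 <= 1 + a by lra.
elim: n => [|n IH]; first by rewrite expr0 mul0r addr0.
rewrite exprS; apply: (le_trans _ (ler_wpM2l a0 IH)).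
rewrite -natr1 mulrDl mul1r; have := mulr_ge0 (ler0n R n) (sqr_ge0 a); lra.
Qed.

Lemma expRn y n : (0 < n)%N -> expR (- (y / n%:R)) ^+ n = expR (- y).
Proof.
move=> n0; rewrite -expRM_natr mulNr divfK // pnatr_eq0 -lt0n //.
Qed.

Lemma euler_le y n : (0 < n)%N -> y <= n%:R -> (1 - y / n%:R) ^+ n <= expR (- y).
Proof.
move=> n0 yn; have nn : 0 < n%:R :> R by rewrite ltr0n.
rewrite -(expRn _ n0) lerXn2r ?nnegrE ?expR_ge0 //.
  by rewrite subr_ge0 ler_pdivrMr // mul1r.
exact: expR_ge1Dx.
Qed.

(** With w = y / n, the inequality 1 + w <= exp w gives exp(-w) (1 - w^2) <= 1 - w. Raising this to
    the power n, Bernoulli's inequality turns (1 - w^2)^n into 1 - y^2 / n. *)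
Lemma euler_ge y n : (0 < n)%N -> 0 <= y -> y <= n%:R ->
  expR (- y) * (1 - y ^+ 2 / n%:R) <= (1 - y / n%:R) ^+ n.
Proof.
move=> n0 y0 yn; have nn : 0 < n%:R :> R by rewrite ltr0n.
pose w := y / n%:R; have w0 : 0 <= w by rewrite divr_ge0 // ltW.
have w1 : w <= 1 by rewrite ler_pdivrMr // mul1r.
have A : expR (- w) * (1 + - w ^+ 2) <= 1 - w.
  rewrite expRN mulrC ler_pdivrMr ?expR_gt0 //.
  have := ler_wpM2l (_ : 0 <= 1 - w) (expR_ge1Dx w); rewrite subr_ge0 => /(_ w1).
  by apply: le_trans; rewrite le_eqVlt; apply/orP; left; apply/eqP; ring.
have w2 : w ^+ 2 <= 1 by rewrite exprn_ile1.
have B : (expR (- w) * (1 + - w ^+ 2)) ^+ n <= (1 - w) ^+ n.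
  rewrite lerXn2r ?nnegrE ?subr_ge0 // mulr_ge0 ?expR_ge0 //; lra.
apply: le_trans B; rewrite exprMn expRn // ler_wpM2l ?expR_ge0 //.
have w21 : -1 <= - w ^+ 2 by lra.
apply: le_trans (bernoulli_ineq n w21); rewrite /w expr_div_n.
rewrite le_eqVlt; apply/orP; left; apply/eqP; field; rewrite gt_eqF //.
Qed.

Lemma euler_cvg y n : (0 < n)%N -> 0 <= y -> y <= n%:R ->
  `|(1 - y / n%:R) ^+ n - expR (- y)| <= y ^+ 2 / n%:R.
Proof.
move=> n0 y0 yn; rewrite ler0_norm ?subr_le0 ?euler_le // opprB.
have := euler_ge n0 y0 yn; rewrite mulrBr mulr1 => H.
have : expR (- y) * (y ^+ 2 / n%:R) <= y ^+ 2 / n%:R.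
  by rewrite ler_piMl ?divr_ge0 ?sqr_ge0 // expR_le1 oppr_le0.
lra.
Qed.

(** Gauss's product is x^z times the integral of (1 - x t / n)^n t^(z-1) over ]0, n / x]. The
    integrand is dominated by exp(-x t) t^(Re z - 1) and converges pointwise with the explicit rate
    of [euler_cvg]. The scale [x] is built into the upper limit n / x, so the factor x^z appears
    without a substitution in the improper integral. *)
Theorem cGamma_integral x z : 0 < x -> 0 < cre z -> cre z <= 1 ->
  cGamma z = cpow x z * cintegral `]0, +oo[ (fun t => rc (expR (- (x * t))) * cpow t (z - 1)).
Proof.
move=> x0 z0 z1; apply: limn_eps => e e0.
set J := cintegral _ _.
have mI : measurable ([set` `]0, +oo[%R] : set (measurableTypeR R)) by exact: measurable_itv.
pose A n : set (measurableTypeR R) := [set` `]0, (n%:R / x)]%R].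
pose g n t := rc ((1 - t / (n%:R / x)) ^+ n) * cpow t (z - 1).
have gE n t : t \in A n -> [/\ (0 < n)%N, 0 < t, x * t <= n%:R & g n t = rc ((1 - x * t / n%:R) ^+ n) * cpow t (z - 1)].
  move/set_mem; rewrite /A /= in_itv /= => /andP[t0 tn].
  have n0 : (0 < n)%N by case: n tn => // tn; move: (lt_le_trans t0 tn); rewrite mul0r ltxx.
  split => //; first by rewrite mulrC -ler_pdivlMr.
  rewrite /g; congr (rc ((1 - _) ^+ _) * _); field.
  by rewrite (gt_eqF x0) pnatr_eq0 -lt0n n0.
pose k t := expR (- (x * t)) * powR t (cre z - 1).
have mcp (D : set R) : cmeasurable D (fun t => cpow t (z - 1)) by exact: cmeasurable_cpow.
have absg t : 0 < t -> cabs (rc (expR (- (x * t))) * cpow t (z - 1)) = k t.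
  by move=> t0; rewrite cabsM cabs_rc ger0_norm ?expR_ge0 // cabs_cpow // !cE.
have [|||||||N HN] := @cdominated R `]0, +oo[%classic k (fun n => cpatch (A n) (g n))
  (fun t => rc (expR (- (x * t))) * cpow t (z - 1)) mI _ _ _ _ _ _ (e / (1 + cabs (cpow x z))).
- move=> n; apply: cmeasurable_cpatch => //; first exact: measurable_itv.
  apply: (@cmeasM R _ R); last exact: mcp.
  apply: cmeas_rc; apply: measurable_funX; apply: measurable_funB => //.
  by apply: measurable_funM => //; exact: measurable_cst.
- apply: (@cmeasM R _ R); last exact: mcp.
  apply: cmeas_rc; apply: measurable_funTS; apply: continuous_measurable_fun => t.
  apply: (continuous_comp (f := fun t => - (x * t))); last exact: continuous_expR.
  apply: (continuous_comp (f := fun t => x * t)); first exact: mulrl_continuous.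
  exact: oppr_continuous.
- exact: expR_powR_integrable.
- move=> n t; rewrite /= in_itv /= andbT => t0; rewrite /cpatch; case: ifP => [tA|_]; last first.
    by rewrite cabs0 mulr_ge0 ?expR_ge0 ?powR_ge0.
  have [n0 _ tn ->] := gE n t tA; rewrite cabsM cabs_cpow // !cE cabs_rc ler_wpM2r ?powR_ge0 //.
  rewrite ger0_norm ?euler_le // exprn_ge0 // subr_ge0 ler_pdivrMr ?mul1r ?ltr0n //.
- by move=> t; rewrite /= in_itv /= andbT => t0; rewrite absg.
- move=> t; rewrite /= in_itv /= andbT => t0 e' e'0.
  pose C := (x * t) ^+ 2 * powR t (cre z - 1).
  exists (Num.truncn (Num.max (x * t) (C / e'))).+1 => n Nn.
  have [n1 n2] : x * t < n%:R /\ C / e' < n%:R.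
    have : Num.max (x * t) (C / e') < n%:R.
      by rewrite (lt_le_trans (truncnS_gt _)) // ler_nat.
    by rewrite gt_max => /andP[].
  have n0 : (0 < n)%N by rewrite -(ltr0n R) (le_lt_trans _ n1) // mulr_ge0 // ltW.
  have tA : t \in A n by rewrite inE /A /= in_itv /= t0 /= ler_pdivlMr // mulrC ltW.
  rewrite /cpatch tA; have [_ _ tn ->] := gE n t tA.
  rewrite -mulrBl -rcB cabsM cabs_rc cabs_cpow // !cE.
  have y0 : 0 <= x * t by rewrite mulr_ge0 // ltW.
  rewrite (le_trans (ler_wpM2r (powR_ge0 _ _) (euler_cvg n0 y0 tn))) //.
  by rewrite mulrAC -/C ler_pdivrMr ?ltr0n // mulrC -ler_pdivrMr // ltW.
- by rewrite divr_gt0 // ltr_pwDl // cabs_ge0.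
(* Index 0 is excluded because the upper limit n / x must be positive. *)
exists (maxn 1 N) => n; rewrite geq_max => /andP[n1 nN].
have n0 : 0 < n%:R :> R by rewrite ltr0n.
have M0 : 0 < n%:R / x by rewrite divr_gt0.
have AI : `]0, +oo[%classic `&` A n = A n.
  by apply/setIidr => t; rewrite /A /= !in_itv /= andbT => /andP[].
have {HN} := HN n nN; rewrite cintegral_cpatch AI gauss_integral // -/J.
set P := \prod_(k < n.+1) _; move=> HN.
have -> : rc n`!%:R * cpow n%:R z / P - cpow x z * J =
  cpow x z * (cpow (n%:R / x) z * rc n`!%:R / P - J).
  rewrite mulrBr; congr (_ - _).
  rewrite cpowMl ?invr_gt0 // cpowV // cpowN; have := cpow_neq0 x z.
  by move: (cpow x z) (P^-1) => X Q X0; field.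
have h : 0 < 1 + cabs (cpow x z) by rewrite ltr_pwDl // cabs_ge0.
rewrite cabsM (le_trans (ler_wpM2l (cabs_ge0 _) HN)) // mulrA ler_pdivrMr // mulrC.
by rewrite ler_wpM2l ?(ltW e0) // lerDr.
Qed.

End GammaIntegral.

(** * The Mellin transform of 1/(1+t^2) *)

Section Sine.
Variable R : realType.
Notation mu := (@lebesgue_measure R).
Implicit Types (x y t : R) (z s u : R[i]).

Definition ch y : R := (expR y + expR (- y)) / 2.
Definition sh y : R := (expR y - expR (- y)) / 2.

Lemma ch2 y : ch y ^+ 2 = 1 + sh y ^+ 2.
Proof.
have E : expR y * expR (- y) = 1 by rewrite expRN mulfV // gt_eqF // expR_gt0.
have -> : ch y ^+ 2 = expR y * expR (- y) + sh y ^+ 2 by rewrite /ch /sh; field.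
by rewrite E.
Qed.

Lemma csinE z : csin z = (cexp (ci * z) - cexp (- (ci * z))) * (- ci / rc 2).
Proof.
have n2 : rc 2 != 0 :> R[i] by rewrite rc_eq0.
have nz : rc 2 * ci != 0 :> R[i] by rewrite mulf_neq0 ?ci_neq0.
rewrite /csin; congr (_ * _); apply: (mulfI nz); rewrite mulfV //.
have -> : rc 2 * ci * (- ci / rc 2) = - (ci * ci) :> R[i] by field.
by rewrite ci2 opprK.
Qed.

Lemma cre_csin z : cre (csin z) = sin (cre z) * ch (cim z).
Proof.
rewrite csinE -rcV !cE /ch !(mul0r, mul1r, mulr0, sub0r, subr0, add0r, addr0, opprK).
by rewrite cosN sinN oppr0; field.
Qed.

Lemma cim_csin z : cim (csin z) = cos (cre z) * sh (cim z).
Proof.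
rewrite csinE -rcV !cE /sh !(mul0r, mul1r, mulr0, sub0r, subr0, add0r, addr0, opprK).
by rewrite cosN sinN oppr0; field.
Qed.

(** From this identity come both the location of the zeros of [csin] and its growth in the imaginary
    direction. *)
Lemma cabs_csin2 z : cabs (csin z) ^+ 2 = sin (cre z) ^+ 2 + sh (cim z) ^+ 2.
Proof.
rewrite cabs_sqr cre_csin cim_csin; have := ch2 (cim z).
move: (ch _) (sh _) => p q E; rewrite !exprMn E.
have -> : sin (cre z) ^+ 2 * (1 + q ^+ 2) + cos (cre z) ^+ 2 * q ^+ 2 =
  sin (cre z) ^+ 2 + (cos (cre z) ^+ 2 + sin (cre z) ^+ 2) * q ^+ 2 by ring.
by rewrite cos2Dsin2 mul1r.
Qed.

Lemma csin_ge_sh z : `|sh (cim z)| <= cabs (csin z).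
Proof.
rewrite -(@ler_pXn2r _ 2) ?nnegrE ?cabs_ge0 // real_normK ?num_real //.
by rewrite cabs_csin2 lerDr sqr_ge0.
Qed.

Lemma csin_ge_ch z : `|sin (cre z)| * ch (cim z) <= cabs (csin z).
Proof.
have c0 : 0 <= ch (cim z) by rewrite /ch divr_ge0 // addr_ge0 // expR_ge0.
rewrite -[ch _]ger0_norm // -normrM -cre_csin; exact: cre_le.
Qed.

(** A linear bound is enough to make the horizontal sides vanish like 1 / T; likewise the quadratic
    bound of [ch_ge] is enough for comparison with 1 / (1 + y^2). *)
Lemma sh_ge y : `|y| / 2 <= `|sh y|.
Proof.
have P t : 0 <= t -> t / 2 <= sh t.
  move=> t0; rewrite ler_pM2r ?invr_gt0 //.
  have := expR_ge1Dx t; have : expR (- t) <= 1 by rewrite expR_le1 oppr_le0.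
  lra.
have [y0|/ltW y0] := leP 0 y.
  by rewrite (ger0_norm y0) (le_trans (P _ y0)) // ler_norm.
have y0' : 0 <= - y by rewrite oppr_ge0.
rewrite (ler0_norm y0) (le_trans (P _ y0')) // (_ : sh y = - sh (- y)); last first.
  by rewrite /sh opprK; field.
by rewrite normrN ler_norm.
Qed.

Lemma ch_ge y : (1 + y ^+ 2 / 4) / 2 <= ch y.
Proof.
have P t : 0 <= t -> 1 + t ^+ 2 / 4 <= expR t.
  move=> t0; rewrite [t in expR t]splitr expRD.
  have h : 1 + t / 2 <= expR (t / 2) by exact: expR_ge1Dx.
  have t2 : 0 <= t / 2 by rewrite divr_ge0.
  have h0 : 0 <= 1 + t / 2 by rewrite addr_ge0.
  apply: (le_trans _ (ler_pM h0 h0 h h)).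
  rewrite -subr_ge0 (_ : _ - _ = t); last by field.
  exact: t0.
rewrite ler_pM2r ?invr_gt0 //; have [y0|/ltW y0] := leP 0 y.
  by rewrite (le_trans (P _ y0)) // lerDl expR_ge0.
have y0' : 0 <= - y by rewrite oppr_ge0.
by have := P _ y0'; rewrite sqrrN => H; rewrite (le_trans H) // lerDr expR_ge0.
Qed.

Lemma csinDpi z : csin (z - rc pi) = - csin z.
Proof.
apply: eqC; rewrite [RHS]cE ?cre_csin ?cim_csin !cE oppr0 addr0.
  by rewrite -[in RHS](subrK pi (cre z)) sinDpi mulNr opprK.
by rewrite -[in RHS](subrK pi (cre z)) cosDpi mulNr opprK.
Qed.

Lemma csin_sub_id z : cabs (csin z - z) <= cabs z ^+ 2 * expR (cabs z).
Proof.
have n2 : rc 2 * ci != 0 :> R[i] by rewrite mulf_neq0 ?ci_neq0 // rc_eq0.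
have -> : csin z - z = ((cexp (ci * z) - 1 - ci * z) - (cexp (- (ci * z)) - 1 - - (ci * z))) / (rc 2 * ci).
  rewrite /csin (_ : rc 2 = 1 + 1); last by rewrite -rc1 -rcD.
  have n2' : (1 + 1 : R[i]) != 0 by rewrite -rc1 -rcD rc_eq0.
  by field; rewrite ci_neq0.
rewrite cabsM cabsV ler_pdivrMr ?cabs_gt0 //.
rewrite (le_trans (cabsB _ _)) //.
have A := cexp_sub1_id (ci * z); have B := cexp_sub1_id (- (ci * z)).
rewrite cabsN cabsM cabs_ci mul1r in A B *.
rewrite (cabsM (rc 2)) cabs_rc cabs_ci mulr1 ger0_norm //; lra.
Qed.

Lemma holo_csin z : holo (@csin R) z.
Proof.
have n2 : rc 2 * ci != 0 :> R[i] by rewrite mulf_neq0 ?ci_neq0 // rc_eq0.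
have h1 : holo (fun z => ci * z) z by apply: holoM; [exact: holo_cst|exact: holo_id].
have h2 : holo (fun z => - ci * z) z by apply: holoM; [exact: holo_cst|exact: holo_id].
apply: (@holo_eq _ (fun z => (cexp (ci * z) + (-1) * cexp (- ci * z)) * (rc 2 * ci)^-1) _ _ 1) => //.
  apply: holoM; last exact: holo_cst.
  apply: holoD; first exact: (holo_comp (holo_cexp _) h1).
  apply: holoM; first exact: holo_cst.
  exact: (holo_comp (holo_cexp _) h2).
by move=> w _; rewrite /csin mulN1r mulNr.
Qed.

Lemma integrable_oneDsqrV : mu.-integrable setT (EFin \o (fun t => (1 + t ^+ 2)^-1)).
Proof.
have c : continuous (fun t : R => (1 + t ^+ 2)^-1) by exact: continuous_oneDsqrV.
apply/integrableP; split.
  by apply/measurable_EFinP; exact: continuous_measurable_fun.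
under eq_integral do rewrite /= ger0_norm ?invr_ge0 ?addr_ge0 ?sqr_ge0 //.
rewrite ge0_symfun_integralT //.
- by rewrite -set_itvcy; have := integral0y_oneDsqr R; rewrite /oneDsqr => ->; rewrite -EFinM ltry.
- by move=> t; rewrite invr_ge0 addr_ge0 // sqr_ge0.
- by move=> t /=; rewrite sqrrN.
Qed.

End Sine.

Section InverseSine.
Variable R : realType.
Notation mu := (@lebesgue_measure R).
Implicit Types (x y t v T : R) (z s u : R[i]).

Definition sarg s : R[i] := rc pi * s / rc 2.
(** With v = 1 / t, this is the integrand t^s B(s) up to the constant - pi / 2. *)
Definition fsin v s : R[i] := cpow v (- s) / csin (sarg s).

Lemma cre_sarg s : cre (sarg s) = pi / 2 * cre s.
Proof. by rewrite /sarg -rcV !cE; ring. Qed.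

Lemma cim_sarg s : cim (sarg s) = pi / 2 * cim s.
Proof. by rewrite /sarg -rcV !cE; ring. Qed.

Lemma sarg_shift s : sarg (s - rc 2) = sarg s - rc pi.
Proof. by rewrite /sarg; field; rewrite rc_eq0. Qed.

Lemma holo_sarg s : holo sarg s.
Proof.
apply: (@holo_eq _ (fun s => (rc pi / rc 2) * s) _ _ 1) => //.
  by apply: holoM; [exact: holo_cst|exact: holo_id].
by move=> w _; rewrite /sarg; ring.
Qed.

Lemma holo_fsin v s : csin (sarg s) != 0 -> holo (fsin v) s.
Proof.
move=> nz; apply: holoM; first exact: holo_cpow.
apply: (@holo_comp _ (fun w => w^-1) (fun s => csin (sarg s))); first exact: holoV.
exact: (holo_comp (holo_csin _) (holo_sarg s)).
Qed.

(** The strip -3 < Re s < 0 contains [c - 2, c] for every c in ]-1, 0[. A zero has sinh of its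
    imaginary part equal to 0, hence is real, and a sign check of the real sine leaves only -2. *)
Lemma csin_sarg_neq0 s : -3 < cre s < 0 -> s != - rc 2 -> csin (sarg s) != 0.
Proof.
move=> /andP[s3 s0] s2; apply/eqP => E.
have := cabs_csin2 (sarg s); rewrite E cabs0 expr0n /= => /eqP.
rewrite eq_sym paddr_eq0 ?sqr_ge0 // !sqrf_eq0 cre_sarg cim_sarg => /andP[/eqP S /eqP H].
have p0 : 0 < pi / 2 :> R by rewrite divr_gt0 // pi_gt0.
have pp : pi = 2 * (pi / 2) :> R by field.
have im0 : cim s = 0.
  have := sh_ge (pi / 2 * cim s); rewrite H normr0 => L.
  have : `|pi / 2 * cim s| <= 0 by rewrite -(@ler_pM2r _ 2^-1) ?mul0r ?invr_gt0.
  by rewrite normr_le0 mulf_eq0 gt_eqF //= => /eqP.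
have re2 : cre s != - 2.
  apply: contraNneq s2 => r2; apply/eqP; apply: eqC; rewrite !cE ?oppr0 //.
(* Up to sign, a shift by pi left of -2 and a reflection right of it bring pi/2 Re s into ]0, pi[,
   where the sine is positive. *)
have [L|L|L] := ltgtP (cre s) (- 2); last by rewrite L eqxx in re2.
  have : 0 < sin (- (pi / 2 * cre s + pi)).
    apply: sin_gt0_pi; apply/andP; split.
      by rewrite {2}pp (_ : - _ = pi / 2 * (- 2 - cre s)); [rewrite mulr_gt0 // subr_gt0|ring].
    rewrite {3}pp {2}pp (_ : - _ = pi / 2 * (- 2 - cre s)); last by ring.
    by rewrite mulrC ltr_pM2r //; lra.
  by rewrite sinN sinDpi S oppr0 oppr0 ltxx.
have : 0 < sin (- (pi / 2 * cre s)).
  apply: sin_gt0_pi; rewrite -mulrN mulr_gt0 ?oppr_gt0 //= [X in _ < X]pp.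
  by rewrite mulrC ltr_pM2r //; lra.
by rewrite sinN S oppr0 ltxx.
Qed.

Lemma cpow2 v : 0 < v -> cpow v (rc 2) = rc (v ^+ 2).
Proof.
move=> v0; rewrite (_ : rc 2 = 1 + 1) ?cpowD ?cpow1 ?expr2 ?rcM //.
by rewrite -rc1 -rcD.
Qed.

Lemma fsin_shift v s : 0 < v -> fsin v (s - rc 2) = - rc (v ^+ 2) * fsin v s.
Proof.
move=> v0; rewrite /fsin sarg_shift csinDpi opprB addrC cpowD cpow2 // invrN; ring.
Qed.

(** The removable singularity at 0 is filled in, so that continuity there computes a residue. *)
Definition sinc u := if u == 0 then 1 else csin u / u.

Lemma ccf_sinc : ccf sinc 0.
Proof.
move=> e e0; pose K := expR 1 : R; have K0 : 0 < K by exact: expR_gt0.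
exists (Num.min 1 (e / K)); first by rewrite lt_min ltr01 divr_gt0.
move=> u; rewrite subr0 lt_min => /andP[u1 ue]; rewrite /sinc eqxx.
have [_|u0] := eqVneq u 0; first by rewrite subrr cabs0 ltW.
have cu : 0 < cabs u by rewrite cabs_gt0.
have -> : csin u / u - 1 = (csin u - u) / u by field.
rewrite cabsM cabsV ler_pdivrMr // (le_trans (csin_sub_id u)) //.
rewrite expr2 mulrAC ler_wpM2r ?(ltW cu) //.
apply: (@le_trans _ _ (cabs u * K)).
  by rewrite ler_wpM2l ?(ltW cu) // ler_expR ltW.
by rewrite -ler_pdivlMr // ltW.
Qed.

Let al v : R[i] := cpow v (rc 2) * (- rc (2 / pi)).

(** Since sin(pi s/2) = - sin(pi (s + 2)/2), the product (s + 2) v^(-s) / sin(pi s/2) equals [G],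
    which is continuous at -2 through [sinc] and takes there the value - 2 v^2 / pi. *)
Lemma Res_fsin v : Res (fsin v) (- rc 2) = al v.
Proof.
have pn0 : rc pi != 0 :> R[i] by rewrite rc_eq0 gt_eqF // pi_gt0.
have n2 : rc 2 != 0 :> R[i] by rewrite rc_eq0.
pose G s := cpow v (- s) * (- rc (2 / pi)) * (sinc (sarg (s - - rc 2)))^-1.
have GE : G (- rc 2) = al v.
  by rewrite /G subrr /sarg mulr0 mul0r /sinc eqxx invr1 mulr1 opprK.
have cG : ccf G (- rc 2).
  apply: ccfM; first by apply: ccfM; [exact/holo_ccf/holo_cpow|exact: ccf_cst].
  apply: (@ccf_compf _ (fun w => w^-1) (fun s => sinc (sarg (s - - rc 2)))).
    by apply: ccfV; rewrite subrr /sarg mulr0 mul0r /sinc eqxx oner_neq0.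
  apply: (@ccf_compf _ sinc (fun s => sarg (s - - rc 2))).
    by rewrite subrr /sarg mulr0 mul0r; exact: ccf_sinc.
  apply: (@ccf_compf _ sarg (fun s => s - - rc 2)); first exact/holo_ccf/holo_sarg.
  exact/holo_ccf/holoD/holo_cst/holo_id.
have near2 s : 0 < cabs (s - - rc 2) < 1 -> (-3 < cre s < 0) && (s != - rc 2).
  move=> /andP[s0 s1]; have := cre_le (s - - rc 2); rewrite !cE opprK => H.
  have : `|cre s + 2| < 1 by exact: le_lt_trans H s1.
  rewrite ltr_norml => H'; rewrite -subr_eq0 -cabs_gt0 s0 andbT; lra.
apply: Res_simple.
  exists 1 => // s /near2 /andP[a b]; apply/holo_ccf/holo_fsin; exact: csin_sarg_neq0.
move=> eta eta0; have [d d0 Hd] := cG _ eta0.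
exists (Num.min d 1); first by rewrite lt_min d0 ltr01.
move=> s /andP[s0]; rewrite lt_min => /andP[sd s1].
have /andP[sr s2] : (-3 < cre s < 0) && (s != - rc 2) by apply: near2; rewrite s0.
rewrite -GE; have <- : G s = (s - - rc 2) * fsin v s; last exact: Hd.
have E : csin (sarg s) = - csin (sarg (s - - rc 2)).
  rewrite -csinDpi; congr csin; rewrite /sarg; field; exact: n2.
have nz := csin_sarg_neq0 sr s2.
have w0 : s - - rc 2 != 0 by rewrite subr_eq0.
have a0 : sarg (s - - rc 2) != 0 by rewrite /sarg !mulf_neq0 // invr_eq0.
have nz' : csin (sarg (s - - rc 2)) != 0 by rewrite -oppr_eq0 -E.
rewrite /G /fsin E /sinc (negPf a0) rcM rcV; move: nz'.
set w := s - - rc 2 in w0 *; rewrite {3}/sarg; move: (csin _) => C C0; field.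
by rewrite pn0 n2 w0 C0.
Qed.

Variable c : R.
Hypothesis c10 : -1 < c < 0.

Lemma sin_c_gt0 : 0 < `|sin (pi / 2 * c)|.
Proof.
rewrite normr_gt0; apply/eqP => E.
have p0 : 0 < pi / 2 :> R by rewrite divr_gt0 // pi_gt0.
have pp : pi = 2 * (pi / 2) :> R by field.
move/andP: c10 => [c1 c0].
have : 0 < sin (- (pi / 2 * c)).
  apply: sin_gt0_pi; rewrite -mulrN mulr_gt0 ?oppr_gt0 //= [X in _ < X]pp.
  by rewrite mulrC ltr_pM2r //; lra.
by rewrite sinN E oppr0 ltxx.
Qed.

(** The 8 comes from cosh(pi y/2) >= (1 + y^2/4) / 2 >= (1 + y^2) / 8, where pi/2 >= 1 is used. *)
Definition ksin : R := 8 / `|sin (pi / 2 * c)|.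

Lemma csinV_bound y : (cabs (csin (sarg (Complex c y))))^-1 <= ksin / (1 + y ^+ 2).
Proof.
have s0 := sin_c_gt0; have y0 := sqr_ge0 y.
have q0 : 0 < 1 + y ^+ 2 by lra.
have L : `|sin (pi / 2 * c)| * ((1 + y ^+ 2) / 8) <= cabs (csin (sarg (Complex c y))).
  apply: le_trans (csin_ge_ch _); rewrite cre_sarg cim_sarg !cE ler_wpM2l ?(ltW s0) //.
  apply: le_trans (ch_ge _); rewrite exprMn.
  have p1 : 1 <= (pi / 2) ^+ 2 :> R by rewrite exprn_ege1 // pihalf_ge1.
  have : y ^+ 2 <= (pi / 2) ^+ 2 * y ^+ 2 by rewrite ler_peMl.
  lra.
have L0 : 0 < `|sin (pi / 2 * c)| * ((1 + y ^+ 2) / 8) by rewrite mulr_gt0 // divr_gt0.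
have -> : ksin / (1 + y ^+ 2) = (`|sin (pi / 2 * c)| * ((1 + y ^+ 2) / 8))^-1.
  by rewrite /ksin; field; rewrite !gt_eqF.
by rewrite lef_pV2 ?posrE // (lt_le_trans L0).
Qed.

Lemma csin_line_neq0 y : csin (sarg (Complex c y)) != 0.
Proof.
apply: csin_sarg_neq0; rewrite ?cE; first by move/andP: c10 => [? ?]; lra.
apply/eqP => /(congr1 (@cre R)); rewrite !cE => E; move: c10; rewrite E; lra.
Qed.

Lemma integrable_ksin (k : R) : mu.-integrable setT (EFin \o (fun y => k / (1 + y ^+ 2))).
Proof.
rewrite (_ : _ \o _ = (fun y => k%:E * (EFin \o (fun t : R => (1 + t ^+ 2)^-1)%R) y)%E) //.
by apply: integrableZl => //; exact: integrable_oneDsqrV.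
Qed.

Lemma ccont_cmeasurable (g : R -> R[i]) : (forall x, ccont g x) -> cmeasurable setT g.
Proof. by move=> H; split; apply: continuous_measurable_fun => x; case: (H x). Qed.

Lemma cintegrable_fsin v : 0 < v -> cintegrable setT (fun y => fsin v (Complex c y)).
Proof.
move=> v0; apply: (cintegrable_dom (k := fun y => (powR v (- c) * ksin) / (1 + y ^+ 2))) => //.
- apply: ccont_cmeasurable => y; apply/ccont_v/holo_ccf/holo_fsin; exact: csin_line_neq0.
- exact: integrable_ksin.
- move=> y _; rewrite /fsin cabsM cabs_cpow // !cE cabsV -mulrA.
  by rewrite ler_wpM2l ?powR_ge0 // csinV_bound.
Qed.

(* By [fsin_shift] the left side of the rectangle is a multiple of the right one. *)
Lemma fsin_contour v T : 0 < v -> 0 < T ->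
  (1 + rc (v ^+ 2)) * (ci * cintegral `[- T, T] (fun y => fsin v (Complex c y))) =
  rc (2 * pi) * ci * al v + hint (fsin v) T (c - 2) c - hint (fsin v) (- T) (c - 2) c.
Proof.
move=> v0 T0; move/andP: c10 => [c1 c0].
have E : rectint (fsin v) (c - 2) c (- T) T = rc (2 * pi) * ci * al v.
  rewrite (@Res_rect _ _ _ _ _ _ (- rc 2)) ?Res_fsin ?cE //; [lra|rewrite oppr0; lra|].
  move=> z /andP[zx _] /eqP z2; apply: holo_fsin; apply: csin_sarg_neq0 => //; lra.
have S : vint (fsin v) (c - 2) (- T) T = - rc (v ^+ 2) * vint (fsin v) c (- T) T.
  rewrite /vint [RHS]mulrCA; congr (_ * _); rewrite -(cintegralZ (- rc (v ^+ 2))) //.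
    apply: eq_cintegral => y _; rewrite -fsin_shift //.
    by congr (fsin v _); apply: eqC; rewrite !cE ?oppr0 ?addr0.
  apply: ccont_integrable => y _; apply/ccont_v/holo_ccf/holo_fsin; exact: csin_line_neq0.
rewrite -E /rectint S /vint; ring.
Qed.

(** On the side |Re s| <= 3, whence |v^(-s)| <= exp(3 |ln v|); the reciprocal sine is at most 2 / T,
    and the side has length 2. *)
Lemma hint_fsin_bound v T y : 0 < v -> 0 < T -> `|y| = T ->
  cabs (hint (fsin v) y (c - 2) c) <= expR (3 * `|ln v|) * 4 / T.
Proof.
move=> v0 T0 yT; move/andP: c10 => [c1 c0].
have nz x : c - 2 <= x <= c -> csin (sarg (Complex x y)) != 0.
  move=> xx; apply: csin_sarg_neq0; rewrite ?cE; first lra.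
  apply/eqP => /(congr1 (@cim R)); rewrite !cE oppr0 => E.
  by move: T0; rewrite -yT E normr0 ltxx.
rewrite (_ : _ / T = expR (3 * `|ln v|) * (2 / T) * (c - (c - 2))); last by field; rewrite gt_eqF.
apply: cabs_cintegral_bound; [lra|by move=> x /nz ?; exact/ccont_h/holo_ccf/holo_fsin|].
move=> x xx; rewrite /fsin cabsM cabsV ler_pM ?cabs_ge0 ?invr_ge0 ?cabs_ge0 //.
  rewrite cabs_cexp ler_expR !cE mulr0 subr0.
  rewrite (le_trans (ler_norm _)) // normrM ler_wpM2r //.
  by rewrite normrN ler_norml; lra.
have L : T / 2 <= cabs (csin (sarg (Complex x y))).
  apply: le_trans (csin_ge_sh _); apply: le_trans (sh_ge _).
  rewrite cim_sarg !cE ler_pM2r ?invr_gt0 // normrM yT ger0_norm; last by rewrite divr_ge0 // pi_ge0.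
  by rewrite ler_peMl ?pihalf_ge1 // ltW.
have T2 : 0 < T / 2 by rewrite divr_gt0.
rewrite -[2 / T]invrK invf_div lef_pV2 ?posrE //; exact: lt_le_trans L.
Qed.

(** As the height grows, the horizontal sides in [fsin_contour] disappear and (1 + v^2) i J = 2 pi i
    (- 2 v^2 / pi) is solved for J. *)
Lemma cintegral_fsin v : 0 < v ->
  cintegral setT (fun y => fsin v (Complex c y)) = rc (- (4 * v ^+ 2) / (1 + v ^+ 2)).
Proof.
move=> v0; set J := cintegral _ _; have v2 := sqr_ge0 v.
have V0 : 0 < 1 + v ^+ 2 by lra.
have rV : 1 + rc (v ^+ 2) = rc (1 + v ^+ 2) :> R[i] by rewrite rcD rc1.
suff H : (1 + rc (v ^+ 2)) * (ci * J) = rc (2 * pi) * ci * al v.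
  have n0 : rc (1 + v ^+ 2) * ci != 0 :> R[i] by rewrite mulf_neq0 ?ci_neq0 // rc_eq0 gt_eqF.
  apply: (mulfI n0); rewrite -mulrA -rV H /al cpow2 // -rcN.
  have -> : rc (2 * pi) * ci * (rc (v ^+ 2) * rc (- (2 / pi))) =
      ci * rc (2 * pi * (v ^+ 2 * - (2 / pi))) by rewrite (rcM (2 * pi)) (rcM (v ^+ 2)); ring.
  rewrite rV (mulrC (rc (1 + v ^+ 2))) -[RHS]mulrA -rcM; congr (_ * rc _).
  have pn0 : pi != 0 :> R by rewrite gt_eqF // pi_gt0.
  have vn0 : 1 + v ^+ 2 != 0 by rewrite gt_eqF.
  by move: (pi : R) pn0 => p pn0; field; rewrite vn0 pn0.
apply/eqP; rewrite -subr_eq0 -cabs_eq0 eq_le cabs_ge0 andbT; apply/ler_addgt0Pl => e e0.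
rewrite addr0; have e2 : 0 < e / 2 by rewrite divr_gt0.
have [||||N HN] := @cintegral_exhaust R setT (fun n => [set` `[- n.+1%:R, n.+1%:R]%R]) _ _ _ _
   (cintegrable_fsin v0) _ _ (divr_gt0 e2 V0) => //.
  move=> x _; exists (Num.truncn `|x|) => n Nn; rewrite /= in_itv /= -ler_norml ltW //.
  by rewrite (lt_le_trans (truncnS_gt _)) // ler_nat.
pose K := expR (3 * `|ln v|) * 4; have K0 : 0 < K by rewrite mulr_gt0 // expR_gt0.
(* Beyond 4 K / e each horizontal side is at most e / 4; beyond N the truncated vertical integral is
   within e / 2 / (1 + v^2) of J. *)
pose n := maxn N (Num.truncn (4 * K / e)).
have n0 : 0 < n.+1%:R :> R by [].
have nK : 4 * K / e < n.+1%:R.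
  by rewrite (lt_le_trans (truncnS_gt _)) // ler_nat ltnS leq_maxr.
have {HN} := HN n (leq_maxl _ _); rewrite -/J => HN.
have C := fsin_contour v0 n0; set Jn := cintegral _ _ in C HN.
set h1 := hint _ _ _ _ in C; set h2 := hint _ _ _ _ in C.
have b1 : cabs h1 <= K / n.+1%:R by apply: hint_fsin_bound => //; rewrite ger0_norm // ltW.
have b2 : cabs h2 <= K / n.+1%:R by apply: hint_fsin_bound => //; rewrite normrN ger0_norm // ltW.
have -> : (1 + rc (v ^+ 2)) * (ci * J) - rc (2 * pi) * ci * al v =
   h1 - h2 - (1 + rc (v ^+ 2)) * (ci * (Jn - J)).
  by rewrite (mulrBr ci) (mulrBr (1 + rc (v ^+ 2))) C; ring.
have b3 : K / n.+1%:R <= e / 4.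
  rewrite ler_pdivrMr // mulrC -ler_pdivrMr ?divr_gt0 // invf_div mulrA (mulrC K) ltW //.
rewrite (le_trans (cabsB _ _)) // [leRHS](splitr e) lerD //.
  rewrite (le_trans (cabsB _ _)) // (_ : e / 2 = e / 4 + e / 4); last by field.
  exact: lerD (le_trans b1 b3) (le_trans b2 b3).
rewrite cabsM cabsM cabs_ci mul1r rV cabs_rc gtr0_norm // mulrC -ler_pdivlMr //.
Qed.

Definition Bfun s : R[i] := - rc (pi / 2) / csin (rc pi * s / rc 2).

(** Taking v = 1 / t turns v^(-s) into t^s, and - pi/2 times - 4 v^2 / (1 + v^2) becomes 2 pi / (1 +
    t^2). *)
Lemma cintegral_Bfun t : 0 < t ->
  cintegral setT (fun y => Bfun (Complex c y) * cpow t (Complex c y)) = rc (2 * pi / (1 + t ^+ 2)).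
Proof.
move=> t0; have v0 : 0 < t^-1 by rewrite invr_gt0.
transitivity (- rc (pi / 2) * cintegral setT (fun y => fsin t^-1 (Complex c y))).
  rewrite -cintegralZ //; last exact: cintegrable_fsin.
  apply: eq_cintegral => y _; rewrite /Bfun /fsin cpowV // opprK -/(sarg _); ring.
rewrite cintegral_fsin // -rcN -rcM; congr rc.
have h : 0 < 1 + t ^+ 2 by have := sqr_ge0 t; lra.
have h0 : 1 + t ^+ 2 != 0 by rewrite gt_eqF.
have t1 : t != 0 by rewrite gt_eqF.
by move: (pi : R) => p; field; rewrite ?h0 ?t1 ?(addrC (t ^+ 2)) ?h0.
Qed.

End InverseSine.

(** * Inverse Mellin transform of K and the line Re s = c *)

Section FubiniDominated.
Variable R : realType.
Notation mu := (@lebesgue_measure R).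
Notation RR := (measurableTypeR R).
Implicit Types (D E : set RR).

(** The product majorant makes every section integrable and, by Tonelli, also the function on the
    plane. Integrability of the inner integral is kept because later steps draw integrability on the
    line from it. *)
Lemma Rfubini_setT (f : RR * RR -> R) (g h : R -> R) :
  measurable_fun setT f -> mu.-integrable setT (EFin \o g) -> mu.-integrable setT (EFin \o h) ->
  (forall x y, `|f (x, y)| <= g x * h y) ->
  [/\ Rintegral mu setT (fun x => Rintegral mu setT (fun y => f (x, y))) =
      Rintegral mu setT (fun y => Rintegral mu setT (fun x => f (x, y))) &
      mu.-integrable setT (EFin \o (fun x => Rintegral mu setT (fun y => f (x, y))))].
Proof.
move=> mf ig ih B.
have mF : measurable_fun setT (EFin \o f) by exact/measurable_EFinP.
have mx x : measurable_fun setT (fun y : RR => f (x, y)).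
  exact: (measurableT_comp mf (measurable_pair1 x)).
have my y : measurable_fun setT (fun x : RR => f (x, y)).
  exact: (measurableT_comp mf (measurable_pair2 y)).
have ix x : mu.-integrable setT (EFin \o (fun y => f (x, y))).
  have J : mu.-integrable setT (fun y => (g x)%:E * (EFin \o h) y)%E by exact: integrableZl.
  apply: (le_integrable measurableT _ _ J); first exact/measurable_EFinP.
  by move=> y _ /=; rewrite lee_fin (le_trans (B x y)) // ler_norm.
have iy y : mu.-integrable setT (EFin \o (fun x => f (x, y))).
  have J : mu.-integrable setT (fun x => (h y)%:E * (EFin \o g) x)%E by exact: integrableZl.
  apply: (le_integrable measurableT _ _ J); first exact/measurable_EFinP.
  by move=> x _ /=; rewrite lee_fin (le_trans (B x y)) // mulrC ler_norm.
have E1 x : ((Rintegral mu setT (fun y => f (x, y)))%:E = \int[mu]_y (f (x, y))%:E)%E.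
  by rewrite /Rintegral fineK //; apply: integrable_fin_num; [exact: measurableT|exact: (ix x)].
have E2 y : ((Rintegral mu setT (fun x => f (x, y)))%:E = \int[mu]_x (f (x, y))%:E)%E.
  by rewrite /Rintegral fineK //; apply: integrable_fin_num; [exact: measurableT|exact: (iy y)].
have I : (mu \x mu)%E.-integrable setT (EFin \o f).
  apply/(integrable12ltyP mu mu mF).
  pose H := (\int[mu]_y `|(h y)%:E|)%E.
  have Hf : H \is a fin_num by apply: integrable_fin_num => //; exact: integrable_abse.
  have HE : H = (fine H)%:E by rewrite fineK.
  have J : mu.-integrable setT (fun x => (fine H)%:E * `|(EFin \o g) x|)%E.
    by apply: integrableZl => //; exact: integrable_abse.
  apply: le_lt_trans (integrable_lty measurableT J).
  apply: ge0_le_integral => //.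
  - by move=> x _; exact: integral_ge0.
  - have p0 p : (0 <= (abse \o (EFin \o f)) p)%E by exact: abse_ge0.
    have mp : measurable_fun setT (abse \o (EFin \o f)) by apply: measurableT_comp => //; exact: mF.
    exact: (measurable_fun_fubini_tonelli_F _ mp p0).
  - exact: measurable_int J.
  move=> x _; rewrite -HE muleC -ge0_integralZl //; last first.
    by apply: measurableT_comp => //; exact: measurable_int ih.
  apply: ge0_le_integral => //.
  - by apply: measurableT_comp => //; exact/measurable_EFinP.
  - by apply: measurable_funeM; apply: measurableT_comp => //; exact: measurable_int ih.
  by move=> y _ /=; rewrite lee_fin -normrM (le_trans (B x y)) // ler_norm.
split; last first.
  have := integrable_fubini_F I.
  by apply: eq_integrable => // x _; rewrite /fubini_F /= E1.
rewrite [LHS]/Rintegral [RHS]/Rintegral; congr fine.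
under eq_integral do rewrite E1; under [RHS]eq_integral do rewrite E2.
exact: (Fubini I).
Qed.

(** Extension by zero outside [D] and [E] reduces to the whole plane. *)
Lemma Rfubini D E (f : R -> R -> R) (g h : R -> R) : measurable D -> measurable E ->
  measurable_fun (D `*` E) (fun p : RR * RR => f p.1 p.2) ->
  mu.-integrable D (EFin \o g) -> mu.-integrable E (EFin \o h) ->
  (forall x y, D x -> E y -> `|f x y| <= g x * h y) ->
  [/\ Rintegral mu D (fun x => Rintegral mu E (f x)) =
      Rintegral mu E (fun y => Rintegral mu D (f^~ y)) &
      mu.-integrable D (EFin \o (fun x => Rintegral mu E (f x)))].
Proof.
move=> mD mE mf ig ih B.
pose F := (fun p : RR * RR => f p.1 p.2) \_ (D `*` E).
have mDE : measurable (D `*` E) by exact: measurableX.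
have Fx x y : F (x, y) = if x \in D then (f x \_ E) y else 0.
  rewrite /F /patch in_setX /=; case: (x \in D) => //.
have Fy x y : F (x, y) = if y \in E then (f^~ y \_ D) x else 0.
  by rewrite /F /patch in_setX /= andbC; case: (y \in E).
have iD : mu.-integrable setT (EFin \o (g \_ D)).
  by move/(integrable_mkcond _ mD): ig; rewrite restrict_EFin.
have iE : mu.-integrable setT (EFin \o (h \_ E)).
  by move/(integrable_mkcond _ mE): ih; rewrite restrict_EFin.
have mF : measurable_fun setT F by exact: (measurable_restrictT _ mDE).1.
have BF x y : `|F (x, y)| <= (g \_ D) x * (h \_ E) y.
  rewrite Fx /patch; case: ifPn => [/set_mem Dx|_]; last by rewrite mul0r normr0.
  case: ifPn => [/set_mem Ey|_]; last by rewrite mulr0 normr0.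
  exact: B.
have [S J] := Rfubini_setT mF iD iE BF.
have GE : (fun x => Rintegral mu setT (fun y => F (x, y))) = (fun x => Rintegral mu E (f x)) \_ D.
  apply/funext => x; rewrite [RHS]/patch; under eq_Rintegral do rewrite Fx.
  by case: ifP => _; rewrite -?Rintegral_mkcond // /Rintegral integral0.
have GE' : (fun y => Rintegral mu setT (fun x => F (x, y))) = (fun y => Rintegral mu D (f^~ y)) \_ E.
  apply/funext => y; rewrite [RHS]/patch; under eq_Rintegral do rewrite Fy.
  by case: ifP => _; rewrite -?Rintegral_mkcond // /Rintegral integral0.
rewrite GE GE' -!Rintegral_mkcond in S; split => //.
by apply/integrable_mkcond => //; rewrite restrict_EFin -GE.
Qed.

Lemma cfubini D E (f : R -> R -> R[i]) (g h : R -> R) : measurable D -> measurable E ->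
  cmeas (D `*` E) (fun p : RR * RR => f p.1 p.2) ->
  mu.-integrable D (EFin \o g) -> mu.-integrable E (EFin \o h) ->
  (forall x y, D x -> E y -> cabs (f x y) <= g x * h y) ->
  [/\ cintegral D (fun x => cintegral E (f x)) = cintegral E (fun y => cintegral D (f^~ y)) &
      cintegrable D (fun x => cintegral E (f x))].
Proof.
move=> mD mE [mr mi] ig ih B.
have [Sr Ir] := @Rfubini D E (fun x y => cre (f x y)) g h mD mE mr ig ih
  (fun x y Dx Ey => le_trans (cre_le _) (B x y Dx Ey)).
have [Si Ii] := @Rfubini D E (fun x y => cim (f x y)) g h mD mE mi ig ih
  (fun x y Dx Ey => le_trans (cim_le _) (B x y Dx Ey)).
split; last by split; [exact: Ir|exact: Ii].
by apply: eqC; [exact: Sr|exact: Si].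
Qed.

End FubiniDominated.

Section Kernel.
Variable R : realType.
Notation mu := (@lebesgue_measure R).
Notation RR := (measurableTypeR R).
Implicit Types (x y t : R) (z s : R[i]).

Lemma cmeas_comp d1 d2 (T1 : measurableType d1) (T2 : measurableType d2)
    (k : T1 -> T2) (g : T2 -> R[i]) :
  cmeas setT g -> measurable_fun setT k -> cmeas setT (fun p => g (k p)).
Proof. by move=> [a b] mk; split; [exact: (measurableT_comp a mk)|exact: (measurableT_comp b mk)]. Qed.

Lemma cmeasTS d1 (T1 : measurableType d1) (D : set T1) (g : T1 -> R[i]) :
  cmeas setT g -> cmeas D g.
Proof. by move=> [a b]; split; exact: measurable_funTS. Qed.

Lemma cintegral_rc (D : set RR) (k : R -> R) : cintegral D (fun t => rc (k t)) = rc (Rintegral mu D k).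
Proof.
apply: eqC; rewrite !cE //; transitivity (Rintegral mu D (fun=> 0)) => //.
by rewrite /Rintegral integral0.
Qed.

Variable c : R.
Hypothesis c10 : -1 < c < 0.

Let L y : R[i] := Complex c y.

Lemma cmeas_line d1 (T1 : measurableType d1) (D : set T1) (k : T1 -> R) :
  measurable_fun D k -> cmeas D (fun p => L (k p)).
Proof. by move=> mk; split => //; exact: measurable_cst. Qed.

Lemma cmeas_Bfun : cmeas setT (fun y : RR => Bfun (L y)).
Proof.
apply: ccont_cmeasurable => y; apply: ccont_v; apply: holo_ccf.
apply: holoM; first exact: holo_cst.
apply: (@holo_comp _ (fun w => w^-1) (fun s => csin (sarg s))).
  by apply: holoV; exact: csin_line_neq0.
exact: (holo_comp (holo_csin _) (holo_sarg _)).
Qed.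

Lemma cabs_Bfun y : cabs (Bfun (L y)) <= pi / 2 * ksin c / (1 + y ^+ 2).
Proof.
rewrite /Bfun cabsM cabsN cabs_rc ger0_norm ?divr_ge0 ?pi_ge0 // cabsV -[leRHS]mulrA.
by rewrite ler_wpM2l ?divr_ge0 ?pi_ge0 //; exact: csinV_bound.
Qed.

Lemma cintegrable_Bfun t : 0 < t -> cintegrable setT (fun y => Bfun (L y) * cpow t (L y)).
Proof.
move=> t0; have v0 : 0 < t^-1 by rewrite invr_gt0.
have mT : measurable (setT : set RR) by [].
apply: (eq_cintegrable mT _ (cintegrableZ (- rc (pi / 2)) mT (cintegrable_fsin c10 v0))).
by move=> y _; rewrite /Bfun /fsin cpowV // opprK -/(sarg _); ring.
Qed.

Let E : set RR := [set` `]0, +oo[%R].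
Let f x y t := Bfun (L y) * (rc (expR (- (x * t))) * cpow t (L y)).

(** Euler's integral is taken at s + 1, whose real part c + 1 lies in ]0, 1[; of its factor x^(s+1)
    only x survives the multiplication by x^(-s). *)
Lemma KfunE x y : 0 < x -> Kfun (L y) * cpow x (- L y) = rc x * cintegral E (f x y).
Proof.
move=> x0; move/andP: c10 => [c1 c0].
have z0 : 0 < cre (L y + 1) by rewrite !cE; lra.
have z1 : cre (L y + 1) <= 1 by rewrite !cE; lra.
have mE : measurable E by exact: measurable_itv.
rewrite /f cintegralZ //; last first.
  apply: (cintegrable_dom (k := fun t => expR (- (x * t)) * powR t (c + 1 - 1)) mE).
  - apply: (@cmeasM _ _ RR); last exact: cmeasurable_cpow.
    apply: cmeas_rc; apply: measurable_funTS; apply: measurableT_comp; first exact: measurable_expR.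
    by apply: continuous_measurable_fun; move=> t; apply: continuousN; exact: mulrl_continuous.
  - by apply: expR_powR_integrable => //; lra.
  - move=> t; rewrite /E /= in_itv /= andbT => t0; rewrite cabsM cabs_rc ger0_norm ?expR_ge0 //.
    by rewrite cabs_cpow // !cE addrK.
rewrite /Kfun (cGamma_integral x0 z0 z1) addrK cpowD cpow1 // cpowN.
have n0 := cpow_neq0 x (L y); rewrite /Bfun; move: (cpow x (L y)) n0 => w w0.
rewrite -/(sarg (L y)); have S0 := csin_line_neq0 c10 y; rewrite -/(L y) in S0.
by move: (csin _) S0 (cintegral _ _) => u u0 J; field; rewrite w0 u0.
Qed.

(** On the line |t^s| = t^c, so the integrand is bounded by a multiple of 1 / (1 + y^2) times exp(-x
    t) t^c. *)
Lemma Kfun_fubini x : 0 < x ->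
  cintegral setT (fun y => cintegral E (f x y)) = cintegral E (fun t => cintegral setT (fun y => f x y t)) /\
  cintegrable setT (fun y => cintegral E (f x y)).
Proof.
move=> x0; move/andP: c10 => [c1 c0].
have mE : measurable E by exact: measurable_itv.
apply: (@cfubini _ setT E (f x) (fun y => pi / 2 * ksin c / (1 + y ^+ 2))
   (fun t => expR (- (x * t)) * powR t (c + 1 - 1)) measurableT mE).
- apply: cmeasTS; apply: cmeasM; first exact: (cmeas_comp cmeas_Bfun measurable_fst).
  apply: cmeasM; last first.
    by apply: cmeas_cpow; [exact: measurable_snd|apply: cmeas_line; exact: measurable_fst].
  apply: cmeas_rc; apply: measurableT_comp; first exact: measurable_expR.
  apply: (@measurableT_comp _ _ _ _ _ _ (fun t : R => - (x * t))); last exact: measurable_snd.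
  by apply: continuous_measurable_fun; move=> t; apply: continuousN; exact: mulrl_continuous.
- exact: integrable_ksin.
- by apply: expR_powR_integrable => //; lra.
move=> y t _; rewrite /E /= in_itv /= andbT => t0; rewrite /f cabsM.
rewrite ler_pM ?cabs_ge0 ?cabs_Bfun //.
by rewrite cabsM cabs_rc ger0_norm ?expR_ge0 // cabs_cpow // !cE addrK.
Qed.

(** Integrability in y is that of the inner integral in Fubini's theorem; the decay is supplied by
    [Bfun]. *)
Lemma Kfun_integrable x : 0 < x -> cintegrable setT (fun y => Kfun (L y) * cpow x (- L y)).
Proof.
move=> x0; have [_ I] := Kfun_fubini x0; have mT : measurable (setT : set RR) by [].
by apply: (eq_cintegrable mT _ (cintegrableZ (rc x) mT I)) => y _; rewrite (KfunE y x0).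
Qed.

Lemma Kfun_integral x : 0 < x ->
  cintegral setT (fun y => Kfun (L y) * cpow x (- L y)) = rc (2 * pi * Xi x).
Proof.
move=> x0; have mT : measurable (setT : set RR) by [].
have [S I] := Kfun_fubini x0; transitivity (rc x * cintegral setT (fun y => cintegral E (f x y))).
  rewrite -(cintegralZ (rc x) mT I); apply: eq_cintegral => y _; exact: (KfunE y x0).
rewrite S; transitivity (rc x * cintegral E (fun t => rc (2 * pi * (expR (- (x * t)) / (1 + t ^+ 2))))).
  congr (_ * _); apply: eq_cintegral => t; rewrite /E /= in_itv /= andbT => t0.
  transitivity (rc (expR (- (x * t))) * cintegral setT (fun y => Bfun (L y) * cpow t (L y))).
    rewrite -(cintegralZ _ mT (cintegrable_Bfun t0)).
    by apply: eq_cintegral => y _; rewrite /f; ring.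
  by rewrite (cintegral_Bfun c10 t0) -rcM mulrCA.
pose k t := expR (- (x * t)) / (1 + t ^+ 2).
have ik : mu.-integrable E (EFin \o k).
  have mE : measurable E by exact: measurable_itv.
  have J : mu.-integrable E (EFin \o (fun t => (1 + t ^+ 2)^-1)).
    exact: (integrableS mT mE (@subsetT _ E) (integrable_oneDsqrV R)).
  apply: (le_integrable mE _ _ J).
    apply/measurable_EFinP; apply: measurable_funTS; apply: continuous_measurable_fun => t.
    apply: cvgM; last exact: continuous_oneDsqrV.
    apply: (@continuous_comp _ _ _ (fun t => - (x * t)) (@expR R)); last exact: continuous_expR.
    by apply: continuousN; exact: mulrl_continuous.
  move=> t; rewrite /E /= in_itv /= andbT => t0; rewrite lee_fin /k; clear J mE S I f.
  have h : 0 < 1 + t ^+ 2 by have := sqr_ge0 t; lra.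
  rewrite normrM (ger0_norm (expR_ge0 _)); apply: ler_piMl; first exact: normr_ge0.
  by rewrite -expR0 ler_expR oppr_le0 mulr_ge0 ?ltW.
(* [Xi] integrates over the closed half-line, the Mellin side over the open one; the endpoint is a
   null set. *)
rewrite cintegral_rc -rcM; congr rc; rewrite /Xi -(Rintegral_itv_obnd_cbnd ik).
have mE : measurable E by exact: measurable_itv.
have Z := RintegralZl (2 * pi) mE ik; rewrite /k in Z *; rewrite Z.
by rewrite mulrCA mulrA.
Qed.

(** Bounding [Bfun] by the constant [A] leaves A exp(-x t) t^c under the integral, which does not
    depend on y. The uniform bound serves to exclude poles on the line. *)
Lemma Kfun_bounded x : 0 < x -> exists M, forall y, cabs (Kfun (L y) * cpow x (- L y)) <= M.
Proof.
move=> x0; have [c1 c0] := andP c10; have mE : measurable E by exact: measurable_itv.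
pose k t := expR (- (x * t)) * powR t (c + 1 - 1); pose A := pi / 2 * ksin c.
have ik : mu.-integrable E (EFin \o k) by apply: expR_powR_integrable; [|lra|lra].
have iA : mu.-integrable E (EFin \o (fun t => A * k t)).
  by rewrite (_ : _ \o _ = (fun t => A%:E * (EFin \o k) t)%E) //; exact: integrableZl.
have A0 : 0 <= A.
  have := le_trans (cabs_ge0 _) (cabs_Bfun 0); by rewrite expr0n /= addr0 divr1.
exists (x * Rintegral mu E (fun t => A * k t)) => y.
rewrite (KfunE y x0) cabsM cabs_rc (gtr0_norm x0); apply: ler_wpM2l; first exact: ltW.
have B t : E t -> cabs (f x y t) <= A * k t.
  rewrite /E /= in_itv /= andbT => t0; rewrite /f cabsM; apply: ler_pM; rewrite ?cabs_ge0 //.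
    apply: le_trans (cabs_Bfun y) _; rewrite ler_pdivrMr; last by have := sqr_ge0 y; lra.
    by rewrite -/A ler_peMr // lerDl sqr_ge0.
  by rewrite cabsM cabs_rc ger0_norm ?expR_ge0 // cabs_cpow // !cE /k addrK.
apply: (cabs_cintegral_dom mE _ iA B); apply: (cintegrable_dom mE _ iA B).
apply: (@cmeasM _ _ RR); first exact: cmeas_cst.
apply: (@cmeasM _ _ RR); last exact: cmeasurable_cpow.
apply: cmeas_rc; apply: measurable_funTS; apply: measurableT_comp; first exact: measurable_expR.
by apply: continuous_measurable_fun; move=> t; apply: continuousN; exact: mulrl_continuous.
Qed.

End Kernel.

(** * The function S as an integral over the line Re s = c *)

Section SLine.
Variable R : realType.
Notation mu := (@lebesgue_measure R).
Notation RR := (measurableTypeR R).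
Implicit Types (x y t : R) (z s : R[i]).

Lemma rc_twopi_neq0 : rc (2 * pi) != 0 :> R[i].
Proof. by rewrite rc_eq0 mulf_neq0 // gt_eqF // pi_gt0. Qed.

Variables (Phi : R -> R[i]) (c m : R).
Hypothesis c10 : -1 < c < 0.
Hypothesis m0 : 0 < m.
Hypothesis mPhi : cmeasurable `]0, +oo[ Phi.
Hypothesis iPhi : (\int[mu]_(y in `]0%R, +oo[%classic)
  (cabs (Phi y) * powR y (- c - 1))%:E < +oo)%E.
Hypothesis D0n0 : D0 Phi != 0.

Let L y : R[i] := Complex c y.
Let E : set RR := [set` `]0, +oo[%R].
Let h y := cabs (Phi y) * powR y (- c - 1).

Let mE : measurable E. Proof. exact: measurable_itv. Qed.
Let mT : measurable (setT : set RR). Proof. by []. Qed.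

Lemma integrable_weight : mu.-integrable E (EFin \o h).
Proof.
apply/integrableP; split.
  apply/measurable_EFinP; apply: measurable_funM; first exact: (measurable_cabs mPhi).
  by apply: measurable_funTS; exact: measurable_powR.
rewrite (_ : (fun y => _) = (fun y => (h y)%:E)) //; apply/funext => y /=.
by rewrite ger0_norm // mulr_ge0 ?cabs_ge0 ?powR_ge0.
Qed.

Lemma Mellin_line y : Mellin_abs Phi (- L y).
Proof.
apply: (cintegrable_dom mE _ integrable_weight).
  by apply: (@cmeasM _ _ RR); [exact: cmeasurable_cpow|exact: mPhi].
move=> t; rewrite /E /= in_itv /= andbT => t0.
by rewrite cabsM cabs_cpow // mulrC !cE.
Qed.

Let K y := Kfun (L y) * cpow m (- L y).
Let f t y := (D0 Phi)^-1 * K y * (cpow t (- L y - 1) * Phi t).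

Let cmeas_f : cmeas (E `*` setT) (fun p : RR * RR => f p.1 p.2).
Proof.
have mK : cmeas setT (K : RR -> R[i]) by exact: cintegrable_measurable (Kfun_integrable c10 m0).
apply: cmeasM.
  apply: cmeasM; first exact: cmeas_cst.
  by apply: cmeasTS; exact: (cmeas_comp mK measurable_snd).
apply: cmeasM.
  apply: cmeasTS; apply: cmeas_cpow; first exact: measurable_fst.
  have -> : (fun p : RR * RR => - L p.2 - 1) = (fun p : RR * RR => -1 * L p.2 + -1).
    by apply/funext => p; rewrite mulN1r.
  apply: cmeasD; last exact: cmeas_cst.
  by apply: cmeasM; [exact: cmeas_cst|apply: cmeas_line; exact: measurable_snd].
have sub : [set p.1 | p in E `*` (setT : set RR)] `<=` E by move=> _ [p [Ep _] <-].
case: mPhi => mr mi; split.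
  exact: (measurable_comp mE sub mr (measurable_funTS measurable_fst)).
exact: (measurable_comp mE sub mi (measurable_funTS measurable_fst)).
Qed.

(** Second use of Fubini, with majorants |Phi(t)| t^(-c-1) and |K(s) m^(-s)| / |D0|. Since t^(-s-1)
    m^(-s) = (m t)^(-s) / t, the inner integral over the line is 2 pi Xi(m t) Phi(t) / t, divided by
    D0. *)
Lemma cintegral_Iform : cintegral setT (fun y => Iform Phi m (L y)) = rc (2 * pi) * Sfun Phi m.
Proof.
have iK : mu.-integrable setT (EFin \o (fun y => cabs ((D0 Phi)^-1 * K y))).
  apply: (integrable_cabs mT); apply: cintegrableZ => //; exact: Kfun_integrable.
have [S I] : cintegral E (fun t => cintegral setT (f t)) = cintegral setT (fun y => cintegral E (f^~ y)) /\
    cintegrable E (fun t => cintegral setT (f t)).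
  apply: (cfubini mE mT cmeas_f integrable_weight iK) => t y.
  rewrite /E /= in_itv /= andbT => t0 _; rewrite /f cabsM mulrC.
  by rewrite [cabs (cpow _ _ * _)]cabsM cabs_cpow // (mulrC (powR _ _)) !cE.
have -> : cintegral setT (fun y => Iform Phi m (L y)) = cintegral setT (fun y => cintegral E (f^~ y)).
  apply: eq_cintegral => y _; rewrite [RHS](cintegralZ _ mE (Mellin_line y)) /Iform /K.
  rewrite -/(Mellin Phi (- L y)); ring.
pose q t := Phi t / rc t * rc (Xi (m * t)).
pose d := (D0 Phi)^-1 * rc (2 * pi); have dn0 : d != 0.
  by apply: mulf_neq0; [rewrite invr_eq0|exact: rc_twopi_neq0].
have fq t : E t -> cintegral setT (f t) = d * q t.
  rewrite /E /= in_itv /= andbT => t0; have mt0 : 0 < m * t by rewrite mulr_gt0.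
  transitivity ((D0 Phi)^-1 * (Phi t / rc t) * cintegral setT (fun y => Kfun (L y) * cpow (m * t) (- L y))).
    rewrite -(cintegralZ _ mT (Kfun_integrable c10 mt0)); apply: eq_cintegral => y _.
    rewrite /f /K (cpowD t) (cpowN t 1) (cpow1 t0) (cpowMl _ m0 t0); ring.
  by rewrite (Kfun_integral c10 mt0) rcM /d /q; ring.
rewrite -S (eq_cintegral fq).
(* Fubini gives the integrability of d * q; dividing by the nonzero constant [d] gives that of the
   integrand of [Sfun]. *)
have iq : cintegrable E q.
  have J := eq_cintegrable mE fq I.
  apply: (eq_cintegrable mE _ (cintegrableZ d^-1 mE J)) => t _.
  exact: (mulKf dn0).
by rewrite (cintegralZ d mE iq) /Sfun /d -mulrA mulrCA.
Qed.

End SLine.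

(** * Shifting the contour *)

(* Joins the library's pointed and topological structures on [R * R], as [compact_cover] needs. *)
HB.instance Definition _ (R : realType) := Pointed.on (R * R)%type.

Section Poles.
Variable R : realType.
Notation mu := (@lebesgue_measure R).
Implicit Types (x y t T : R) (z s w : R[i]).

Variables (a b : R) (I : R[i] -> R[i]) (P : set R[i]).
Hypothesis mer : meromorphic_on (strip a b) I P.

Lemma strip_open z : a < cre z < b ->
  exists2 r, 0 < r & forall w, cabs (w - z) < r -> a < cre w < b.
Proof.
move=> /andP[az zb]; exists (Num.min (cre z - a) (b - cre z)).
  by rewrite lt_min !subr_gt0 az zb.
move=> w; rewrite lt_min => /andP[w1 w2]; have := cre_le (w - z); rewrite !cE => H.
have : `|cre w - cre z| < cre z - a by exact: le_lt_trans H w1.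
have : `|cre w - cre z| < b - cre z by exact: le_lt_trans H w2.
by rewrite !ltr_norml; lra.
Qed.

Lemma holo_off z : a < cre z < b -> ~ P z -> holo I z.
Proof. by case: mer => _ _ _ d _ sz nP; apply: derivable_holo; exact: d. Qed.

Lemma pole_isolated z : a < cre z < b -> exists2 r, 0 < r &
  forall w, 0 < cabs (w - z) < r -> a < cre w < b /\ ~ P w.
Proof.
case: mer => _ _ i _ _ sz; have [r r0 Hr] := i _ sz; have [r' r'0 Hr'] := strip_open sz.
exists (Num.min r r'); first by rewrite lt_min r0.
move=> w /andP[w0]; rewrite lt_min => /andP[wr wr']; split; first exact: Hr'.
by move=> Pw; have := Hr _ Pw w0; rewrite leNgt wr.
Qed.

Lemma pole_strip z : P z -> a < cre z < b.
Proof. by case: mer => _ s _ _ _ /s. Qed.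

(** By compactness finitely many isolating neighbourhoods cover the rectangle, and each contains at
    most one pole, namely its center. *)
Lemma poles_finite x0 x1 y0 y1 : a < x0 -> x1 < b ->
  finite_set [set z | P z /\ inrect x0 x1 y0 y1 z].
Proof.
move=> ax xb; pose Q : set (R * R) := [set` `[x0, x1]%R] `*` [set` `[y0, y1]%R].
have cQ : cover_compact Q.
  rewrite -(@compact_cover (R * R)%type); apply: compact_setX; exact: segment_compact.
pose C (p : R * R) : R[i] := Complex p.1 p.2.
(* The radius is defined for every [p], with default 0 off [Q], so that [choice] applies. *)
have H p : exists r : R, Q p -> 0 < r /\ forall w, 0 < cabs (w - C p) < r -> ~ P w.
  have [Qp|] := pselect (Q p); last by exists 0.
  have sp : a < cre (C p) < b.
    by move: Qp => [/= + _]; rewrite in_itv /= => /andP[u v]; rewrite /C /cre /= (lt_le_trans ax u) (le_lt_trans v).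
  by have [r r0 Hr] := pole_isolated sp; exists r => _; split => // w /Hr[].
have {H} [r Hr] := choice H.
(* Balls of R * R are boxes: with half-width r p / 2 they lie inside the disc of radius [r p], in
   which only the center can be a pole. *)
have [] := cQ (R * R)%type Q (fun p => ball p (r p / 2)).
- by move=> p _; exact: ball_open.
- by move=> p Qp; exists p => //; apply: ballxx; have [? _] := Hr _ Qp; rewrite divr_gt0.
move=> D' DQ cov; apply: (sub_finite_set _ (finite_image C (finite_fset D'))) => z [Pz].
rewrite /inrect => /andP[xz yz].
have Qz : Q (cre z, cim z) by split; rewrite /= in_itv.
have [p pD [/= bx by_]] := cov _ Qz; have Qp : Q p by apply/set_mem/DQ.
have [rp Hp] := Hr _ Qp; exists p => //; apply/eqP; apply: contraPT Pz => zp.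
apply: Hp; rewrite cabs_gt0 subr_eq0 eq_sym zp /=.
apply: (le_lt_trans (cabs_le _)); rewrite !cE [ltRHS](splitr (r p)).
by rewrite ltrD // distrC.
Qed.

(* Countably many ordinates cannot exhaust an interval. *)
Lemma exists_height t0 t1 : t0 < t1 -> exists2 T, t0 < T < t1 & forall z, P z -> `|cim z| != T.
Proof.
(* These rectangles exhaust the strip while staying off its edges, where poles may accumulate. *)
move=> t01; pose A n : set R[i] := [set z | P z /\
   inrect (a + n.+1%:R^-1) (b - n.+1%:R^-1) (- n%:R) n%:R z].
have cA : countable [set `|cim z| | z in \bigcup_n A n].
  apply: (sub_countable (card_image_le _ _)); apply: bigcup_countable => // n _.
  apply: finite_set_countable; apply: poles_finite; rewrite ?ltrDl ?gtrDl ?oppr_lt0 invr_gt0 //.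
apply: contrapT => N; have : mu (`]t0, t1[%classic : set R) = 0.
  apply: countable_lebesgue_measure0; apply: (sub_countable _ cA).
  apply: subset_card_le => T; rewrite /= in_itv /= => tT.
  apply: contrapT => nT; apply: N; exists T => // z Pz; apply/eqP => zT.
  apply: nT; exists z => //; have /andP[az zb] := pole_strip Pz.
  pose d := Num.min (cre z - a) (b - cre z).
  have d0 : 0 < d by rewrite lt_min !subr_gt0 az.
  exists (maxn (Num.truncn d^-1) (Num.truncn `|cim z|).+1) => //; split => //.
  set n := maxn _ _.
  have nd : n.+1%:R^-1 <= d.
    rewrite -[d]invrK lef_pV2 ?posrE ?invr_gt0 // ltW //.
    by rewrite (lt_le_trans (truncnS_gt _)) // ler_nat ltnS leq_maxl.
  have nz : `|cim z| <= n%:R.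
    by rewrite ltW // (lt_le_trans (truncnS_gt _)) // ler_nat leq_maxr.
  move: nd; rewrite /d le_min => /andP[u v]; apply/andP; split; last by rewrite -ler_norml.
  by move: u v; set e := _^-1; lra.
rewrite lebesgue_measure_itv /= lte_fin t01 -EFinB => /eqP.
by rewrite eqe subr_eq0 gt_eqF.
Qed.

End Poles.

(** * Rectangles of growing height *)

Section Shift.
Variable R : realType.
Notation mu := (@lebesgue_measure R).
Notation RR := (measurableTypeR R).
Implicit Types (x y t T : R) (z s w : R[i]) (g : R -> R[i]).

(** Dominated convergence works along sequences. If the claim failed, there would be bad heights
    [T_ n] > n, and the intervals [- T_ n, T_ n] exhaust the line. *)
Lemma cintegral_tail g : cintegrable setT g -> forall e, 0 < e ->
  exists T0, forall T, T0 < T -> cabs (cintegral `[- T, T] g - cintegral setT g) <= e.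
Proof.
move=> ig e e0; apply: contrapT => N.
have H n : exists T : R, n%:R < T /\ ~ (cabs (cintegral `[- T, T] g - cintegral setT g) <= e).
  apply: contrapT => nT; apply: N; exists n%:R => T nt; apply: contrapT => h.
  by apply: nT; exists T.
have [T_ HT] := choice H.
have [||||N0 HN] := @cintegral_exhaust R setT (fun n => [set` `[- T_ n, T_ n]%R]) g _ _ _ ig _ e e0.
- by [].
- by move=> n; exact: measurable_itv.
- by [].
- move=> x _; exists (Num.truncn `|x|).+1 => n Nn; rewrite /= in_itv /= -ler_norml ltW //.
  apply: lt_trans (truncnS_gt _) _; apply: le_lt_trans (HT n).1; by rewrite ler_nat.
by have [_] := HT N0; apply; exact: HN.
Qed.

(** It leaves a gap below [T] free of pole ordinates, within which [T] can be lowered while the same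
    poles stay enclosed. *)
Lemma seq_lt_max (k : R[i] -> R) T (s : seq R[i]) : (forall z, z \in s -> k z < T) ->
  exists2 T1, T1 < T & forall z, z \in s -> k z <= T1.
Proof.
elim: s => [|z s IH] H; first by exists (T - 1) => //; rewrite gtrBl.
have [w ws|T1 T1T H1] := IH; first by apply: H; rewrite inE ws orbT.
exists (Num.max (k z) T1); first by rewrite gt_max T1T H // mem_head.
move=> w; rewrite inE => /orP[/eqP ->|/H1 h]; first by rewrite le_max lexx.
by rewrite le_max h orbT.
Qed.

Variables (a b m : R) (I : R[i] -> R[i]) (P : set R[i]).
Hypothesis mer : meromorphic_on (strip a b) I P.
Hypothesis m0 : 0 < m.

Lemma line_ccf x y : a < x < b -> (forall z, P z -> cre z != x) -> ccf I (Complex x y).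
Proof.
by move=> xab Px; apply/holo_ccf/(holo_off mer); rewrite ?cE // => /Px; rewrite cE eqxx.
Qed.

Lemma line_integrable x : a < x < b -> (forall z, P z -> cre z != x) ->
  (A_int I m x < +oo)%E ->
  cintegrable setT (fun t => I (Complex x t)) /\
  cabs (cintegral setT (fun t => I (Complex x t))) <= powR m (- x) * fine (A_int I m x).
Proof.
move=> xab Px Afin; have mT : measurable (setT : set RR) by [].
pose J t := I (Complex x t) * cpow m (Complex x t).
have mI : cmeasurable setT (fun t => I (Complex x t)).
  by apply: ccont_cmeasurable => t; apply: ccont_v; exact: line_ccf.
have mJ : cmeasurable setT J.
  apply: (@cmeasM _ _ RR _ _ _ mI); apply: cmeas_cpow; first exact: measurable_cst.
  by split; [exact: measurable_cst|exact: measurable_id].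
have iJ : cintegrable setT J by exact: (cintegrableP mT mJ).
have cJ := integrable_cabs mT iJ.
have JE t : cabs (I (Complex x t)) = powR m (- x) * cabs (J t).
  have p0 : powR m x != 0 by rewrite gt_eqF ?powR_gt0.
  by rewrite /J cabsM cabs_cpow // powRN mulrCA mulVf ?mulr1.
have ik : mu.-integrable setT (EFin \o (fun t => powR m (- x) * cabs (J t))).
  by rewrite (_ : _ \o _ = (fun t => (powR m (- x))%:E * (EFin \o (@cabs R \o J)) t)%E) //; exact: integrableZl.
have B t : setT t -> cabs (I (Complex x t)) <= powR m (- x) * cabs (J t) by rewrite JE.
have iI := cintegrable_dom mT mI ik B; split => //.
apply: (le_trans (cabs_cintegral_dom mT iI ik B)).
by rewrite (RintegralZl _ mT cJ).
Qed.

Let holoI z : a < cre z < b -> ~ P z -> holo I z.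
Proof. exact: (holo_off mer). Qed.

Variables sl sr : R.
Hypotheses (asl : a < sl) (slr : sl < sr) (srb : sr < b).
Hypothesis Psl : forall z, P z -> cre z != sl.
Hypothesis Psr : forall z, P z -> cre z != sr.

Let S T := [set z | P z /\ sl < cre z < sr /\ `|cim z| < T].

Lemma poles_below_finite T : finite_set (S T).
Proof.
apply: (sub_finite_set _ (poles_finite mer (- T) T asl srb)) => z [Pz [/andP[u v] w]].
by split => //; rewrite /inrect -ler_norml !ltW.
Qed.

(* The sum over [S T] makes sense for every [T], the rectangle only for pole-free ordinates. *)
Lemma poles_below_generic T t0 : t0 < T -> exists2 T', t0 < T' < T &
  (forall z, P z -> `|cim z| != T') /\ S T' = S T.
Proof.
move=> t0T.
have [T1 T1T HT1] : exists2 T1, T1 < T & forall z, S T z -> `|cim z| <= T1.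
  have fS := poles_below_finite T.
  have [|T1 T1T H] := @seq_lt_max (fun z => `|cim z|) T (finmap.enum_fset (fset_set (S T))).
    by move=> z; rewrite in_fset_set // => /set_mem[_ []].
  by exists T1 => // z Sz; apply: H; rewrite in_fset_set //; exact/mem_set.
have mT : Num.max t0 T1 < T by rewrite gt_max t0T.
have [T' /andP[]] := exists_height mer mT; rewrite gt_max => /andP[t0T' T1T'] T'T nP.
exists T'; first by rewrite t0T'.
split => //; apply/seteqP; split => z [Pz [u v]]; split => //; split => //.
  exact: lt_trans T'T.
by apply: le_lt_trans T1T'; exact: HT1.
Qed.

Lemma residue_generic T : 0 < T -> (forall z, P z -> `|cim z| != T) ->
  rectint I sl sr (- T) T = rc (2 * pi) * ci * \sum_(z \in S T) Res I z.
Proof.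
move=> T0 nP; rewrite fsbig_finite; last exact: poles_below_finite.
apply: residue_rect; [exact: ltW|lra|exact: finmap.fset_uniq| |].
  move=> z; rewrite in_fset_set; last exact: poles_below_finite.
  by move=> /set_mem[Pz [u]]; rewrite ltr_norml /inside u.
move=> z /andP[/andP[u1 u2] v] zS; apply: holoI.
  by rewrite (lt_le_trans asl u1) (le_lt_trans u2 srb).
move=> Pz; move/negP: zS; apply; rewrite in_fset_set; last exact: poles_below_finite.
apply/mem_set; split => //; split.
  by rewrite !lt_neqAle u1 u2 eq_sym Psl // Psr.
by rewrite lt_neqAle nP // ler_norml v.
Qed.

Hypothesis decay : forall e : R, 0 < e -> exists T0 : R, forall T : R, T0 < T ->
  (forall rho, P rho -> `|cim rho| != T) ->
  (\int[mu]_(x in `[sl, sr]%classic) (cabs (I (Complex x T)))%:E < e%:E)%E /\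
  (\int[mu]_(x in `[sl, sr]%classic) (cabs (I (Complex x (- T))))%:E < e%:E)%E.
Hypothesis Isl : cintegrable setT (fun t => I (Complex sl t)).
Hypothesis Isr : cintegrable setT (fun t => I (Complex sr t)).

Lemma contour_shift_eps (e : R) : 0 < e -> exists T0, forall T, T0 < T ->
  cabs (rc (2 * pi) * ci * \sum_(z \in S T) Res I z - (vline_int sr I - vline_int sl I)) <= e.
Proof.
move=> e0; have e4 : 0 < e / 4 by rewrite divr_gt0.
have [T1 H1] := decay e4; have [T2 H2] := cintegral_tail Isl e4.
have [T3 H3] := cintegral_tail Isr e4.
pose t0 := Num.max (Num.max 0 T1) (Num.max T2 T3).
(* The limit runs over all T, whereas decay and the residue theorem need a height free of poles: T
   is replaced by a slightly smaller T', still above [t0], with the same residue sum. Each of the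
   four sides then costs e / 4. *)
exists t0 => T /poles_below_generic[T' /andP[]].
rewrite !gt_max => /andP[/andP[T'0 T'1] /andP[T'2 T'3]] _ [nP <-].
have nPm z : P z -> `|- cim z| != T' by rewrite normrN; exact: nP.
rewrite -(residue_generic T'0 nP) /rectint.
have [h1 h2] := H1 _ T'1 nP; have v2 := H2 _ T'2; have v3 := H3 _ T'3.
have hb y : (forall x, sl <= x <= sr -> ~ P (Complex x y)) ->
    (\int[mu]_(x in `[sl, sr]%classic) (cabs (I (Complex x y)))%:E < (e / 4)%:E)%E ->
    cabs (hint I y sl sr) <= e / 4.
  move=> nPy h; rewrite -lee_fin; apply: le_trans (ltW h).
  apply: cabs_cintegral_lee; first exact: measurable_itv.
  apply: ccont_integrable => x xx; apply/ccont_h/holo_ccf/holoI; last exact: nPy.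
  by rewrite cE; move/andP: xx => [u v]; rewrite (lt_le_trans asl u) (le_lt_trans v srb).
have b1 : cabs (hint I T' sl sr) <= e / 4.
  by apply: hb => // x _ /nP; rewrite cE ger0_norm ?eqxx // ltW.
have b2 : cabs (hint I (- T') sl sr) <= e / 4.
  by apply: hb => // x _ /nP; rewrite cE normrN ger0_norm ?eqxx // ltW.
have v2' : cabs (vint I sl (- T') T' - vline_int sl I) <= e / 4.
  by rewrite /vint /vline_int -mulrBr cabsM cabs_ci mul1r.
have v3' : cabs (vint I sr (- T') T' - vline_int sr I) <= e / 4.
  by rewrite /vint /vline_int -mulrBr cabsM cabs_ci mul1r.
move: (hint I T' _ _) (hint I (- T') _ _) (vint I sl _ _) (vint I sr _ _) b1 b2 v2' v3' => p q u v b1 b2 v2' v3'.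
have -> : q + v - p - u - (vline_int sr I - vline_int sl I) =
    (q - p) + ((v - vline_int sr I) - (u - vline_int sl I)) by ring.
rewrite (_ : e = (e / 4 + e / 4) + (e / 4 + e / 4)); last by field.
by rewrite (le_trans (cabsD _ _)) // lerD // (le_trans (cabsB _ _)) // lerD.
Qed.

Lemma contour_shift :
  (\sum_(z \in S T) Res I z) @[T --> +oo] -->
  (rc (2 * pi) * ci)^-1 * (vline_int sr I - vline_int sl I).
Proof.
have w0 : rc (2 * pi) * ci != 0 :> R[i] by exact: twopii_neq0.
have c0 : 0 < cabs (rc (2 * pi) * ci : R[i]) by rewrite cabs_gt0.
apply/cvgrPdist_le => eta eta0.
have eE : eta = rc (cre eta) by apply: eqC; rewrite ?cE //; move: eta0; rewrite ltcE => /andP[/eqP].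
have eta0' : 0 < cre eta by rewrite -lt_rc -eE.
have [T0 HT] := contour_shift_eps (mulr_gt0 eta0' c0).
near=> T; rewrite eE cabsE le_rc.
have TT : T0 < T by near: T; apply: nbhs_pinfty_gt; exact: num_real.
rewrite -(ler_pM2r c0) -cabsM mulrBl -cabsN opprB; apply: le_trans (HT _ TT).
by rewrite [_ * (rc _ * _)]mulrC [_^-1 * _]mulrC divfK.
Unshelve. all: by end_near.
Qed.

End Shift.

(** * Absence of poles on the line Re s = c *)

Section NoPole.
Variable R : realType.
Notation mu := (@lebesgue_measure R).
Notation RR := (measurableTypeR R).

(** The exceptional points have real part an integer at most -1 or an even integer, and no such
    number lies strictly between -1 and 0. *)
Lemma Kpole_line (c y : R) : -1 < c < 0 -> ~ Kpole (Complex c y).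
Proof.
move=> /andP[c1 c0] [[n] /(congr1 (@cre R))|[k] /(congr1 (@cre R))]; rewrite !cE => E.
  by move: c1; rewrite E ltrN2 ltNge (ler_nat _ 1).
have k0 : k%:~R < 0 :> R by lra.
have : k%:~R <= (-1)%:~R :> R by rewrite ler_int; move: k0; rewrite ltrz0; case: k {E} => // -[].
by move: c1; rewrite E; lra.
Qed.

(** A pole makes |I| exceed any bound nearby in every direction, in particular along the line, where
    |I| is at most [M] times the modulus of 1 / D0 times the integral [W] of |Phi(y)| y^(-c-1). *)
Lemma line_pole_free (Phi : R -> R[i]) (c m a b : R) (I : R[i] -> R[i]) (P : set R[i]) :
  cmeasurable `]0, +oo[ Phi -> -1 < c < 0 ->
  (\int[mu]_(y in `]0%R, +oo[%classic) (cabs (Phi y) * powR y (- c - 1))%:E < +oo)%E ->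
  0 < m -> a < c < b -> meromorphic_on (strip a b) I P ->
  (forall s, strip a b s -> ~ P s -> ~ Kpole s -> Mellin_abs Phi (- s) -> I s = Iform Phi m s) ->
  forall z, P z -> cre z != c.
Proof.
move=> mPhi c10 iPhi m0 acb mer Ieq z Pz; apply/eqP => zc.
have [M HM] := Kfun_bounded c10 m0.
pose E : set RR := [set` `]0, +oo[%R]; have mE : measurable E by exact: measurable_itv.
pose W := Rintegral mu E (fun y => cabs (Phi y) * powR y (- c - 1)).
have HW y : cabs (Mellin Phi (- Complex c y)) <= W.
  apply: (cabs_cintegral_dom mE (Mellin_line mPhi iPhi y) (integrable_weight mPhi iPhi)) => t.
  rewrite /E /= in_itv /= andbT => t0.
  by rewrite cabsM cabs_cpow // mulrC !cE.
have HI y : cabs (Iform Phi m (Complex c y)) <= cabs (D0 Phi)^-1 * M * W.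
  rewrite (_ : Iform _ _ _ = (D0 Phi)^-1 * (Kfun (Complex c y) * cpow m (- Complex c y)) *
     Mellin Phi (- Complex c y)); last by rewrite /Iform; ring.
  by rewrite cabsM ler_pM ?cabs_ge0 // cabsM ler_wpM2l ?cabs_ge0.
have [r r0 Hr] := pole_isolated mer (pole_strip mer Pz).
case: (mer) => _ _ _ _ /(_ _ Pz (cabs (D0 Phi)^-1 * M * W))[d d0 Hd].
(* The test point z + i e stays on the line, inside the isolating disc, so it is no pole and the
   explicit formula holds there; it is also within [d], where |I| exceeds its bound. *)
pose e := Num.min r d / 2; have rd : 0 < Num.min r d by rewrite lt_min r0.
have e0 : 0 < e by rewrite divr_gt0.
have : e < Num.min r d by rewrite /e; lra.
rewrite lt_min => /andP[er ed].
have D : cabs (Complex c (cim z + e) - z) = e.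
  rewrite (_ : _ - z = ci * rc e); first by rewrite cabsM cabs_ci mul1r cabs_rc gtr0_norm.
  by apply: eqC; rewrite !cE ?zc; ring.
have [sc nP] : a < cre (Complex c (cim z + e)) < b /\ ~ P (Complex c (cim z + e)).
  by apply: Hr; rewrite D e0.
have := Hd (Complex c (cim z + e)); rewrite D e0 ed => /(_ isT); rewrite ltNge => /negP; apply.
rewrite Ieq //; first exact: Kpole_line.
exact: Mellin_line.
Qed.

End NoPole.

(** * The two expansions, the estimate of the line integrals and the residue formula *)

Theorem theorem2 (R : realType) (Phi : R -> R[i]) (c m a b : R)
    (I : R[i] -> R[i]) (P : set R[i]) :
  cmeasurable `]0, +oo[ Phi ->
  -1 < c < 0 ->
  cintegrable `]0, +oo[ (fun y => Phi y / rc y) ->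
  D0 Phi != 0 ->
  (\int[@lebesgue_measure R]_(y in `]0%R, +oo[%classic)
      (cabs (Phi y) * powR y (- c - 1))%:E < +oo)%E ->
  0 < m ->
  a < c -> c < b ->
  (* (1) I is a meromorphic continuation of I(s; mu) to a < Re s < b *)
  meromorphic_on (strip a b) I P ->
  (forall s, strip a b s -> ~ P s -> ~ Kpole s -> Mellin_abs Phi (- s) ->
     I s = Iform Phi m s) ->
  (* (2) *)
  (forall sigma, a < sigma < b -> (forall rho, P rho -> cre rho != sigma) ->
     (A_int I m sigma < +oo)%E) ->
  (* (3) *)
  (forall s1 s2, a < s1 -> s1 < s2 -> s2 < b ->
     forall e : R, 0 < e -> exists T0 : R, forall T : R, T0 < T ->
       (forall rho, P rho -> `|cim rho| != T) ->
       (\int[@lebesgue_measure R]_(x in `[s1, s2]%classic) (cabs (I (Complex x T)))%:E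
          < e%:E)%E /\
       (\int[@lebesgue_measure R]_(x in `[s1, s2]%classic) (cabs (I (Complex x (- T))))%:E
          < e%:E)%E) ->
  [/\ (forall sm sp, a < sm -> sm < c -> c < sp -> sp < b ->
         (forall rho, P rho -> cre rho != sm) ->
         (forall rho, P rho -> cre rho != sp) ->
         ((\sum_(rho \in [set rho | P rho /\ sm < cre rho < c /\ `|cim rho| < T])
              Res I rho) @[T --> +oo]
            --> Sfun Phi m - (rc (2 * pi) * ci)^-1 * vline_int sm I) /\
         ((\sum_(rho \in [set rho | P rho /\ c < cre rho < sp /\ `|cim rho| < T])
              Res I rho) @[T --> +oo]
            --> (rc (2 * pi) * ci)^-1 * vline_int sp I - Sfun Phi m)),
      (forall sigma, a < sigma < b -> (forall rho, P rho -> cre rho != sigma) ->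
         cabs ((rc (2 * pi) * ci)^-1 * vline_int sigma I)
           <= powR m (- sigma) / (2 * pi) * fine (A_int I m sigma)) &
      (forall rho (k : nat) (al : nat -> R[i]), P rho -> (0 < k)%N ->
         al k != 0 ->
         (exists M : R, exists2 d : R, 0 < d & forall s,
            0 < cabs (s - rho) < d ->
            cabs (D0 Phi * I s * cpow m s
                  - \sum_(1 <= j < k.+1) al j / (s - rho) ^+ j) <= M) ->
         Res I rho = cpow m (- rho) *
           ((D0 Phi)^-1 * \sum_(1 <= j < k.+1)
               al j * rc ((- ln m) ^+ j.-1 / (j.-1)`!%:R)))].
Proof.
move=> mPhi c10 iP1 D0n0 iPhi m0 ac cb mer Ieq h2 h3.
have acb : a < c < b by rewrite ac.
have Pc := line_pole_free mPhi c10 iPhi m0 acb mer Ieq.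
(* Every point of the line is admissible for [Ieq]: it is neither a pole of I nor an exceptional
   point of [Kfun], and the Mellin integral converges absolutely. *)
have Ic : (rc (2 * pi) * ci)^-1 * vline_int c I = Sfun Phi m.
  have E : cintegral setT (fun t => I (Complex c t)) = rc (2 * pi) * Sfun Phi m.
    rewrite -(cintegral_Iform c10 m0 mPhi iPhi D0n0); apply: eq_cintegral => t _.
    apply: Ieq; [exact: acb|by move=> /Pc; rewrite cE eqxx| |exact: Mellin_line].
    exact: Kpole_line.
  rewrite /vline_int E [ci * _]mulrA [ci * _]mulrC mulKf //; exact: twopii_neq0.
have Il x : a < x < b -> (forall z, P z -> cre z != x) -> cintegrable setT (fun t => I (Complex x t)).
  by move=> xab Px; have [] := line_integrable mer m0 xab Px (h2 _ xab Px).
have icl := Il _ acb Pc.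
split.
(* The line Re s = c is the right side of the rectangles for the first expansion and the left side
   for the second, whence the opposite signs. *)
- move=> sm sp asm smc csp spb Psm Psp.
  have Im : a < sm < b by rewrite asm (lt_trans smc).
  have Ip : a < sp < b by rewrite spb andbT (lt_trans ac).
  rewrite -Ic -!(mulrBr (_ * _)^-1); split.
    exact: (contour_shift mer asm smc cb Psm Pc (h3 _ _ asm smc cb) (Il _ Im Psm) icl).
  exact: (contour_shift mer ac csp spb Pc Psp (h3 _ _ ac csp spb) icl (Il _ Ip Psp)).
- move=> x xab Px; have [_ B] := line_integrable mer m0 xab Px (h2 _ xab Px).
  have p2 : 0 < 2 * pi :> R by rewrite mulr_gt0 // pi_gt0.
  rewrite /vline_int cabsM cabsV !cabsM cabs_ci mul1r mulr1 cabs_rc (gtr0_norm p2).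
  by rewrite mulrC mulrAC ler_wpM2r // invr_ge0 ltW.
move=> z k al Pz k0 alk [M [d d0 H]].
have [r r0 Hr] := pole_isolated mer (pole_strip mer Pz).
apply: (Res_polar_part D0n0 d0 r0 _ H) => s /Hr[u v]; exact/holo_ccf/(holo_off mer).
Qed.
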